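(* Let $\mathbf{N}\in\mathbb{R}^{n\times p}$ have independent entries with zero mean and uniformly bounded fourth moments. Let $\boldsymbol{\pi}_1,\dots,\boldsymbol{\pi}_p\in\{0,1\}^{n\times n}$ be i.i.d. uniformly random permutation matrices, independent of $\mathbf{N}$, and let $\mathbf{N}_\pi=[\boldsymbol{\pi}_1\mathbf{N}_{:1},\dots,\boldsymbol{\pi}_p\mathbf{N}_{:p}]\in\mathbb{R}^{n\times p}$ be the permuted noise, where $\mathbf{N}_{:j}$ is the $j$-th column of $\mathbf{N}$. Let $\bar{\mathbf{N}}\in\mathbb{R}^{n\times p}$ be the homogenized noise matrix with independent entries $\bar N_{ij}\sim\mathcal{N}(0,v_j)$, where $v_j=\frac1n\sum_{m=1}^n\mathbb{E}|N_{mj}|^2$. Then, as $n,p\to\infty$ with $p/n\to\gamma>0$, the empirical singular value distribution of $\mathbf{N}_\pi/\sqrt n$ converges to the same almost sure weak limit as that of $\bar{\mathbf{N}}/\sqrt n$, as long as the empirical distribution of the column-wise variances $v_1,\dots,v_p$ converges to some deterministic distribution $H$. In particular, the empirical singular value distributions of $\mathbf{N}_\pi/\sqrt n$ and $\bar{\mathbf{N}}/\sqrt n$ both converge to the generalized Marchenko–Pastur distribution defined by $H$.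
   Context: ''Uniformly bounded fourth moments'' means $\sup_{n,p}\max_{i,j}\mathbb{E}|N_{ij}|^4<\infty$. Convergence of distributions is weak convergence. The empirical singular value distribution of an $n\times p$ matrix $\mathbf{A}$ is the uniform probability distribution on the square roots of the $n$ eigenvalues (with multiplicity) of $\mathbf{A}\mathbf{A}^\top$. That it converges (almost surely, weakly) to the generalized Marchenko–Pastur distribution defined by $H$ (with aspect ratio limit $\gamma$) means that the empirical spectral distribution of $\mathbf{A}\mathbf{A}^\top$ converges almost surely weakly to the probability distribution on $[0,\infty)$ whose Stieltjes transform $m(z)=\int\frac{1}{x-z}\,d\mu(x)$ is the unique solution in $\mathbb{C}^+=\{z:\operatorname{Im}z>0\}$ of $$z+\frac1{m(z)}=\gamma\int\frac{t\,dH(t)}{1+t\,m(z)},\qquad z\in\mathbb{C}^+.$$ *)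

(* Defs.v *)
From HB Require Import structures.
From mathcomp Require Import all_boot all_order all_algebra all_fingroup.
From mathcomp Require Import complex.
From mathcomp Require Import all_classical all_reals all_analysis.

Set Implicit Arguments.
Unset Strict Implicit.
Unset Printing Implicit Defensive.

Import Order.TTheory GRing.Theory Num.Theory.
Import numFieldNormedType.Exports.

Local Open Scope classical_set_scope.
Local Open Scope complex_scope.
Local Open Scope ring_scope.

(* [F i] is the family of events observable through the i-th object. *)
Definition mutually_independent d (T : measurableType d) (R : realType)
    (P : probability T R) (I : finType) (F : I -> set (set T)) : Prop :=
  forall (J : {set I}) (E : I -> set T),
    (forall i, i \in J -> F i (E i)) ->
    P (\bigcap_(i in [set` J]) E i) = (\prod_(i in J) P (E i))%E.

Definition independent_families d (T : measurableType d) (R : realType)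
    (P : probability T R) (F G : set (set T)) : Prop :=
  forall A B, F A -> G B -> P (A `&` B) = (P A * P B)%E.

Definition sigma_RV d (T : measurableType d) (R : realType)
    (X : T -> R) : set (set T) :=
  preimage_set_system setT X (measurable : set (set R)).

(* [U] carries the discrete sigma-algebra. *)
Definition sigma_discrete d (T : measurableType d) (U : Type)
    (X : T -> U) : set (set T) :=
  preimage_set_system setT X [set: set U].

Definition sigma_joint d (T : measurableType d) (I : Type)
    (F : I -> set (set T)) : set (set T) := <<s \bigcup_i F i >>.

Definition abs_moment d (T : measurableType d) (R : realType)
    (P : probability T R) (X : {RV P >-> R}) (k : nat) : \bar R :=
  'E_P[(fun t => `|X t| ^+ k)%R].

Definition uniform_perm d (T : measurableType d) (R : realType)
    (P : probability T R) n (s : T -> 'S_n) : Prop :=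
  forall sigma : 'S_n, measurable (s @^-1` [set sigma]) /\
    P (s @^-1` [set sigma]) = ((n`!%:R)^-1 : R)%:E.

(* [normal_prob 0 0] is not the Dirac mass at 0, hence the case split. *)
Definition centered_normal (R : realType) (v : R) : set R -> \bar R :=
  if v == 0 then \d_(0 : R) else normal_prob 0 (Num.sqrt v).

Definition has_law d (T : measurableType d) (R : realType)
    (P : probability T R) (X : {RV P >-> R}) (mu : set R -> \bar R) : Prop :=
  forall B : set R, measurable B -> distribution P X B = mu B.

(* The zero measure when [s] is empty. *)
Definition empirical_measure (R : realType) (s : seq R) :
    {measure set R -> \bar R} :=
  mscale (((size s)%:R)^-1%:nng : {nonneg R})
    (msum (fun k => \d_(nth 0 s k)) (size s)).

Definition weakly_converges (R : realType)
    (mu_ : nat -> {measure set R -> \bar R})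
    (mu : {measure set R -> \bar R}) : Prop :=
  forall f : R -> R, continuous f -> bounded_fun f ->
    \int[mu_ n]_x f x @[n --> \oo] --> \int[mu]_x f x.

Definition as_weakly_converges d (T : measurableType d) (R : realType)
    (P : probability T R) (mu_ : nat -> T -> {measure set R -> \bar R})
    (mu : {measure set R -> \bar R}) : Prop :=
  {ae P, forall t, weakly_converges (fun n => mu_ n t) mu}.

(* The eigenvalues listed with multiplicity, in an unspecified order; this is
   only meaningful when the characteristic polynomial splits over [R], which
   is the case for symmetric matrices by [eigenvaluesP] below. *)
Definition eigenvalues (R : realType) n (A : 'M[R]_n) : seq R :=
  xget [::] [set s | char_poly A = \prod_(x <- s) ('X - x%:P)].

Lemma eigenvaluesP (R : realType) n (A : 'M[R]_n) : A^T = A ->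
  char_poly A = \prod_(x <- eigenvalues A) ('X - x%:P).
Proof.
move=> Asym; rewrite /eigenvalues; case: xgetP => [s -> //|/= nosplit].
pose f : {rmorphism R -> R[i]} := real_complex R.
pose B := map_mx f A.
have Breal : B \is a realmx.
  by apply/mxOverP => i j; rewrite mxE; apply/complex_realP; exists (A i j).
have Bsym : B \is symmetricmx.
  apply/is_hermitianmxP; rewrite expr0 scale1r; apply/matrixP => i j.
  by rewrite !mxE /= -[in RHS]Asym mxE.
have Bherm := realsym_hermsym Bsym Breal.
have /mxOverP Dreal := hermitian_spectral_diag_real Bherm.
have /hermitian_normalmx/orthomx_spectralP BE := Bherm.
have Punit := spectral_unit B.
move: Dreal BE Punit; move: (spectralmx B) (spectral_diag B) => Q D Dreal BE Qu.
have charB : char_poly B = \prod_(j < n) ('X - (D 0 j)%:P).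
  rewrite [in LHS]BE /char_poly /char_poly_mx.
  pose Qp := map_mx (@polyC _) Q; pose Qi := map_mx (@polyC _) (invmx Q).
  have QiQ : Qi *m Qp = 1%:M by rewrite -map_mxM mulVmx// map_mx1.
  have -> : 'X%:M - map_mx polyC (invmx Q *m diag_mx D *m Q) =
            Qi *m ('X%:M - map_mx polyC (diag_mx D)) *m Qp.
    rewrite mulmxBr mulmxBl !map_mxM; congr (_ - _).
    by rewrite scalar_mxC -mulmxA QiQ mulmx1.
  rewrite !det_mulmx mulrC mulrA -det_mulmx.
  rewrite (mulmx1C QiQ) det1 mul1r.
  rewrite -[LHS]/(char_poly (diag_mx D)) char_poly_trig ?diag_mx_is_trig//.
  by apply: eq_bigr => i _; rewrite mxE eqxx mulr1n.
case: (nosplit [seq complex.Re (D 0 j) | j <- enum 'I_n]).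
apply/(map_poly_inj f); rewrite map_char_poly -/B charB big_map big_enum /=.
rewrite rmorph_prod; apply: eq_bigr => j _ /=.
rewrite rmorphB/= map_polyX map_polyC/=; congr (_ - _%:P).
have := Dreal 0 j; by move=> /RRe_real <-.
Qed.

Lemma size_eigenvalues (R : realType) n (A : 'M[R]_n) : A^T = A ->
  size (eigenvalues A) = n.
Proof.
by move=> /eigenvaluesP/(congr1 (fun q : {poly R} => size q));
  rewrite size_char_poly size_prod_XsubC => -[].
Qed.

Definition singular_values (R : realType) n p (A : 'M[R]_(n, p)) : seq R :=
  [seq Num.sqrt x | x <- eigenvalues (A *m A^T)].

Definition esd (R : realType) n (A : 'M[R]_n) :=
  empirical_measure (eigenvalues A).

Definition esvd (R : realType) n p (A : 'M[R]_(n, p)) :=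
  empirical_measure (singular_values A).

(* [complex.Re] and [complex.Im] take values in [R], unlike ['Re] and ['Im]. *)
Definition cintegral (R : realType) (mu : {measure set R -> \bar R})
    (f : R -> R[i]) : R[i] :=
  (\int[mu]_x complex.Re (f x)) +i* (\int[mu]_x complex.Im (f x)).

Definition stieltjes (R : realType) (mu : {measure set R -> \bar R})
    (z : R[i]) : R[i] :=
  cintegral mu (fun x => (x%:C - z)^-1).

Definition MP_equation (R : realType) (gamma : R)
    (H : {measure set R -> \bar R}) (z m : R[i]) : Prop :=
  z + m^-1 = gamma%:C * cintegral H (fun t => t%:C / (1 + t%:C * m)).

Definition MP_stieltjes (R : realType) (gamma : R)
    (H : {measure set R -> \bar R}) (mu : probability R R) : Prop :=
  mu `[0, +oo[%classic = 1%E /\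
  forall z : R[i], 0 < complex.Im z ->
    [/\ 0 < complex.Im (stieltjes mu z),
        MP_equation gamma H z (stieltjes mu z) &
        forall m : R[i], 0 < complex.Im m -> MP_equation gamma H z m ->
          m = stieltjes mu z].

(* The second conjunct accounts for the definite article in "the distribution
   whose Stieltjes transform solves the equation". *)
Definition generalized_MP (R : realType) (gamma : R)
    (H : {measure set R -> \bar R}) (mu : probability R R) : Prop :=
  MP_stieltjes gamma H mu /\
  forall mu' : probability R R, MP_stieltjes gamma H mu' ->
    forall B, measurable B -> mu' B = mu B.

Definition matrix_of d (T : measurableType d) (R : realType)
    (P : probability T R) n p (X : 'I_n -> 'I_p -> {RV P >-> R}) (t : T) :
    'M[R]_(n, p) :=
  \matrix_(i, j) X i j t.

Definition permute_columns (R : realType) n p (s : 'I_p -> 'S_n)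
    (A : 'M[R]_(n, p)) : 'M[R]_(n, p) :=
  \matrix_(i, j) (perm_mx (s j) *m col j A) i 0.

Definition column_variance d (T : measurableType d) (R : realType)
    (P : probability T R) n p (X : 'I_n -> 'I_p -> {RV P >-> R}) (j : 'I_p) :
    R :=
  n%:R^-1 * \sum_(m < n) fine (abs_moment (X m j) 2).

(* Main.v *)
Require Import Defs.
From HB Require Import structures.
From mathcomp Require Import all_boot all_order all_algebra all_fingroup.
From mathcomp Require Import complex.
From mathcomp Require Import all_classical all_reals all_analysis.
From mathcomp Require Import measurable_realfun.
From mathcomp Require Import ring lra zify.

Set Implicit Arguments.
Unset Strict Implicit.
Unset Printing Implicit Defensive.

Import Order.TTheory GRing.Theory Num.Theory.
Import numFieldNormedType.Exports.
Import Normc.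

Local Open Scope classical_set_scope.
Local Open Scope complex_scope.
Local Open Scope ring_scope.

Local Notation Re := complex.Re.
Local Notation Im := complex.Im.

(** Write [G(z)] for the resolvent of [A A^T], [m(z)] for its normalized trace,
    and [beta_j] for the quadratic form of the [j]-th column of [A] in the
    resolvent obtained by deleting that column.  The Sherman-Morrison formula
    gives [1 + z m = n^-1 \sum_j beta_j / (1 + beta_j)].  Because deleting one
    column moves [m] by [O(1 / n)], it suffices that [beta_j] concentrates around
    [v_j m]; for a column with independent entries this is orthogonality of the
    off-diagonal terms, and a uniform permutation of such a column averages the
    variances over the coordinates while making the remaining covariances
    exchangeable, so that both matrices satisfy the same approximate
    Marchenko-Pastur equation.  A bounded-difference inequality for the
    exchange of one column turns this into almost sure convergence, for
    countably many [z].  The spectral distributions are tight; each of their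
    limit points along an ultrafilter has a Stieltjes transform that solves the
    limit equation, whose solution is unique, and a measure on the nonnegative
    reals is determined by its Stieltjes transform. *)

(** Nothing relates the matrices of different sizes, so almost sure convergence has to come from
    summable moments. The leave-one-out argument only yields a second moment of order [1 / n] for
    the defect, which shows that its mean tends to 0; the fluctuation around the mean is handled
    separately, through exponential moments of a function of independent columns, at the summable
    rate [1 / n^2]. Columns are the right unit: the entries of a permuted column are dependent, and
    given the permutation they are independent with unequal variances. The bias
    [\sum_k M k k * (w (sg k) - v)] that remains is what the average over permutations controls.
    Tightness does not go through a bound on the largest eigenvalue; it is read off the approximate
    equation at [z = i y] with [y] large. Ultrafilters replace subsequences, as every bounded
    sequence converges along them, and they also produce the limit law, whose existence is proved
    together with the convergence. *)

(** * Complex moduli, and the map [w / (1 + w)] *)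

Section complex_numbers.
Variable R : rcfType.
Implicit Types (x y : R) (z w : R[i]).

Lemma normc_ge0 z : 0 <= normc z.
Proof. by case: z => a b /=; rewrite sqrtr_ge0. Qed.

Lemma normc_sqr z : normc z ^+ 2 = Re z ^+ 2 + Im z ^+ 2.
Proof. by case: z => a b /=; rewrite sqr_sqrtr// addr_ge0// sqr_ge0. Qed.

Lemma normc_real x : normc (x%:C) = `|x|.
Proof. by rewrite /= expr0n addr0 sqrtr_sqr. Qed.

Lemma Re_le_normc z : `|Re z| <= normc z.
Proof.
by case: z => a b /=; rewrite -sqrtr_sqr ler_wsqrtr// lerDl sqr_ge0.
Qed.

Lemma Im_le_normc z : `|Im z| <= normc z.
Proof.
by case: z => a b /=; rewrite -sqrtr_sqr ler_wsqrtr// lerDr sqr_ge0.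
Qed.

Lemma normc_le z : normc z <= `|Re z| + `|Im z|.
Proof.
rewrite -(ler_pXn2r (n := 2))// ?nnegrE ?normc_ge0 ?addr_ge0//.
rewrite normc_sqr sqrrD !real_normK ?num_real//.
by rewrite lerD2r lerDl mulrn_wge0// mulr_ge0.
Qed.

Lemma normc_gt0 z : (0 < normc z) = (z != 0).
Proof.
rewrite lt_def normc_ge0 andbT; congr negb; apply/eqP/eqP => [/eq0_normc//|->].
exact: normc0.
Qed.

Lemma normcB z w : normc (z - w) = normc (w - z).
Proof. by rewrite -opprB normcN. Qed.

Lemma normc_sum (I : Type) (r : seq I) (P : pred I) (F : I -> R[i]) :
  normc (\sum_(i <- r | P i) F i) <= \sum_(i <- r | P i) normc (F i).
Proof.
elim/big_ind2 : _ => //; first by rewrite normc0.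
by move=> u a v b ua vb; apply: le_trans (le_normcD _ _) _; exact: lerD.
Qed.

Lemma cReD z w : Re (z + w) = Re z + Re w.
Proof. by case: z w => [a b] [c e]. Qed.

Lemma cImD z w : Im (z + w) = Im z + Im w.
Proof. by case: z w => [a b] [c e]. Qed.

Lemma cReN z : Re (- z) = - Re z. Proof. by case: z. Qed.

Lemma cImN z : Im (- z) = - Im z. Proof. by case: z. Qed.

Lemma cReM z w : Re (z * w) = Re z * Re w - Im z * Im w.
Proof. by case: z w => [a b] [c e]. Qed.

Lemma cImM z w : Im (z * w) = Re z * Im w + Im z * Re w.
Proof. by case: z w => [a b] [c e]. Qed.

Lemma cRe_inv z : Re z^-1 = Re z / normc z ^+ 2.
Proof. by rewrite normc_sqr; case: z. Qed.

Lemma cIm_inv z : Im z^-1 = - Im z / normc z ^+ 2.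
Proof. by rewrite normc_sqr; case: z => a b /=; rewrite mulNr. Qed.

Lemma cRe_sum (I : Type) (r : seq I) (P : pred I) (F : I -> R[i]) :
  Re (\sum_(i <- r | P i) F i) = \sum_(i <- r | P i) Re (F i).
Proof. by elim/big_ind2 : _ => // ? ? ? ? <- <-; rewrite cReD. Qed.

Lemma cIm_sum (I : Type) (r : seq I) (P : pred I) (F : I -> R[i]) :
  Im (\sum_(i <- r | P i) F i) = \sum_(i <- r | P i) Im (F i).
Proof. by elim/big_ind2 : _ => // ? ? ? ? <- <-; rewrite cImD. Qed.

Lemma complex_eq z w : Re z = Re w -> Im z = Im w -> z = w.
Proof. by case: z w => [a b] [c e] /= -> ->. Qed.

Lemma Im_gt0_neq0 z : 0 < Im z -> z != 0.
Proof. by apply: contraTneq => ->; rewrite ltxx. Qed.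

Lemma cReMr x z : Re (x%:C * z) = x * Re z.
Proof. by rewrite cReM /= mul0r subr0. Qed.

Lemma cImMr x z : Im (x%:C * z) = x * Im z.
Proof. by rewrite cImM /= mul0r addr0. Qed.

(* When [z] is in the upper half-plane and [w] is the Stieltjes transform at [z]
   of a finite measure on the nonnegative reals, [z * w] has a nonnegative
   imaginary part, whence a lower bound on [1 + w]. *)
Lemma normc_1D_ge z w : 0 < Im z -> 0 <= Im (z * w) ->
  Im z / normc z <= normc (1 + w).
Proof.
move=> z0 zw0; have nz : 0 < normc z by rewrite normc_gt0 Im_gt0_neq0.
rewrite ler_pdivrMr// mulrC -normcM mulrDr mulr1.
rewrite (le_trans _ (Im_le_normc _))// (le_trans _ (ler_norm _))//.
by rewrite cImD lerDl.
Qed.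

Lemma neq0_1D z w : 0 < Im z -> 0 <= Im (z * w) -> 1 + w != 0.
Proof.
move=> z0 zw0; rewrite -normc_gt0 (lt_le_trans _ (normc_1D_ge z0 zw0))//.
by rewrite divr_gt0// normc_gt0 Im_gt0_neq0.
Qed.

(** The leave-one-out forms are unbounded in the data; on the region [0 <= Im (z * w)] the map
    [w / (1 + w)] is nevertheless Lipschitz, because both denominators have modulus at least
    [Im z / normc z]. *)
Lemma dist_div_1D z w1 w2 : 0 < Im z ->
  0 <= Im (z * w1) -> 0 <= Im (z * w2) ->
  normc (w1 / (1 + w1) - w2 / (1 + w2)) <=
  (normc z / Im z) ^+ 2 * normc (w1 - w2).
Proof.
move=> z0 h1 h2; have n1 := neq0_1D z0 h1; have n2 := neq0_1D z0 h2.
have -> : w1 / (1 + w1) - w2 / (1 + w2) = (w1 - w2) / ((1 + w1) * (1 + w2)).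
  by field; rewrite ?n1 ?n2.
rewrite normcM normcV normcM mulrC ler_wpM2r ?normc_ge0//.
have ub w : 0 <= Im (z * w) -> (normc (1 + w))^-1 <= normc z / Im z.
  move=> h; rewrite -[leRHS]invrK lef_pV2 ?posrE ?invr_gt0 ?divr_gt0//.
  - by rewrite invf_div normc_1D_ge.
  - by rewrite normc_gt0 (neq0_1D z0).
  - by rewrite normc_gt0 Im_gt0_neq0.
by rewrite invfM expr2 ler_pM// ?invr_ge0 ?normc_ge0// ub.
Qed.

End complex_numbers.

(** * Resolvents of Gram matrices *)

Section rank_one_inverse.
Variables (K : fieldType) (n : nat) (M : 'M[K]_n) (u : 'cV[K]_n) (v : 'rV[K]_n).
Hypothesis Mu : M \in unitmx.
Hypothesis Muv : M + u *m v \in unitmx.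
Let b := (v *m (invmx M *m u)) 0 0.
Hypothesis b1 : 1 + b != 0.

Let bE : v *m invmx M *m u = b%:M.
Proof. by rewrite [LHS]mx11_scalar -mulmxA. Qed.

(* Sherman-Morrison *)
Lemma invmx_rank_one : invmx (M + u *m v) =
  invmx M - (1 + b)^-1 *: (invmx M *m u *m v *m invmx M).
Proof.
rewrite -[RHS]mul1mx -(mulVmx Muv).
rewrite -mulmxA; set X := (X in _ = _ *m X); suff -> : X = 1%:M by rewrite mulmx1.
rewrite {}/X mulmxBr mulmxDl mulmxV//.
rewrite -scalemxAr mulmxDl !mulmxA mulmxV// mul1mx.
have -> : u *m v *m invmx M *m u *m v *m invmx M = b *: (u *m v *m invmx M).
  rewrite [LHS](_ : _ = u *m (v *m invmx M *m u) *m (v *m invmx M)).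
    by rewrite bE mul_mx_scalar -scalemxAl mulmxA.
  by rewrite !mulmxA.
set V := u *m v *m invmx M.
have -> : V + b *: V = (1 + b) *: V by rewrite scalerDl scale1r.
by rewrite scalerA mulVf// scale1r addrK.
Qed.

Lemma invmx_rank_one_form : (v *m (invmx (M + u *m v) *m u)) 0 0 = b / (1 + b).
Proof.
rewrite invmx_rank_one mulmxBl mulmxBr mxE -/b -scalemxAl -scalemxAr.
have -> : v *m (invmx M *m u *m v *m invmx M *m u) = (b * b)%:M.
  by rewrite scalar_mxM -bE !mulmxA.
by rewrite !mxE eqxx mulr1n -/b; field.
Qed.

Lemma mxtrace_invmx_rank_one : \tr (invmx (M + u *m v)) - \tr (invmx M) =
  - ((1 + b)^-1 * (v *m (invmx M *m invmx M) *m u) 0 0).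
Proof.
rewrite invmx_rank_one linearB /= addrAC subrr add0r mxtraceZ; congr (- (_ * _)).
rewrite -!mulmxA mxtrace_mulC -!mulmxA mxtrace_mulC -!mulmxA.
by rewrite trace_mx11.
Qed.

End rank_one_inverse.

Lemma diagonalized_invmx (K : fieldType) n (Q : 'M[K]_n) (D : 'rV[K]_n) :
  Q \in unitmx -> (forall j, D 0 j != 0) ->
  \tr (invmx (invmx Q *m diag_mx D *m Q)) = \sum_j (D 0 j)^-1.
Proof.
move=> Qu D0; pose E := diag_mx (\row_j (D 0 j)^-1).
have DE : diag_mx D *m E = 1%:M.
  rewrite mulmx_diag; apply/matrixP => i j; rewrite !mxE; congr (_ *+ _).
  by rewrite mulfV.
have MI : (invmx Q *m diag_mx D *m Q) *m (invmx Q *m E *m Q) = 1%:M.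
  rewrite !mulmxA -(mulmxA _ Q (invmx Q)) mulmxV// mulmx1.
  by rewrite -(mulmxA _ (diag_mx D)) DE mulmx1 mulVmx.
have Mu : invmx Q *m diag_mx D *m Q \in unitmx by case/mulmx1_unit : MI.
rewrite -[invmx (_ *m Q)]mulmx1 -MI mulmxA mulVmx// mul1mx.
rewrite mxtrace_mulC mulmxA mulmxV// mul1mx mxtrace_diag.
by apply: eq_bigr => j _; rewrite mxE.
Qed.

Section resolvent.
Variable R : realType.
Local Notation cmx := (map_mx (real_complex R)).
Local Notation conjmx := (map_mx (@conjc R)).

Lemma conjc_mul (w : R[i]) : w^* * w = (normc w ^+ 2)%:C.
Proof.
apply: complex_eq; rewrite ?cReM ?cImM /= ?normc_sqr; case: w => a b /=.
  by rewrite mulNr opprK !expr2.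
by rewrite mulNr mulrC subrr.
Qed.

Lemma conjmx_real m n (A : 'M[R]_(m, n)) : conjmx (cmx A) = cmx A.
Proof. by apply/matrixP => i j; rewrite !mxE conjc_real. Qed.

Lemma conjmx_tr_mul n (w : 'cV[R[i]]_n) :
  ((conjmx w)^T *m w) 0 0 = (\sum_k normc (w k 0) ^+ 2)%:C.
Proof.
rewrite mxE rmorph_sum /=; apply: eq_bigr => k _.
by rewrite !mxE conjc_mul.
Qed.

(** The list [eigenvalues S] is specified only by the characteristic polynomial, so it agrees with
    the diagonal of the spectral theorem up to order: both factor the same polynomial into linear
    terms. *)
Lemma symmetric_diagonalization n (S : 'M[R]_n) : S^T = S ->
  exists (Q : 'M[R[i]]_n) (D : 'rV[R[i]]_n), [/\ Q \in unitmx,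
    cmx S = invmx Q *m diag_mx D *m Q &
    perm_eq [seq D 0 j | j <- enum 'I_n] [seq x%:C | x <- eigenvalues S]].
Proof.
move=> Ssym; pose B := cmx S.
have Breal : B \is a realmx.
  by apply/mxOverP => i j; rewrite mxE; apply/complex_realP; exists (S i j).
have Bsym : B \is symmetricmx.
  apply/is_hermitianmxP; rewrite expr0 scale1r; apply/matrixP => i j.
  by rewrite !mxE /= -[in RHS]Ssym mxE.
have Bherm := realsym_hermsym Bsym Breal.
have /hermitian_normalmx/orthomx_spectralP BE := Bherm.
have := spectral_unit B; move: BE.
move: (spectralmx B) (spectral_diag B) => Q D BE Qu.
exists Q, D; split => //; apply/prod_XsubC_eq.
transitivity (char_poly B).
  rewrite big_map big_enum /= [in RHS]BE /char_poly /char_poly_mx.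
  pose Qp := map_mx (@polyC _) Q; pose Qi := map_mx (@polyC _) (invmx Q).
  have QiQ : Qi *m Qp = 1%:M by rewrite -map_mxM mulVmx// map_mx1.
  have -> : 'X%:M - map_mx polyC (invmx Q *m diag_mx D *m Q) =
            Qi *m ('X%:M - map_mx polyC (diag_mx D)) *m Qp.
    rewrite mulmxBr mulmxBl !map_mxM; congr (_ - _).
    by rewrite scalar_mxC -mulmxA QiQ mulmx1.
  rewrite !det_mulmx mulrC mulrA -det_mulmx.
  rewrite (mulmx1C QiQ) det1 mul1r.
  rewrite -[RHS]/(char_poly (diag_mx D)) char_poly_trig ?diag_mx_is_trig//.
  by apply: eq_bigr => i _; rewrite mxE eqxx mulr1n.
rewrite -map_char_poly (eigenvaluesP Ssym) rmorph_prod big_map /=.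
by apply: eq_bigr => x _; rewrite rmorphB/= map_polyX map_polyC.
Qed.

Section fixed_matrix.
Variables (n p : nat) (A : 'M[R]_(n, p)) (z : R[i]).
Hypothesis z0 : 0 < Im z.

Definition shifted_gram := cmx (A *m A^T) - z%:M.
Definition resolvent := invmx shifted_gram.

Lemma shifted_gram_tr : shifted_gram^T = shifted_gram.
Proof. by rewrite /shifted_gram linearB/= tr_scalar_mx matrix.map_trmx trmx_mul trmxK. Qed.

(** A real [a] equals its conjugate, so the left factor may be replaced by the conjugate of
    [shifted_gram *m w]; the form becomes [|A^T w|^2] minus the conjugate of [z] times [|w|^2]. Its
    imaginary part isolates [|w|^2], and multiplication by [z] makes the second term real, which
    leaves [Im z * |A^T w|^2]. The sign and norm bounds for the resolvent rest on these two
    readings. *)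
Lemma real_form (a : 'cV[R]_n) (w : 'cV[R[i]]_n) : shifted_gram *m w = cmx a ->
  ((cmx a)^T *m w) 0 0 =
  (\sum_j normc ((cmx A^T *m w) j 0) ^+ 2)%:C -
  z^* * (\sum_k normc (w k 0) ^+ 2)%:C.
Proof.
move=> wa; rewrite -(conjmx_real a) -wa map_mxM -!conjmx_tr_mul.
rewrite trmx_mul !matrix.map_trmx shifted_gram_tr /shifted_gram.
rewrite map_mxB conjmx_real map_scalar_mx /= mulmxBr mulmxBl.
rewrite [LHS]mxE [X in _ + X]mxE; congr (_ - _).
  by rewrite trmx_mul !map_mxM matrix.map_trmx trmxK conjmx_real !mulmxA.
rewrite mul_mx_scalar -scalemxAl [LHS]mxE.
by [].
Qed.

Lemma Im_real_form (a : 'cV[R]_n) (w : 'cV[R[i]]_n) :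
  shifted_gram *m w = cmx a ->
  Im (((cmx a)^T *m w) 0 0) = Im z * \sum_k normc (w k 0) ^+ 2.
Proof.
move=> wa; rewrite (real_form wa) cImD cImN cImM /=.
by case: (z) => x y /=; rewrite mulr0 !add0r mulNr opprK.
Qed.

Lemma Im_mul_real_form (a : 'cV[R]_n) (w : 'cV[R[i]]_n) :
  shifted_gram *m w = cmx a -> 0 <= Im (z * ((cmx a)^T *m w) 0 0).
Proof.
move=> wa; rewrite (real_form wa); set U : R := \sum_j _; set S : R := \sum_k _.
have U0 : 0 <= U by apply: sumr_ge0 => j _; exact: sqr_ge0.
have -> : Im (z * (U%:C - z^* * S%:C)) = Im z * U.
  by case: (z) => x y /=; ring.
by rewrite mulr_ge0// ltW.
Qed.

(** A kernel vector solves the equation with [a = 0], and the imaginary part of the form then forces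
    [Im z * |w|^2 = 0]. *)
Lemma shifted_gram_unit : shifted_gram \in unitmx.
Proof.
rewrite unitmxE unitfE; apply/det0P => -[v v0 vM].
have : shifted_gram *m v^T = cmx 0.
  by rewrite -shifted_gram_tr -trmx_mul vM trmx0 map_mx0.
move/Im_real_form; rewrite map_mx0 trmx0 mul0mx mxE /= => /esym/eqP.
rewrite mulf_eq0 gt_eqF//= psumr_eq0 => [/allP v00|k _]; last exact: sqr_ge0.
move/negP: v0; apply; apply/eqP/matrixP => i j; rewrite !ord1 !mxE.
have := v00 j (mem_index_enum _); rewrite mxE sqrf_eq0 => /eqP.
exact: eq0_normc.
Qed.

Lemma mul_shifted_gram_resolvent : shifted_gram *m resolvent = 1%:M.
Proof. by rewrite mulmxV// shifted_gram_unit. Qed.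

Lemma resolvent_tr : resolvent^T = resolvent.
Proof. by rewrite /resolvent trmx_inv shifted_gram_tr. Qed.

Definition resolvent_form (a : 'cV[R]_n) : R[i] :=
  ((cmx a)^T *m (resolvent *m cmx a)) 0 0.

Lemma shifted_gram_resolventK (a : 'cV[R]_n) :
  shifted_gram *m (resolvent *m cmx a) = cmx a.
Proof. by rewrite mulmxA mul_shifted_gram_resolvent mul1mx. Qed.

Lemma Im_resolvent_form a : Im (resolvent_form a) =
  Im z * \sum_k normc ((resolvent *m cmx a) k 0) ^+ 2.
Proof. by apply: Im_real_form; rewrite shifted_gram_resolventK. Qed.

Lemma Im_mul_resolvent_form a : 0 <= Im (z * resolvent_form a).
Proof. by apply: Im_mul_real_form; rewrite shifted_gram_resolventK. Qed.

(** The resolvent [G] is symmetric rather than Hermitian: [a^T G^2 a] is the sum of the squares of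
    the entries of [G a], so its modulus is at most the sum of their squared moduli, which is
    [Im (resolvent_form a) / Im z]. *)
Lemma resolvent_sqr_form_le (a : 'cV[R]_n) :
  normc (((cmx a)^T *m (resolvent *m resolvent) *m cmx a) 0 0) <=
  Im (resolvent_form a) / Im z.
Proof.
rewrite Im_resolvent_form mulrAC divff ?gt_eqF// mul1r.
rewrite -{1}resolvent_tr !mulmxA -trmx_mul -mulmxA mxE.
apply: le_trans (normc_sum _ _ _) _; apply: ler_sum => k _.
by rewrite mxE normcM expr2.
Qed.

Lemma delta_mx_resolvent_form (l : 'I_n) :
  resolvent_form (delta_mx l 0) = resolvent l l.
Proof.
rewrite /resolvent_form map_delta_mx trmx_delta mulmxA -rowE -colE.
by rewrite !mxE.
Qed.

(** Let [S] be the sum of the squared moduli in column [l]. Then [Im z * S] is the imaginary part of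
    the diagonal entry of that column, whose squared modulus is itself a term of [S]. Hence
    [(Im z * S)^2 <= S], and each column contributes at most [(Im z)^-2]. *)
Lemma resolvent_entries_sum_le :
  \sum_k \sum_l normc (resolvent k l) ^+ 2 <= n%:R / Im z ^+ 2.
Proof.
rewrite exchange_big /=.
apply: (@le_trans _ _ (\sum_(l < n) (Im z ^+ 2)^-1)); last first.
  by rewrite sumr_const card_ord mulrC mulr_natr.
apply: ler_sum => l _.
have := Im_resolvent_form (delta_mx l 0); rewrite delta_mx_resolvent_form.
under [X in _ = _ * X -> _]eq_bigr => k _.
  rewrite map_delta_mx -colE mxE.
  over.
set S := \sum_k _ => GS; have S0 : 0 <= S by apply: sumr_ge0=> *; exact: sqr_ge0.
have : (Im z * S) ^+ 2 <= S.
  rewrite -GS (@le_trans _ _ (normc (resolvent l l) ^+ 2))//.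
    by rewrite normc_sqr lerDr sqr_ge0.
  by rewrite /S (bigD1 l)//= lerDl; apply: sumr_ge0 => *; exact: sqr_ge0.
move=> h; have [->|Sn] := eqVneq S 0; first by rewrite invr_ge0 sqr_ge0.
have Sp : 0 < S by rewrite lt_def Sn.
rewrite -[leRHS]mulr1 ler_pdivlMl ?exprn_gt0//.
by move: h; rewrite exprMn [S ^+ 2]expr2 mulrA ger_pMl.
Qed.

Lemma eigenvalues_gram_ge0 x : x \in eigenvalues (A *m A^T) -> 0 <= x.
Proof.
move=> xs; have Asym : (A *m A^T)^T = A *m A^T by rewrite trmx_mul trmxK.
have : root (char_poly (A *m A^T)) x.
  by rewrite (eigenvaluesP Asym) root_prod_XsubC.
rewrite -eigenvalue_root_char => /eigenvalueP[v vA v0].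
have sqE m (u : 'rV[R]_m) : (u *m u^T) 0 0 = \sum_j u 0 j ^+ 2.
  by rewrite mxE; apply: eq_bigr => j _; rewrite mxE expr2.
have : ((v *m A) *m (v *m A)^T) 0 0 = x * (v *m v^T) 0 0.
  by rewrite trmx_mul mulmxA -(mulmxA v) vA -scalemxAl mxE.
rewrite !sqE => h; rewrite -(@pmulr_lge0 _ (\sum_j v 0 j ^+ 2)).
  by rewrite -h; apply: sumr_ge0 => j _; exact: sqr_ge0.
rewrite lt_def sumr_ge0 => [|j _]; last exact: sqr_ge0.
rewrite andbT psumr_eq0 => [|j _]; last exact: sqr_ge0.
apply: contra v0 => /allP v00; apply/eqP/matrixP => i j; rewrite ord1 mxE.
by have := v00 j (mem_index_enum _); rewrite sqrf_eq0 => /eqP.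
Qed.

Lemma mxtrace_resolvent :
  \tr resolvent = \sum_(x <- eigenvalues (A *m A^T)) (x%:C - z)^-1.
Proof.
have Asym : (A *m A^T)^T = A *m A^T by rewrite trmx_mul trmxK.
have [Q [D [Qu BE pe]]] := symmetric_diagonalization Asym.
have shiftE : shifted_gram = invmx Q *m diag_mx (\row_j (D 0 j - z)) *m Q.
  have -> : diag_mx (\row_j (D 0 j - z)) = diag_mx D - z%:M.
    by apply/matrixP => i j; rewrite !mxE; case: eqVneq => [->|_] /=;
      rewrite ?mulr1n ?mulr0n ?subr0.
  rewrite mulmxBr mulmxBl -BE; congr (_ - _).
  by rewrite -mulmxA -scalar_mxC mulmxA mulVmx// mul1mx.
have Dz j : D 0 j - z != 0.
  have : D 0 j \in [seq D 0 j | j <- enum 'I_n].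
    by apply: map_f; rewrite mem_enum.
  rewrite (perm_mem pe) => /mapP[x _ ->]; apply/eqP => /(congr1 (@complex.Im R)).
  by rewrite cImD cImN /= add0r => /eqP; rewrite oppr_eq0 gt_eqF.
rewrite /resolvent shiftE diagonalized_invmx// => [|j]; last by rewrite mxE.
rewrite -(big_map (fun x => x%:C) predT (fun x => (x - z)^-1)) /=.
rewrite -(perm_big _ pe)/= big_map big_enum /=.
by apply: eq_bigr => j _; rewrite mxE.
Qed.

End fixed_matrix.

Section rank_one_update.
Variables (n p q : nat) (A : 'M[R]_(n, p)) (A' : 'M[R]_(n, q)).
Variables (a : 'cV[R]_n) (z : R[i]).
Hypothesis z0 : 0 < Im z.
Hypothesis AA' : A *m A^T = A' *m A'^T + a *m a^T.

Let b := resolvent_form A' z a.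
Let ac := cmx a.

Let b1 : 1 + b != 0.
Proof. by apply: (neq0_1D z0); exact: Im_mul_resolvent_form. Qed.

Let shifted_gramD : shifted_gram A z = shifted_gram A' z + ac *m ac^T.
Proof.
rewrite /shifted_gram AA' map_mxD addrAC; congr (_ + _).
by rewrite map_mxM matrix.map_trmx.
Qed.

Let shifted_unit := shifted_gram_unit A z0.
Let shifted_unit' := shifted_gram_unit A' z0.

Lemma resolvent_form_rank_one : resolvent_form A z a = b / (1 + b).
Proof.
move: shifted_unit; rewrite /resolvent_form /resolvent shifted_gramD => u.
by rewrite invmx_rank_one_form.
Qed.

(** The bound is uniform in [a]: up to sign the change of trace is [a^T G^2 a / (1 + b)] with [G]
    the resolvent of [A'], the numerator is at most [Im b / Im z], and [Im b = Im (1 + b)] is at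
    most the modulus of the denominator. *)
Lemma mxtrace_resolvent_rank_one :
  normc (\tr (resolvent A z) - \tr (resolvent A' z)) <= (Im z)^-1.
Proof.
move: shifted_unit; rewrite /resolvent shifted_gramD => u.
rewrite mxtrace_invmx_rank_one// normcN normcM normcV.
have [b0|bn0] := eqVneq (Im b) 0.
  suff -> : normc ((ac^T *m (resolvent A' z *m resolvent A' z) *m ac) 0 0) = 0.
    by rewrite mulr0 invr_ge0 ltW.
  apply/eqP; rewrite eq_le normc_ge0 andbT.
  rewrite (le_trans (resolvent_sqr_form_le _ z0 _))//.
  by rewrite -/b b0 mul0r.
rewrite ler_pdivrMl ?normc_gt0//.
apply: le_trans (resolvent_sqr_form_le _ z0 _) _.
rewrite ler_wpM2r ?invr_ge0 ?(ltW z0)//.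
have -> : Im b = Im (1 + b) by rewrite cImD add0r.
by apply: le_trans (ler_norm _) _; exact: Im_le_normc.
Qed.

End rank_one_update.
End resolvent.

(** * Replacement of a single column *)

Section replace_column.
Variable R : pzRingType.

(** Zeroing a column, instead of deleting it, keeps all matrices in one type. The equation
    [replace_col k A 0 = replace_col k B 0] expresses that [A] and [B] differ at most in column
    [k]. *)
Definition replace_col n p (k : 'I_p) (A A' : 'M[R]_(n, p)) : 'M[R]_(n, p) :=
  \matrix_(i, j) if j == k then A' i j else A i j.

Lemma replace_colE n p (k : 'I_p) (A A' : 'M[R]_(n, p)) i j :
  replace_col k A A' i j = if j == k then A' i j else A i j.
Proof. by rewrite mxE. Qed.

Lemma replace_colK n p (k : 'I_p) (A A' B : 'M[R]_(n, p)) :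
  replace_col k (replace_col k A A') B = replace_col k A B.
Proof. by apply/matrixP => i j; rewrite !mxE; case: (j == k). Qed.

Lemma replace_colZ n p (k : 'I_p) (c : R) (A A' : 'M[R]_(n, p)) :
  replace_col k (c *: A) (c *: A') = c *: replace_col k A A'.
Proof. by apply/matrixP => i j; rewrite !mxE; case: (j == k). Qed.

Lemma gram_replace_col0 n p (k : 'I_p) (A : 'M[R]_(n, p)) :
  A *m A^T = replace_col k A 0 *m (replace_col k A 0)^T + col k A *m (col k A)^T.
Proof.
apply/matrixP => i l; rewrite !mxE (bigD1 k)//= [X in _ = X + _](bigD1 k)//=.
rewrite !mxE eqxx mul0r add0r big_ord1 !mxE addrC; congr (_ + _).
by apply: eq_bigr => j /negPf jk; rewrite !mxE jk.
Qed.

End replace_column.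

(** * The defect in the Marchenko-Pastur equation of a fixed matrix *)

Section MP_defect.
Variable R : realType.
Local Notation cmx := (map_mx (real_complex R)).
Variables (n p : nat) (z : R[i]).
Hypothesis z0 : 0 < Im z.
Implicit Types A B : 'M[R]_(n, p).

Definition gram_stieltjes A : R[i] := \tr (resolvent A z) / n%:R.

Definition loo_form A (j : 'I_p) : R[i] :=
  resolvent_form (replace_col j A 0) z (col j A).

(** The Marchenko-Pastur equation for the empirical distribution of [v] and the ratio [p / n],
    multiplied by [m]. In this form nothing is divided by [m], and the integral is an average of the
    Lipschitz map [w / (1 + w)]. *)
Definition MP_defect (v : 'I_p -> R) A : R[i] := let m := gram_stieltjes A in
  1 + z * m - n%:R^-1 * \sum_j (v j)%:C * m / (1 + (v j)%:C * m).

Let y := Im z.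
Let kappa := normc z / y.

Let nz : 0 < normc z. Proof. by rewrite normc_gt0 Im_gt0_neq0. Qed.
Let kappa_gt0 : 0 < kappa. Proof. exact: divr_gt0. Qed.

Lemma normc_natrV : normc (n%:R^-1 : R[i]) = n%:R^-1.
Proof.
by rewrite normcV -[n%:R]/((1 : R[i]) *+ n) normcMn normc1.
Qed.

Lemma Im_divn (w : R[i]) : Im (w / n%:R) = Im w / n%:R.
Proof.
have -> : (n%:R^-1 : R[i]) = (n%:R^-1)%:C by rewrite fmorphV rmorph_nat.
by rewrite mulrC cImMr mulrC.
Qed.

Lemma Im_mul_gram_stieltjes A : 0 <= Im (z * gram_stieltjes A).
Proof.
rewrite /gram_stieltjes mulrA Im_divn divr_ge0// /mxtrace mulr_sumr cIm_sum.
apply: sumr_ge0 => l _; rewrite -(delta_mx_resolvent_form A z l).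
exact: Im_mul_resolvent_form.
Qed.

Lemma normc_resolvent_diag A l : normc (resolvent A z l l) <= y^-1.
Proof.
have [->|Gn] := eqVneq (resolvent A z l l) 0.
  by rewrite normc0 invr_ge0 ltW.
have Gp : 0 < normc (resolvent A z l l) by rewrite normc_gt0.
rewrite -[leRHS]mulr1 ler_pdivlMl// -(ler_pM2r Gp) mul1r -mulrA -expr2.
rewrite (le_trans _ (Im_le_normc _))// (le_trans _ (ler_norm _))//.
rewrite -(delta_mx_resolvent_form A z l) Im_resolvent_form// ler_pM2l//.
rewrite map_delta_mx -colE (bigD1 l)//= delta_mx_resolvent_form [col l _ l 0]mxE lerDl.
by apply: sumr_ge0 => *; exact: sqr_ge0.
Qed.

Lemma normc_gram_stieltjes A : normc (gram_stieltjes A) <= y^-1.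
Proof.
rewrite /gram_stieltjes normcM normc_natrV.
apply: (@le_trans _ _ ((\sum_(l < n) y^-1) / n%:R)).
  rewrite ler_wpM2r ?invr_ge0//; apply: le_trans (normc_sum _ _ _) _.
  by apply: ler_sum => l _; exact: normc_resolvent_diag.
rewrite sumr_const card_ord -[_ *+ n]mulr_natl mulrAC.
have [->|n0] := eqVneq n 0%N; first by rewrite !mul0r invr_ge0 ltW.
by rewrite mulfV ?mul1r// pnatr_eq0.
Qed.

Lemma gram_stieltjes_loo A j :
  normc (gram_stieltjes A - gram_stieltjes (replace_col j A 0)) <=
  (n%:R * y)^-1.
Proof.
rewrite /gram_stieltjes -mulrBl normcM normc_natrV invfM mulrC.
rewrite ler_wpM2l ?invr_ge0//.
exact/mxtrace_resolvent_rank_one/gram_replace_col0.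
Qed.

Lemma gram_stieltjes_bounded_diff A B j :
  replace_col j A 0 = replace_col j B 0 ->
  normc (gram_stieltjes A - gram_stieltjes B) <= 2 / (n%:R * y).
Proof.
move=> AB; rewrite -(subrKA (gram_stieltjes (replace_col j A 0))).
apply: le_trans (le_normcD _ _) _; rewrite mulr_natl mulr2n lerD//.
  exact: gram_stieltjes_loo.
by rewrite AB normcB; exact: gram_stieltjes_loo.
Qed.

(** The trace of [shifted_gram A z *m resolvent A z = 1] reads [\tr (A A^T G) - z * \tr G = n], and
    the first trace splits over the columns into forms that the rank-one update evaluates. At
    [n = 0] division returns 0, so the left side is 1; the last term accounts for it. *)
Lemma stieltjes_sum_loo A : 1 + z * gram_stieltjes A =
  n%:R^-1 * \sum_j loo_form A j / (1 + loo_form A j) + (n == 0)%:R.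
Proof.
have [n0|n0] := eqVneq n 0%N.
  have nR : n%:R = 0 :> R[i] by rewrite n0.
  by rewrite /gram_stieltjes nR invr0 !mulr0 mul0r addr0 add0r.
have nC : (n%:R : R[i]) != 0 by rewrite pnatr_eq0.
rewrite addr0; apply: (mulfI nC); rewrite [in RHS]mulrA mulfV// mul1r mulrDr mulr1.
have -> : n%:R * (z * gram_stieltjes A) = z * \tr (resolvent A z).
  by rewrite /gram_stieltjes; field.
have : \tr (shifted_gram A z *m resolvent A z) = n%:R.
  by rewrite mul_shifted_gram_resolvent// mxtrace1.
rewrite /shifted_gram mulmxBl linearB /= mul_scalar_mx mxtraceZ.
move=> /(canRL (subrK _)) <-.
rewrite map_mxM -mulmxA mxtrace_mulC /mxtrace; apply: eq_bigr => j _.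
rewrite /loo_form -(resolvent_form_rank_one z0 (gram_replace_col0 j A)).
rewrite -mulmxA /resolvent_form mxE [RHS]mxE; apply: eq_bigr => k _; rewrite !mxE; congr (_ * _).
by apply: eq_bigr => l _; rewrite !mxE.
Qed.

Section variances.
Variables (v : 'I_p -> R) (C : R).
Hypothesis v0 : forall j, 0 <= v j.
Hypothesis vC : forall j, v j <= C.

Let Im_zv A j : 0 <= Im (z * ((v j)%:C * gram_stieltjes A)).
Proof. by rewrite mulrCA cImMr mulr_ge0// Im_mul_gram_stieltjes. Qed.

(** Each [loo_form] is compared with the normalized trace of the matrix without column [j], the one
    that will be independent of this column; passing back to the full trace costs [C / (n * Im z)]
    by the rank-one bound. *)
Lemma MP_defect_le A : (0 < n)%N -> normc (MP_defect v A) <=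
  n%:R^-1 * \sum_j kappa ^+ 2 *
    (normc (loo_form A j - (v j)%:C * gram_stieltjes (replace_col j A 0)) +
     C / (n%:R * y)).
Proof.
move=> n0; rewrite /MP_defect stieltjes_sum_loo gtn_eqF// addr0 -mulrBr.
rewrite normcM normc_natrV ler_wpM2l ?invr_ge0// -sumrB.
apply: le_trans (normc_sum _ _ _) _; apply: ler_sum => j _.
apply: le_trans (dist_div_1D z0 _ _) _ => //; first exact: Im_mul_resolvent_form.
rewrite ler_wpM2l ?sqr_ge0//.
rewrite -(subrKA ((v j)%:C * gram_stieltjes (replace_col j A 0))).
apply: le_trans (le_normcD _ _) _; rewrite lerD2l -mulrBr normcM normc_real.
rewrite ger0_norm// ler_pM ?normc_ge0//.
by rewrite normcB gram_stieltjes_loo.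
Qed.

(** Writing [w / (1 + w) = 1 - (1 + w)^-1] bounds every summand uniformly in [w]. This deterministic
    bound supplies the integrability on which the concentration argument relies. *)
Lemma MP_defect_bounded A :
  normc (MP_defect v A) <= (1 + kappa) * (1 + p%:R / n%:R).
Proof.
rewrite /MP_defect; apply: le_trans (le_normcD _ _) _.
rewrite normcN mulrDr mulr1 lerD//.
  apply: le_trans (le_normcD _ _) _; rewrite normc1 lerD2l normcM.
  by rewrite ler_wpM2l ?normc_ge0// normc_gram_stieltjes.
rewrite normcM normc_natrV [leRHS]mulrCA mulrA [leRHS]mulrC ler_wpM2l ?invr_ge0//.
apply: le_trans (normc_sum _ _ _) _.
rewrite mulr_natl -[p in leRHS]card_ord -sumr_const; apply: ler_sum => j _.
set w := (v j)%:C * _; have w1 := neq0_1D z0 (Im_zv A j).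
have -> : w / (1 + w) = 1 - (1 + w)^-1 by field.
apply: le_trans (le_normcD _ _) _; rewrite normcN normc1 lerD2l normcV.
rewrite -[leRHS]invrK lef_pV2 ?posrE ?invr_gt0 ?normc_gt0 ?kappa_gt0//.
by rewrite /kappa invf_div; apply: normc_1D_ge => //; exact: Im_zv.
Qed.

Lemma MP_defect_bounded_diff A B j :
  replace_col j A 0 = replace_col j B 0 ->
  normc (MP_defect v A - MP_defect v B) <=
  (normc z + p%:R / n%:R * (kappa ^+ 2 * C)) * (2 / (n%:R * y)).
Proof.
move=> AB; have mAB := gram_stieltjes_bounded_diff AB.
have -> : MP_defect v A - MP_defect v B =
  z * (gram_stieltjes A - gram_stieltjes B) - n%:R^-1 *
  \sum_j ((v j)%:C * gram_stieltjes A / (1 + (v j)%:C * gram_stieltjes A) -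
          (v j)%:C * gram_stieltjes B / (1 + (v j)%:C * gram_stieltjes B)).
  by rewrite /MP_defect sumrB; ring.
apply: le_trans (le_normcD _ _) _; rewrite mulrDl normcN !normcM normc_natrV.
rewrite lerD ?ler_wpM2l ?normc_ge0//.
rewrite [leRHS](_ : _ =
  n%:R^-1 * (p%:R * (kappa ^+ 2 * (C * (2 / (n%:R * y)))))); last first.
  by rewrite (mulrC p%:R) !mulrA.
rewrite ler_wpM2l ?invr_ge0//.
apply: le_trans (normc_sum _ _ _) _.
rewrite [leRHS]mulr_natl -[X in _ *+ X]card_ord -sumr_const.
apply: ler_sum => k _.
apply: le_trans (dist_div_1D z0 _ _) _ => //.
rewrite -/kappa ler_wpM2l ?sqr_ge0// -mulrBr normcM normc_real ger0_norm//.
by rewrite ler_pM ?normc_ge0.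
Qed.

End variances.
End MP_defect.

(** * Independence and concentration *)

Section decoupling.
Context d (T : measurableType d) (R : realType) (P : probability T R).
Local Open Scope ereal_scope.

(** The joint law of an independent pair is the product of the marginals, as both agree on
    rectangles; Tonelli's theorem then separates the variables. This takes the place of conditional
    expectations: one argument is frozen while the other is integrated. *)
Lemma decoupling d1 d2 (T1 : measurableType d1) (T2 : measurableType d2)
    (X : T -> T1) (Y : T -> T2) (h : T1 * T2 -> \bar R) :
  measurable_fun setT X -> measurable_fun setT Y ->
  (forall A B, measurable A -> measurable B ->
    P (X @^-1` A `&` Y @^-1` B) = P (X @^-1` A) * P (Y @^-1` B)) ->
  measurable_fun [set: T1 * T2] h -> (forall u, 0 <= h u) ->
  \int[P]_t h (X t, Y t) = \int[P]_t \int[P]_t' h (X t, Y t').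
Proof.
move=> mX mY XY mh h0.
pose X' : {mfun T >-> T1} := HB.pack X (isMeasurableFun.Build _ _ _ _ _ mX).
pose Y' : {mfun T >-> T2} := HB.pack Y (isMeasurableFun.Build _ _ _ _ _ mY).
have mXY : measurable_fun setT (fun t => (X t, Y t)).
  exact: measurable_fun_pair.
pose Z : {mfun T >-> (T1 * T2)%type} :=
  HB.pack (fun t => (X t, Y t)) (isMeasurableFun.Build _ _ _ _ _ mXY).
have E : {in measurable, distribution P X' \x distribution P Y' =1 distribution P Z}.
  move=> A /set_mem mA; apply: product_measure_unique => //= B C mB mC.
rewrite -[LHS](@ge0_integral_distribution _ _ _ _ _ P Z)//.
rewrite (eq_measure_integral (distribution P X' \x distribution P Y')); last first.
  by move=> A mA _; apply/esym/E; rewrite inE.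
rewrite fubini_tonelli1// /fubini_F.
rewrite (@ge0_integral_distribution _ _ _ _ _ P X')//=; last 2 first.
- exact: measurable_fun_fubini_tonelli_F.
- by move=> y; apply: integral_ge0.
apply: eq_integral => t _ /=.
rewrite (@ge0_integral_distribution _ _ _ _ _ P Y')//=.
exact: measurableT_comp.
Qed.

Lemma independent_familiesC (F G : set (set T)) :
  independent_families P F G -> independent_families P G F.
Proof. by move=> FG A B GA FB; rewrite setIC FG// muleC. Qed.

(** With [B] fixed, the probability of the intersection with [B] and the measure [P] scaled by [P B]
    are finite measures that agree on a pi-system containing the whole space, hence on the
    sigma-algebra it generates. *)
Lemma independent_sigma_l (F G : set (set T)) :
  F `<=` measurable -> G `<=` measurable -> F setT -> setI_closed F ->
  independent_families P F G -> independent_families P <<s F >> G.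
Proof.
move=> Fm Gm FT FI FG A B FA GB; have mB := Gm _ GB.
have PBfin : P B \is a fin_num by exact: fin_num_measure.
have PB0 : (0 <= fine (P B))%R by exact: fine_ge0.
pose m2 := mscale (NngNum PB0) P.
have m2E C : m2 C = P C * P B by rewrite /m2 /mscale/= fineK// muleC.
have := @g_sigma_algebra_measure_unique _ _ _ F Fm (fun=> setT)
  (fun=> FT) _ (mrestr P mB) m2 FI _ _ A FA.
rewrite -m2E; apply.
- by apply: bigcup_const; exists 0%N.
- by move=> C FC; rewrite [RHS]m2E; exact: FG.
- by move=> _; rewrite -[X in X < _]/(P (setT `&` B)) setTI ltey_eq PBfin.
Qed.

Lemma independent_sigma (F G : set (set T)) :
  F `<=` measurable -> G `<=` measurable -> F setT -> G setT ->
  setI_closed F -> setI_closed G ->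
  independent_families P F G -> independent_families P <<s F >> <<s G >>.
Proof.
move=> Fm Gm FT GT FI GI FG; apply: independent_sigma_l => //.
  by apply: smallest_sub => //; exact: sigma_algebra_measurable.
by apply/independent_familiesC/independent_sigma_l => //; exact: independent_familiesC.
Qed.

Section grouping.
Variables (I : finType) (F : I -> set (set T)).
Hypothesis Fm : forall i, F i `<=` measurable.
Hypothesis FT : forall i, F i setT.
Hypothesis FI : forall i, setI_closed (F i).
Hypothesis Find : mutually_independent P F.

Let joint_pi (J : {set I}) : set (set T) :=
  [set A | exists2 E : I -> set T, (forall i, i \in J -> F i (E i)) &
     A = \bigcap_(i in [set` J]) E i].

Let joint_pi_measurable J : joint_pi J `<=` measurable.
Proof.
move=> _ [E FE ->]; apply: fin_bigcap_measurable => // i iJ.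
exact/Fm/FE.
Qed.

Let joint_pi_setI J : setI_closed (joint_pi J).
Proof.
move=> _ _ [E FE ->] [E' FE' ->]; exists (fun i => E i `&` E' i).
  by move=> i iJ; apply: FI; [exact: FE|exact: FE'].
by rewrite bigcapI.
Qed.

Let joint_piT J : joint_pi J setT.
Proof.
exists (fun=> setT) => [i _|]; first exact: FT.
by apply/seteqP; split.
Qed.

Let joint_pi_sub (J : {set I}) i : i \in J -> F i `<=` joint_pi J.
Proof.
move=> iJ A FA; exists (fun j => if j == i then A else setT) => [j _|].
  by case: eqP => [->|_] //; exact: FT.
apply/seteqP; split=> [t At j _ /=|t /(_ i iJ) /=]; first by case: eqP.
by rewrite eqxx.
Qed.

(** Intersections of one event per index form a pi-system that contains every family of the block.
    For disjoint blocks two of them glue into one intersection over the union, where mutual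
    independence factorizes; the pi-lambda argument then reaches the generated sigma-algebras. *)
Lemma grouping_independent (J K : {set I}) : [disjoint J & K]%bool ->
  independent_families P <<s \bigcup_(i in [set` J]) F i >>
                         <<s \bigcup_(i in [set` K]) F i >>.
Proof.
move=> JK; have JK' : independent_families P <<s joint_pi J >> <<s joint_pi K >>.
  apply: independent_sigma => // _ _ [E FE ->] [E' FE' ->].
  pose E2 i := if i \in J then E i else E' i.
  have E2E i : i \in J -> E2 i = E i by rewrite /E2 => ->.
  have E2E' i : i \in K -> E2 i = E' i.
    by move=> iK; rewrite /E2; case: ifP => // iJ; rewrite (disjointFr JK iJ) in iK.
  have -> : \bigcap_(i in [set` J]) E i `&` \bigcap_(i in [set` K]) E' i =
      \bigcap_(i in [set` finset.setU J K]) E2 i.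
    apply/seteqP; split=> [t [Jt Kt] i /=|t JKt].
      by rewrite finset.inE => /orP[iJ|iK]; [rewrite E2E//; exact: Jt|rewrite E2E'//; exact: Kt].
    split=> i /= iJ; first by rewrite -E2E//; apply: JKt; rewrite /= finset.inE iJ.
    by rewrite -E2E'//; apply: JKt; rewrite /= finset.inE iJ orbT.
  rewrite (Find (J := finset.setU J K)); last first.
    by move=> i; rewrite finset.inE => /orP[iJ|iK]; [rewrite E2E//; exact: FE|rewrite E2E'//; exact: FE'].
  rewrite (Find FE) (Find FE').
  rewrite (eq_bigl [predU J & K]) => [|i]; last by rewrite !inE.
  rewrite bigU//=.
  congr (_ * _); apply: eq_bigr => i iJ; first by rewrite E2E.
  by rewrite E2E'.
have sub (L : {set I}) : <<s \bigcup_(i in [set` L]) F i >> `<=` <<s joint_pi L >>.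
  apply: sub_sigma_algebra2 => A [i /= iL]; exact: joint_pi_sub.
by move=> A B /sub JA /sub KB; exact: JK'.
Qed.

End grouping.
End decoupling.

Section probability_integrals.
Context d (T : measurableType d) (R : realType) (P : probability T R).
Implicit Types f g : T -> R.

Lemma integrable_bounded f (b : R) : measurable_fun setT f -> (forall t, `|f t| <= b) ->
  P.-integrable setT (EFin \o f).
Proof.
move=> mf fb; apply: measurable_bounded_integrable => //.
  by rewrite (le_lt_trans (probability_le1 P measurableT)) ?ltry.
exists b; split; first exact: num_real.
by move=> M bM t _ /=; rewrite (le_trans (fb t))// ltW.
Qed.

Lemma EFin_Rintegral f : P.-integrable setT (EFin \o f) ->
  (\int[P]_t f t)%:E = (\int[P]_t (f t)%:E)%E.
Proof. by move=> fi; rewrite fineK//; exact: integrable_fin_num. Qed.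

Lemma Rintegral_prob_cst (c : R) : \int[P]_t c = c.
Proof. by rewrite Rintegral_cst//= probability_setT mulr1. Qed.

Lemma integrable_EFinD f g : P.-integrable setT (EFin \o f) ->
  P.-integrable setT (EFin \o g) ->
  P.-integrable setT (EFin \o (fun t => f t + g t)).
Proof. by move=> fi gi; exact: (integrableD measurableT fi gi). Qed.

Lemma integrable_EFinB f g : P.-integrable setT (EFin \o f) ->
  P.-integrable setT (EFin \o g) ->
  P.-integrable setT (EFin \o (fun t => f t - g t)).
Proof. by move=> fi gi; exact: (integrableB measurableT fi gi). Qed.

Lemma integrable_EFinZ (k : R) f : P.-integrable setT (EFin \o f) ->
  P.-integrable setT (EFin \o (fun t => k * f t)).
Proof. by move=> fi; exact: (integrableZl measurableT k fi). Qed.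

Lemma integrable_EFin_cst (k : R) : P.-integrable setT (EFin \o (fun=> k)).
Proof. exact: finite_measure_integrable_cst. Qed.

Lemma Rintegral_dist_le f g (c : R) : P.-integrable setT (EFin \o f) ->
  P.-integrable setT (EFin \o g) -> (forall t, `|f t - g t| <= c) ->
  `|\int[P]_t f t - \int[P]_t g t| <= c.
Proof.
move=> fi gi fgc; rewrite -RintegralB//.
have fgi : P.-integrable setT (EFin \o (fun t => f t - g t)).
  exact: integrable_EFinB.
apply: le_trans (le_normr_Rintegral _ _) _ => //.
rewrite -[leRHS]Rintegral_prob_cst; apply: le_Rintegral => //.
- exact: integrable_norm.
- exact: finite_measure_integrable_cst.
Qed.

(** Nonnegativity of the variance. *)
Lemma Rintegral_sqr_le f (b : R) : measurable_fun setT f -> (forall t, `|f t| <= b) ->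
  (\int[P]_t f t) ^+ 2 <= \int[P]_t (f t ^+ 2).
Proof.
move=> mf fb; set m := \int[P]_t f t.
have fi := integrable_bounded mf fb.
have f2i : P.-integrable setT (EFin \o (fun t => f t ^+ 2)).
  apply: (@integrable_bounded _ (b ^+ 2)); first exact: measurable_funX.
  by move=> t; rewrite normrX ler_pXn2r ?nnegrE// (le_trans _ (fb t)).
have mi : P.-integrable setT (EFin \o (fun t => 2 * m * f t)).
  exact: integrable_EFinZ.
have ci : P.-integrable setT (EFin \o (fun=> m ^+ 2)).
  exact: integrable_EFin_cst.
have h : 0 <= \int[P]_t (f t ^+ 2 - 2 * m * f t + m ^+ 2).
  apply: Rintegral_ge0 => t _.
  by have := sqr_ge0 (f t - m); rewrite sqrrB; congr (0 <= _); ring.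
move: h; rewrite RintegralD//; last exact: integrable_EFinB.
rewrite RintegralB// RintegralZl// -/m Rintegral_prob_cst.
lra.
Qed.

(* [exp x <= x + exp (2 x^2)]: the exponential moment of a centred variable
   bounded by [c] is at most that of the constant [2 c^2]. *)
Lemma expR_le_add_sqr (x : R) : expR x <= x + expR (2 * x ^+ 2).
Proof.
(* The threshold comes from [(1 + x + 2 x^2) (1 - x) = 1 + x^2 (1 - 2 x)], which is at least 1 up to
   [1 / 2], so that [expR x <= (1 - x)^-1] suffices there; beyond it [x <= 2 x^2]. *)
have [x2|x2] := leP x (2^-1).
  have e2 := expR_ge1Dx (2 * x ^+ 2).
  suff : expR x <= 1 + x + 2 * x ^+ 2 by lra.
  have := expR_ge1Dx (- x); rewrite expRN => h.
  have x1 : 0 < 1 - x by lra.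
  have : expR x <= (1 - x)^-1.
    by rewrite -[leLHS]invrK lef_pV2 ?posrE ?invr_gt0 ?expR_gt0.
  move=> /le_trans; apply; rewrite -[leLHS]mul1r ler_pdivrMr//.
  nra.
suff : expR x <= expR (2 * x ^+ 2) by lra.
by rewrite ler_expR; nra.
Qed.

(** Hoeffding's lemma, with the constant 2 in place of [1 / 2]: once [expR (l * m)] is factored out,
    the linear term of the pointwise bound integrates to 0. *)
Lemma expR_moment_centred f (b c l : R) : measurable_fun setT f ->
  (forall t, `|f t| <= b) -> (forall t, `|f t - \int[P]_u f u| <= c) ->
  (\int[P]_t (expR (l * f t))%:E <=
   (expR (2 * l ^+ 2 * c ^+ 2) * expR (l * \int[P]_u f u))%:E)%E.
Proof.
move=> mf fb; set m := \int[P]_u f u => fc.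
have fi := integrable_bounded mf fb.
pose E := expR (2 * l ^+ 2 * c ^+ 2).
pose g t := expR (l * m) * (l * f t + (E - l * m)).
have gi : P.-integrable setT (EFin \o g).
  apply: integrable_EFinZ => //; apply: integrable_EFinD => //; first exact: integrable_EFinZ.
  exact: integrable_EFin_cst.
have gE : \int[P]_t g t = E * expR (l * m).
  rewrite RintegralZl//; last first.
    apply: integrable_EFinD => //; first exact: integrable_EFinZ.
    exact: finite_measure_integrable_cst.
  rewrite RintegralD//; last 2 first.
  - exact: integrable_EFinZ.
  - exact: finite_measure_integrable_cst.
  by rewrite RintegralZl// Rintegral_prob_cst -/m addrC subrK mulrC.
rewrite -/E -gE EFin_Rintegral//; apply: ge0_le_integral => //.
- apply/measurable_EFinP/measurableT_comp => //.
  exact: measurable_funM.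
- by case/integrableP : gi.
move=> t _; rewrite lee_fin /g.
have -> : expR (l * f t) = expR (l * m) * expR (l * (f t - m)).
  by rewrite -expRD; congr expR; ring.
rewrite ler_wpM2l ?expR_ge0//.
apply: le_trans (expR_le_add_sqr _) _; rewrite mulrBr.
suff : expR (2 * (l * f t - l * m) ^+ 2) <= E by lra.
rewrite ler_expR -mulrBr exprMn mulrA.
rewrite ler_wpM2l ?(mulr_ge0 _ (sqr_ge0 _))//.
by rewrite -real_normK ?num_real// ler_pXn2r ?nnegrE// (le_trans _ (fc t)).
Qed.

(** The factor 24 is [4!]: the fourth Taylor term of the exponential at [|u|] is at most its value,
    which is one of the two summands. *)
Lemma pow4_le_expR (u : R) : u ^+ 4 <= 24 * (expR u + expR (- u)).
Proof.
wlog u0 : u / 0 <= u.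
  move=> W; have [/W//|u0] := leP 0 u.
  have := W (- u); rewrite opprK addrC -[(- u) ^+ 4]/((- u) ^+ (2 * 2)).
  by rewrite exprM sqrrN -exprM; apply; rewrite oppr_ge0 ltW.
have := expR_ge1Dxn 3 u0; have := expR_gt0 (- u).
have -> : 4`! = 24%N by [].
lra.
Qed.

Lemma Rintegral_bounds f (a b : R) : measurable_fun setT f ->
  (forall t, a <= f t <= b) -> a <= \int[P]_t f t <= b.
Proof.
move=> mf fab; have fi : P.-integrable setT (EFin \o f).
  apply: (@integrable_bounded _ (`|a| + `|b|)) => // t.
  have /andP[h1 h2] := fab t; rewrite ler_norml; apply/andP.
  have := ler_norm b; have := ler_norm (- a); rewrite normrN => ha hb.
  have := normr_ge0 a; have := normr_ge0 b.
  by move=> *; split; lra.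
have ci c := integrable_EFin_cst c.
apply/andP; split.
  rewrite -[leLHS]Rintegral_prob_cst; apply: le_Rintegral => // t _.
  by have /andP[] := fab t.
rewrite -[leRHS]Rintegral_prob_cst; apply: le_Rintegral => // t _.
by have /andP[] := fab t.
Qed.

End probability_integrals.

(** * Concentration of functions of independent columns *)

Section concentration.
Context d (T : measurableType d) (R : realType) (P : probability T R).

(** Measurability is tested along entrywise measurable families over an arbitrary space. The same
    property can then be used on [T], on products, and on [T] with a smaller sigma-algebra. *)
Definition mx_measurable n p (f : 'M[R]_(n, p) -> R) : Prop :=
  forall d' (S : measurableType d') (X : S -> 'M[R]_(n, p)),
    (forall i j, measurable_fun setT (fun s => X s i j)) ->
    measurable_fun setT (fun s => f (X s)).

(** Independence of each column from the others, in resampling form: reading column [k] at an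
    independent point [t'] preserves the mean of nonnegative functions. *)
Definition independent_columns n p (Y : T -> 'M[R]_(n, p)) : Prop :=
  forall (k : 'I_p) (h : 'M[R]_(n, p) -> R), mx_measurable h ->
    (forall A, 0 <= h A) ->
    (\int[P]_t (h (Y t))%:E =
     \int[P]_t \int[P]_t' (h (replace_col k (Y t) (Y t')))%:E)%E.

Section bounded_difference.
Variables (n p : nat) (Y : T -> 'M[R]_(n, p)).
Hypothesis mY : forall i j, measurable_fun setT (fun t => Y t i j).
Hypothesis Yind : independent_columns Y.
Variables (f : 'M[R]_(n, p) -> R) (b c : R).
Hypothesis mf : mx_measurable f.
Hypothesis f0 : forall A, 0 <= f A.
Hypothesis fb : forall A, f A <= b.
Hypothesis fc : forall A B (k : 'I_p), replace_col k A 0 = replace_col k B 0 ->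
  `|f A - f B| <= c.

Definition mix_cols (k : nat) (A B : 'M[R]_(n, p)) : 'M[R]_(n, p) :=
  \matrix_(i, j) if (j < k)%N then A i j else B i j.

(* The conditional expectation of [f (Y t)] given the first [k] columns. *)
Definition partial_mean (k : nat) (A : 'M[R]_(n, p)) : R :=
  \int[P]_t f (mix_cols k A (Y t)).

Let mix_measurable d' (S : measurableType d') (k : nat) (X Z : S -> 'M[R]_(n, p)) :
  (forall i j, measurable_fun setT (fun s => X s i j)) ->
  (forall i j, measurable_fun setT (fun s => Z s i j)) ->
  forall i j, measurable_fun setT (fun s => mix_cols k (X s) (Z s) i j).
Proof.
move=> mX mZ i j; under eq_fun do rewrite mxE.
by case: (j < k)%N; [exact: mX|exact: mZ].
Qed.

Let replace_measurable d' (S : measurableType d') k (X Z : S -> 'M[R]_(n, p)) :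
  (forall i j, measurable_fun setT (fun s => X s i j)) ->
  (forall i j, measurable_fun setT (fun s => Z s i j)) ->
  forall i j, measurable_fun setT (fun s => replace_col k (X s) (Z s) i j).
Proof.
move=> mX mZ i j; under eq_fun do rewrite mxE.
by case: (j == k); [exact: mZ|exact: mX].
Qed.

Let mf_mix k A : measurable_fun setT (fun t => f (mix_cols k A (Y t))).
Proof. by apply: mf; apply: mix_measurable. Qed.

Let fbn A : `|f A| <= b. Proof. by rewrite ger0_norm. Qed.

Let f_mix_int k A : P.-integrable setT (EFin \o (fun t => f (mix_cols k A (Y t)))).
Proof. exact: integrable_bounded. Qed.

Lemma partial_mean_ge0 k A : 0 <= partial_mean k A.
Proof. by apply: Rintegral_ge0. Qed.

Lemma partial_mean_le k A : partial_mean k A <= b.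
Proof.
have := @Rintegral_bounds _ _ _ P _ 0 b (mf_mix k A).
by move=> /(_ _)/andP[] // t; rewrite f0 fb.
Qed.

Lemma partial_mean_measurable k : mx_measurable (partial_mean k).
Proof.
move=> d' S X mX; rewrite /partial_mean /Rintegral.
apply: measurableT_comp => //.
have mh : measurable_fun [set: S * T] (fun u : S * T => (f (mix_cols k (X u.1) (Y u.2)))%:E).
  apply/measurable_EFinP; apply: mf; apply: mix_measurable => i j.
    exact: (measurableT_comp (mX i j) measurable_fst).
  exact: (measurableT_comp (mY i j) measurable_snd).
rewrite -[X in measurable_fun _ X]/(fubini_F P
  (fun u : S * T => (f (mix_cols k (X u.1) (Y u.2)))%:E)).
by apply: measurable_fun_fubini_tonelli_F => // u; rewrite lee_fin.
Qed.

Lemma partial_mean_diff k A B (j : 'I_p) :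
  replace_col j A 0 = replace_col j B 0 ->
  `|partial_mean k A - partial_mean k B| <= c.
Proof.
move=> AB; apply: Rintegral_dist_le => // t; apply: (fc (k := j)).
apply/matrixP => i l; have := congr1 (fun M : 'M[R]_(n, p) => M i l) AB.
by rewrite !mxE; case: (l == j) => // ->.
Qed.

(** The tower property. After exchanging the two integrals, column [k] is read at one point and the
    later columns at another, and independence of the columns merges the two points. *)
Lemma partial_meanS (k : 'I_p) A :
  \int[P]_t partial_mean k.+1 (replace_col k A (Y t)) = partial_mean k A.
Proof.
apply: EFin_inj; rewrite !EFin_Rintegral//; last first.
  apply: (@integrable_bounded _ _ _ _ _ b) => [|t].
    by apply: partial_mean_measurable; apply: replace_measurable.
  by rewrite ger0_norm ?partial_mean_ge0// partial_mean_le.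
pose g (u : T * T) := (f (mix_cols k A (replace_col k (Y u.2) (Y u.1))))%:E.
have mg : measurable_fun [set: T * T] g.
  apply/measurable_EFinP; apply: mf; apply: mix_measurable => [//|].
  apply: replace_measurable => i j.
    exact: (measurableT_comp (mY i j) measurable_snd).
  exact: (measurableT_comp (mY i j) measurable_fst).
transitivity (\int[P]_t \int[P]_t' g (t, t'))%E.
  apply: eq_integral => t _; rewrite EFin_Rintegral//.
  apply: eq_integral => t' _; congr (f _)%:E.
  apply/matrixP => i j; rewrite !mxE ltnS leq_eqVlt.
  have [->|jk] := eqVneq j k; first by rewrite eqxx/= ltnn.
  by rewrite -[(j == k :> nat)]/(j == k) (negPf jk).
rewrite (@fubini_tonelli _ _ _ _ _ P P g)//; last first.
  by move=> u; rewrite lee_fin.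
rewrite (Yind k (h := fun B => f (mix_cols k A B)))// => d' S X mX.
by apply: mf; apply: mix_measurable.
Qed.

(** Column [k] is resampled and the exponential moment bound is applied to the inner integral, whose
    mean is [partial_mean k]; changing this column moves [partial_mean k.+1] by at most [c], hence
    so does centring it. *)
Lemma expR_partial_meanS (k : 'I_p) (l : R) :
  (\int[P]_t (expR (l * partial_mean k.+1 (Y t)))%:E <=
   (expR (2 * l ^+ 2 * c ^+ 2))%:E *
   \int[P]_t (expR (l * partial_mean k (Y t)))%:E)%E.
Proof.
have mE k' : mx_measurable (fun A => expR (l * partial_mean k' A)).
  move=> d' S X mX; apply: measurableT_comp => //.
  by apply: measurable_funM => //; exact: partial_mean_measurable.
rewrite (Yind k (h := fun B => expR (l * partial_mean k.+1 B)))//.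
rewrite -ge0_integralZl//; last by exact/measurable_EFinP/mE.
have mphi t : measurable_fun setT
    (fun t' => partial_mean k.+1 (replace_col k (Y t) (Y t'))).
  by apply: partial_mean_measurable; exact: replace_measurable.
apply: ge0_le_integral => //.
- by move=> t _; apply: integral_ge0 => t' _; rewrite lee_fin expR_ge0.
- have mh : measurable_fun [set: T * T] (fun u : T * T =>
      (expR (l * partial_mean k.+1 (replace_col k (Y u.1) (Y u.2))))%:E).
    apply/measurable_EFinP; apply: mE; apply: replace_measurable => i j.
      exact: (measurableT_comp (mY i j) measurable_fst).
    exact: (measurableT_comp (mY i j) measurable_snd).
  rewrite -[X in measurable_fun _ X]/(fubini_F P (fun u : T * T =>
    (expR (l * partial_mean k.+1 (replace_col k (Y u.1) (Y u.2))))%:E)).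
  exact: measurable_fun_fubini_tonelli_F.
- by apply: emeasurable_funM => //; exact/measurable_EFinP/mE.
move=> t _; rewrite -EFinM -(partial_meanS k (Y t)).
apply: (@expR_moment_centred _ _ _ _ _ b) => // t'.
  by rewrite ger0_norm ?partial_mean_ge0// partial_mean_le.
have fin : P.-integrable setT (EFin \o (fun t' : T =>
    partial_mean k.+1 (replace_col k (Y t) (Y t')))).
  apply: (@integrable_bounded _ _ _ _ _ b) => // u.
  by rewrite ger0_norm ?partial_mean_ge0// partial_mean_le.
rewrite -[X in `|X - _|](Rintegral_prob_cst P).
apply: Rintegral_dist_le => // [|u]; first exact: integrable_EFin_cst.
by apply: (@partial_mean_diff k.+1 _ _ k); rewrite !replace_colK.
Qed.

(** Induction on the number of revealed columns: with none the partial mean is the constant mean,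
    with all [p] it is [f] itself, and each column costs one exponential factor. *)
Lemma expR_bounded_difference (l : R) :
  (\int[P]_t (expR (l * f (Y t)))%:E <=
   (expR (2 * l ^+ 2 * c ^+ 2 * p%:R) * expR (l * \int[P]_t f (Y t)))%:E)%E.
Proof.
have H (k : nat) : (k <= p)%N ->
  (\int[P]_t (expR (l * partial_mean k (Y t)))%:E <=
   (expR (2 * l ^+ 2 * c ^+ 2 * k%:R) * expR (l * \int[P]_t f (Y t)))%:E)%E.
  elim: k => [|k IHk] kp.
    rewrite mulr0 expR0 mul1r; under eq_integral => t _.
      have -> : partial_mean 0 (Y t) = \int[P]_t f (Y t).
        apply: eq_Rintegral => t' _; congr f; apply/matrixP => i j.
        by rewrite mxE.
      over.
    by rewrite -(EFin_Rintegral (integrable_EFin_cst P _)) Rintegral_prob_cst.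
  apply: le_trans (expR_partial_meanS (Ordinal kp) l) _ => /=.
  apply: (@le_trans _ _ ((expR (2 * l ^+ 2 * c ^+ 2))%:E *
    (expR (2 * l ^+ 2 * c ^+ 2 * k%:R) * expR (l * \int[P]_t f (Y t)))%:E)%E).
    by rewrite lee_wpmul2l ?lee_fin ?expR_ge0// IHk// ltnW.
  have -> : 2 * l ^+ 2 * c ^+ 2 * k.+1%:R =
    2 * l ^+ 2 * c ^+ 2 + 2 * l ^+ 2 * c ^+ 2 * k%:R.
    by rewrite -[k.+1%:R]natr1 mulrDr mulr1 addrC.
  by rewrite -EFinM lee_fin expRD mulrA.
have E t : partial_mean p (Y t) = f (Y t).
  rewrite -[RHS](Rintegral_prob_cst P); apply: eq_Rintegral => t' _; congr f.
  by apply/matrixP => i j; rewrite mxE ltn_ord.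
by have := H p (leqnn p); under eq_integral do rewrite E.
Qed.

(** The fourth power is dominated by exponentials at [l] and [- l], each contributing 24. The
    parameter [l] stays free: with [c] of order [1 / n] and [p] of order [n], the choice [l^2 = n]
    keeps the exponent bounded and gives the rate [n^-2]. *)
Lemma pow4_bounded_difference (l : R) : 0 < l ->
  (\int[P]_t ((f (Y t) - \int[P]_u f (Y u)) ^+ 4)%:E <=
   (48 * expR (2 * l ^+ 2 * c ^+ 2 * p%:R) / l ^+ 4)%:E)%E.
Proof.
move=> l0; set m := \int[P]_u f (Y u).
have mfY : measurable_fun setT (fun t => f (Y t)) by apply: mf.
pose e (a : R) t := expR (a * f (Y t)).
have me a : measurable_fun setT (e a).
  by apply: measurableT_comp => //; apply: measurable_funM.
have [K K0 KE] : exists2 K : R, 0 <= K & K = 24 / l ^+ 4.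
  by exists (24 / l ^+ 4) => //; rewrite divr_ge0// exprn_ge0// ltW.
have eC a : (0 <= (K * expR (- (a * m)))%:E)%E.
  by rewrite lee_fin mulr_ge0// expR_ge0.
apply: (@le_trans _ _ (\int[P]_t ((K * expR (- (l * m)))%:E * (e l t)%:E +
    (K * expR (- (- l * m)))%:E * (e (- l) t)%:E))%E).
  apply: ge0_le_integral => //.
  - by move=> t _; rewrite lee_fin exprn_even_ge0.
  - by apply/measurable_EFinP/measurable_funX/measurable_funB.
  - by apply: emeasurable_funD; apply: emeasurable_funM => //; exact/measurable_EFinP.
  move=> t _; rewrite -!EFinM -EFinD lee_fin /e -!mulrA -mulrDr -!expRD KE.
  rewrite mulrAC ler_pdivlMr ?exprn_gt0// -exprMn mulrC.
  apply: le_trans (pow4_le_expR _) _; rewrite le_eqVlt; apply/orP; left.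
  by apply/eqP; congr (_ * (expR _ + expR _)); ring.
have eb a : (\int[P]_t (e a t)%:E <= (expR (2 * l ^+ 2 * c ^+ 2 * p%:R) *
    expR (a * m))%:E)%E -> (\int[P]_t ((K * expR (- (a * m)))%:E * (e a t)%:E) <=
    (K * expR (2 * l ^+ 2 * c ^+ 2 * p%:R))%:E)%E.
  move=> h; rewrite ge0_integralZl//; last 2 first.
  - exact/measurable_EFinP.
  - by move=> t _; rewrite lee_fin expR_ge0.
  apply: le_trans (lee_wpmul2l (eC a) h) _.
  rewrite -EFinM lee_fin le_eqVlt; apply/orP; left; apply/eqP.
  rewrite expRN; have := expR_gt0 (a * m); move: (expR (a * m)) => x x0.
  by field; rewrite gt_eqF.
rewrite ge0_integralD//; last 4 first.
- by move=> t _; rewrite mule_ge0// lee_fin expR_ge0.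
- by apply: emeasurable_funM => //; exact/measurable_EFinP.
- by move=> t _; rewrite mule_ge0// lee_fin expR_ge0.
- by apply: emeasurable_funM => //; exact/measurable_EFinP.
have := leeD (eb l (expR_bounded_difference l))
  (eb (- l) _); rewrite -EFinD => /(_ _)/le_trans; apply.
  by have := expR_bounded_difference (- l); rewrite sqrrN.
by rewrite lee_fin KE le_eqVlt; apply/orP; left; apply/eqP; ring.
Qed.

End bounded_difference.
End concentration.

(** * From summable moments to almost sure convergence *)

Section almost_sure_convergence.
Context d (T : measurableType d) (R : realType) (P : probability T R).

(** The terms are dominated by [2 / ((k + 1) (k + 2))], which telescopes. *)
Lemma sum_inv_sqr_le (n : nat) :
  \sum_(0 <= k < n) (k.+1%:R ^+ 2)^-1 <= 2 - 2 / n.+1%:R :> R.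
Proof.
elim: n => [|n IHn]; first by rewrite big_geq// divr1 subrr.
rewrite big_nat_recr//=; apply: le_trans (lerD IHn (lexx _)) _.
rewrite -addrA lerD2l addrC -lerBrDr opprK.
have n1 : (0 : R) < n.+1%:R by rewrite ltr0n.
have -> : (n.+2%:R : R) = n.+1%:R + 1 by rewrite [RHS]natr1.
have : (1 : R) <= n.+1%:R by rewrite ler1n.
move: (n.+1%:R : R) n1 => x x0 x1.
have -> : - (2 / (x + 1)) + 2 / x = 2 / (x * (x + 1)).
  by field; rewrite !gt_eqF// addr_gt0.
rewrite -[leLHS]mul1r ler_pdivrMr ?exprn_gt0// mulrAC ler_pdivlMr ?mulr_gt0 ?addr_gt0//.
by rewrite mul1r expr2 mulrCA ler_pM2l//; lra.
Qed.

(** The sum of the series has a finite integral, so it is finite almost everywhere, and the terms of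
    a convergent series tend to 0. *)
Lemma ae_cvg0_of_summable (g : nat -> T -> R) (K : R) :
  (forall n, measurable_fun setT (g n)) -> (forall n t, 0 <= g n t) ->
  (forall n, (\int[P]_t (g n t)%:E <= (K / n.+1%:R ^+ 2)%:E)%E) ->
  {ae P, forall t, g n t @[n --> \oo] --> 0}.
Proof.
move=> mg g0 gK.
have K0 : 0 <= K.
  have := gK 0%N; rewrite expr1n divr1 -lee_fin; apply: le_trans.
  by apply: integral_ge0 => t _; rewrite lee_fin.
pose S t := (\sum_(n <oo) (g n t)%:E)%E.
have S0 t : (0 <= S t)%E by apply: nneseries_ge0 => n _ _; rewrite lee_fin.
have mS : measurable_fun setT S.
  apply: ge0_emeasurable_sum => [n t _ _|n _]; first by rewrite lee_fin.
  exact/measurable_EFinP.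
have SK : (\int[P]_t S t <= (2 * K)%:E)%E.
  rewrite integral_nneseries//; last 2 first.
  - by move=> n; exact/measurable_EFinP.
  - by move=> n t _; rewrite lee_fin.
  have ge0i n : (0 <= \int[P]_t (g n t)%:E)%E.
    by apply: integral_ge0 => t _; rewrite lee_fin.
  apply: lime_le; first exact: is_cvg_nneseries.
  apply: nearW => n.
  apply: (@le_trans _ _ (\sum_(0 <= k < n) (K / k.+1%:R ^+ 2)%:E)%E).
    by apply: lee_sum => k _; exact: gK.
  rewrite sumEFin lee_fin -mulr_sumr mulrC ler_wpM2r//.
  by apply: le_trans (sum_inv_sqr_le n) _; rewrite gerBl divr_ge0.
have Sint : P.-integrable setT S.
  apply/integrableP; split => //; under eq_integral do rewrite gee0_abs//.
  by apply: le_lt_trans SK _; rewrite ltry.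
have := integrable_ae measurableT Sint; apply: filterS => t /(_ I) St.
apply: cvg_series_cvg_0; apply: nondecreasing_is_cvgn.
  exact: nondecreasing_series.
exists (fine (S t)) => _ [n _ <-]; rewrite -lee_fin fineK//.
rewrite /series /= -sumEFin; apply: nneseries_lim_ge => k _ _.
by rewrite lee_fin.
Qed.

Variable p : nat -> nat.
Variable Y : forall n, T -> 'M[R]_(n, p n).
Hypothesis mY : forall n i j, measurable_fun setT (fun t => Y n t i j).
Hypothesis Yind : forall n, independent_columns P (Y n).

(** Two scales are combined: the second moment, which only has to tend to 0, controls the mean,
    while the fourth moment around the mean is of order [n^-2] and hence summable. *)
Lemma bounded_difference_ae_cvg0 (f : forall n, 'M[R]_(n, p n) -> R)
    (b e : nat -> R) (c Kp : R) :
  (forall n, mx_measurable (f n)) -> (forall n A, `|f n A| <= b n) ->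
  (forall n A B k, (0 < n)%N -> replace_col k A 0 = replace_col k B 0 ->
    `|f n A - f n B| <= c / n%:R) ->
  (forall n, (0 < n)%N -> (p n)%:R <= Kp * n%:R) ->
  (forall n, (0 < n)%N -> (\int[P]_t (f n (Y n t) ^+ 2)%:E <= (e n)%:E)%E) ->
  e n @[n --> \oo] --> 0 ->
  {ae P, forall t, f n (Y n t) @[n --> \oo] --> 0}.
Proof.
move=> mf fb fc pK fe e0.
have mfY n : measurable_fun setT (fun t => f n (Y n t)) by apply: mf.
pose m n := \int[P]_u f n (Y n u).
have mean0 : m n @[n --> \oo] --> 0.
  have m2e n : (0 < n)%N -> m n ^+ 2 <= e n.
    move=> n0; have := fe n n0; rewrite -EFin_Rintegral; last first.
      apply: (@integrable_bounded _ _ _ _ _ (b n ^+ 2)); first exact: measurable_funX.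
      by move=> t; rewrite normrX ler_pXn2r ?nnegrE// (le_trans _ (fb n 0)).
    by rewrite lee_fin; apply: le_trans; apply: (@Rintegral_sqr_le _ _ _ _ _ (b n)).
  apply/cvgrPdist_lt => eps eps0; move/cvgrPdist_lt/(_ _ (exprn_gt0 2 eps0)) : e0.
  apply: filterS2 (nbhs_infty_gt 0) => n n0; rewrite !sub0r !normrN => h.
  rewrite -(ltr_pXn2r (n := 2)) ?nnegrE// ?ltW// real_normK ?num_real//.
  apply: le_lt_trans (m2e n n0) _; apply: le_lt_trans (ler_norm _) h.
pose g n t := (f n.+1 (Y n.+1 t) - m n.+1) ^+ 4.
have : {ae P, forall t, g n t @[n --> \oo] --> 0}.
  apply: (@ae_cvg0_of_summable g (48 * expR (2 * c ^+ 2 * Kp))).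
  - by move=> n; apply/measurable_funX/measurable_funB.
  - by move=> n t; rewrite exprn_even_ge0.
  move=> n; set N := n.+1; have N0 : (0 : R) < N%:R by rewrite ltr0n.
  (* The fourth moment bound is stated for nonnegative functions; adding the uniform bound [b N]
     achieves this and cancels in all differences. *)
  pose F (A : 'M[R]_(N, p N)) := f N A + b N.
  have subK x y : x + b N - (y + b N) = x - y by rewrite opprD addrACA subrr addr0.
  have mF : mx_measurable F.
    by move=> d' S X mX; apply: measurable_funD => //; exact: mf.
  have F0 A : 0 <= F A.
    by have := fb N A; rewrite ler_norml /F => /andP[h _]; lra.
  have Fb A : F A <= b N + b N.
    by have := fb N A; rewrite ler_norml /F => /andP[_ h]; lra.
  have Fc A B k : replace_col k A 0 = replace_col k B 0 -> `|F A - F B| <= c / N%:R.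
    by move=> AB; rewrite /F subK; apply: fc AB.
  have mE : \int[P]_t F (Y N t) = m N + b N.
    rewrite RintegralD//; last exact: integrable_EFin_cst.
      by rewrite Rintegral_prob_cst.
    exact: (@integrable_bounded _ _ _ _ _ (b N)).
  have sN0 : 0 < Num.sqrt (N%:R : R) by rewrite sqrtr_gt0.
  have := pow4_bounded_difference (mY (n := N)) (Yind (n := N)) mF F0 Fb Fc sN0.
  rewrite mE; under eq_integral => t _ do rewrite /F subK.
  move=> /le_trans; apply; rewrite lee_fin.
  have -> : Num.sqrt N%:R ^+ 4 = N%:R ^+ 2 :> R.
    by rewrite -[4%N]/(2 * 2)%N exprM sqr_sqrtr// ltW.
  rewrite sqr_sqrtr ?(ltW N0)//.
  rewrite ler_wpM2r ?invr_ge0 ?sqr_ge0// ler_wpM2l// ler_expR.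
  have -> : 2 * N%:R * (c / N%:R) ^+ 2 * (p N)%:R =
      2 * c ^+ 2 * ((p N)%:R / N%:R) :> R by field; rewrite gt_eqF.
  rewrite ler_wpM2l ?(mulr_ge0 _ (sqr_ge0 _))//.
  by rewrite ler_pdivrMr// pK.
apply: filterS => t gt0.
suff : f n.+1 (Y n.+1 t) @[n --> \oo] --> 0.
  by rewrite (cvg_shiftS (fun n => f n (Y n t))).
have h2 : m n.+1 @[n --> \oo] --> 0 by rewrite (cvg_shiftS m).
have h1 : f n.+1 (Y n.+1 t) - m n.+1 @[n --> \oo] --> 0.
  apply/cvgrPdist_lt => eps eps0; move/cvgrPdist_lt/(_ _ (exprn_gt0 4 eps0)) : gt0.
  apply: filterS => n; rewrite !sub0r !normrN normrX => h.
  by rewrite -(ltr_pXn2r (n := 4)) ?nnegrE// ltW.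
have -> : (fun n => f n.+1 (Y n.+1 t)) =
    (fun n => f n.+1 (Y n.+1 t) - m n.+1) \+ (fun n => m n.+1).
  by apply/funext => n /=; rewrite subrK.
by rewrite -[X in _ --> X](addr0 0); apply: cvgD.
Qed.

End almost_sure_convergence.

(** * Measurability of complex functions and of resolvents *)

Section complex_measurability.
Context d (S : measurableType d) (R : realType).
Implicit Types f g : S -> R[i].

Definition cmeasurable f := measurable_fun setT (fun s => Re (f s)) /\
  measurable_fun setT (fun s => Im (f s)).

Lemma eq_cmeasurable f g : f =1 g -> cmeasurable f -> cmeasurable g.
Proof. by move=> /funext ->. Qed.

Lemma cmeasurable_cst (c : R[i]) : cmeasurable (fun=> c).
Proof. by split; exact: measurable_cst. Qed.

Lemma cmeasurable_real (f : S -> R) : measurable_fun setT f ->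
  cmeasurable (fun s => (f s)%:C).
Proof. by split => //; exact: measurable_cst. Qed.

Lemma cmeasurableD f g : cmeasurable f -> cmeasurable g ->
  cmeasurable (fun s => f s + g s).
Proof.
move=> [f1 f2] [g1 g2]; split.
  by under eq_fun do rewrite cReD; exact: measurable_funD.
by under eq_fun do rewrite cImD; exact: measurable_funD.
Qed.

Lemma cmeasurableM f g : cmeasurable f -> cmeasurable g ->
  cmeasurable (fun s => f s * g s).
Proof.
move=> [f1 f2] [g1 g2]; split.
  under eq_fun do rewrite cReM.
  by apply: measurable_funB; exact: measurable_funM.
under eq_fun do rewrite cImM.
by apply: measurable_funD; exact: measurable_funM.
Qed.

Lemma cmeasurableN f : cmeasurable f -> cmeasurable (fun s => - f s).
Proof.
move=> fm; apply: (eq_cmeasurable (f := fun s => -1 * f s)) => [s|].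
  by rewrite mulN1r.
by apply: cmeasurableM => //; exact: cmeasurable_cst.
Qed.

Lemma measurable_normc_sqr f : cmeasurable f ->
  measurable_fun setT (fun s => normc (f s) ^+ 2).
Proof.
move=> [f1 f2]; under eq_fun do rewrite normc_sqr.
by apply: measurable_funD; exact: measurable_funX.
Qed.

Lemma measurable_fun_inv (f : S -> R) : measurable_fun setT f ->
  measurable_fun setT (fun s => (f s)^-1).
Proof.
move=> mf; apply: measurableT_comp => //.
(* The inverse is continuous away from 0 and has a default value at 0, which is split off. *)
have -> : [set: R] = [set 0] `|` ~` [set 0] by rewrite setUv.
apply/measurable_funU => //; first exact: measurableC.
split; first exact: measurable_fun_set1.
apply: open_continuous_measurable_fun => [|x].
  by rewrite openC; exact: closed_eq.
by rewrite inE /= => /eqP x0; exact: inv_continuous.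
Qed.

Lemma cmeasurableV f : cmeasurable f -> cmeasurable (fun s => (f s)^-1).
Proof.
move=> fm; have mn := measurable_fun_inv (measurable_normc_sqr fm).
case: fm => f1 f2; split.
  by under eq_fun do rewrite cRe_inv; exact: measurable_funM.
under eq_fun do rewrite cIm_inv.
by apply: measurable_funM => //; exact: measurableT_comp.
Qed.

Lemma cmeasurable_sum (I : Type) (r : seq I) (Q : pred I) (F : I -> S -> R[i]) :
  (forall i, Q i -> cmeasurable (F i)) ->
  cmeasurable (fun s => \sum_(i <- r | Q i) F i s).
Proof.
move=> mF; elim: r => [|i r IHr].
  by under eq_fun do rewrite big_nil; exact: cmeasurable_cst.
under eq_fun do rewrite big_cons.
have [Qi|_] := boolP (Q i); last exact: IHr.
by apply: cmeasurableD => //; exact: mF.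
Qed.

Lemma cmeasurable_prod (I : Type) (r : seq I) (Q : pred I) (F : I -> S -> R[i]) :
  (forall i, Q i -> cmeasurable (F i)) ->
  cmeasurable (fun s => \prod_(i <- r | Q i) F i s).
Proof.
move=> mF; elim: r => [|i r IHr].
  by under eq_fun do rewrite big_nil; exact: cmeasurable_cst.
under eq_fun do rewrite big_cons.
have [Qi|_] := boolP (Q i); last exact: IHr.
by apply: cmeasurableM => //; exact: mF.
Qed.

Lemma cmeasurable_det n (M : S -> 'M[R[i]]_n) :
  (forall i j, cmeasurable (fun s => M s i j)) -> cmeasurable (fun s => \det (M s)).
Proof.
move=> mM; apply: cmeasurable_sum => sg _; apply: cmeasurableM.
  exact: cmeasurable_cst.
by apply: cmeasurable_prod => i _; exact: mM.
Qed.

(** Cramer's rule writes each entry of the resolvent as a quotient of polynomials in the entries of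
    [X s]. *)
Lemma cmeasurable_resolvent n p (z : R[i]) (X : S -> 'M[R]_(n, p)) : 0 < Im z ->
  (forall i j, measurable_fun setT (fun s => X s i j)) ->
  forall i j, cmeasurable (fun s => resolvent (X s) z i j).
Proof.
move=> z0 mX i j.
have mG k l : cmeasurable (fun s => shifted_gram (X s) z k l).
  have E s : \sum_h (X s k h)%:C * (X s l h)%:C + - (z *+ (k == l)) =
      shifted_gram (X s) z k l.
    rewrite !mxE; congr (_ - _); rewrite rmorph_sum; apply: eq_bigr => h _.
    by rewrite mxE rmorphM.
  apply: (eq_cmeasurable E); apply: cmeasurableD; last exact: cmeasurable_cst.
  by apply: cmeasurable_sum => h _; apply: cmeasurableM; exact: cmeasurable_real.
have E s : (\det (shifted_gram (X s) z))^-1 *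
    ((-1) ^+ (j + i) * \det (row' j (col' i (shifted_gram (X s) z)))) =
    resolvent (X s) z i j.
  by rewrite /resolvent /invmx shifted_gram_unit// !mxE.
apply: (eq_cmeasurable E); apply: cmeasurableM.
  exact/cmeasurableV/cmeasurable_det.
apply: cmeasurableM; first exact: cmeasurable_cst.
apply: cmeasurable_det => k l.
apply: (eq_cmeasurable
  (f := fun s => shifted_gram (X s) z (lift j k) (lift i l))) => [s|].
  by rewrite [RHS]mxE [RHS]mxE.
exact: mG.
Qed.

Lemma cmeasurable_gram_stieltjes n p (z : R[i]) (X : S -> 'M[R]_(n, p)) :
  0 < Im z -> (forall i j, measurable_fun setT (fun s => X s i j)) ->
  cmeasurable (fun s => gram_stieltjes z (X s)).
Proof.
move=> z0 mX; apply: cmeasurableM; last exact: cmeasurable_cst.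
by apply: cmeasurable_sum => i _; exact: cmeasurable_resolvent.
Qed.

Lemma cmeasurable_MP_defect n p (z : R[i]) (v : 'I_p -> R)
    (X : S -> 'M[R]_(n, p)) : 0 < Im z ->
  (forall i j, measurable_fun setT (fun s => X s i j)) ->
  cmeasurable (fun s => MP_defect z v (X s)).
Proof.
move=> z0 mX; have mg := cmeasurable_gram_stieltjes z0 mX.
apply: cmeasurableD.
  apply: cmeasurableD; first exact: cmeasurable_cst.
  by apply: cmeasurableM => //; exact: cmeasurable_cst.
apply: cmeasurableN; apply: cmeasurableM; first exact: cmeasurable_cst.
apply: cmeasurable_sum => j _.
have mj : cmeasurable (fun s => (v j)%:C * gram_stieltjes z (X s)).
  by apply: cmeasurableM => //; exact: cmeasurable_cst.
apply: cmeasurableM => //; apply: cmeasurableV; apply: cmeasurableD => //.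
Qed.

Lemma cmeasurable_loo_form n p (z : R[i]) (X : S -> 'M[R]_(n, p)) j :
  0 < Im z -> (forall i j, measurable_fun setT (fun s => X s i j)) ->
  cmeasurable (fun s => loo_form z (X s) j).
Proof.
move=> z0 mX; have mX0 i l : measurable_fun setT (fun s => replace_col j (X s) 0 i l).
  under eq_fun do rewrite !mxE.
  by case: (l == j); [exact: measurable_cst|exact: mX].
have E s : \sum_k (X s k j)%:C * \sum_l resolvent (replace_col j (X s) 0) z k l *
    (X s l j)%:C = loo_form z (X s) j.
  rewrite /loo_form /resolvent_form mxE; apply: eq_bigr => k _.
  rewrite !mxE; congr (_ * _); apply: eq_bigr => l _; by rewrite !mxE.
apply: (eq_cmeasurable E); apply: cmeasurable_sum => k _.
apply: cmeasurableM; first exact/cmeasurable_real/mX.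
apply: cmeasurable_sum => l _; apply: cmeasurableM; last exact/cmeasurable_real/mX.
exact: cmeasurable_resolvent.
Qed.

End complex_measurability.

(** Cauchy-Schwarz against the constant 1, by summing [2 a_i a_j <= a_i^2 + a_j^2] over all
    pairs. *)
Lemma sqr_sum_le (R : realDomainType) p (a : 'I_p -> R) :
  (\sum_j a j) ^+ 2 <= p%:R * \sum_j a j ^+ 2.
Proof.
rewrite -(ler_pM2l (ltr0n R 2)) expr2.
have -> : 2 * (p%:R * \sum_j a j ^+ 2) = \sum_i \sum_j (a i ^+ 2 + a j ^+ 2).
  under [RHS]eq_bigr => i _ do rewrite big_split /= sumr_const card_ord.
  rewrite big_split /= sumr_const card_ord sumrMnl.
  by rewrite -[(\sum_i _) *+ p]mulr_natl mulr_natl mulr2n.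
rewrite mulr_suml mulr_sumr.
apply: ler_sum => i _; rewrite !mulr_sumr; apply: ler_sum => j _.
by have := sqr_ge0 (a i - a j); rewrite sqrrB; nra.
Qed.

(** * Normalized traces of random Gram matrices *)

Section random_matrices.
Context d (T : measurableType d) (R : realType) (P : probability T R).

(** This is [y^T M y - v * \tr M], the deviation of a quadratic form from its mean when the entries
    of [y] are centred, uncorrelated and of variance [v]. *)
Definition quad_dev n (M : 'M[R]_n) (v : R) (y : 'I_n -> R) : R :=
  \sum_k \sum_l M k l * (y k * y l) - v * \sum_k M k k.

(** The real and imaginary parts of the resolvent act as two real matrices, so that moment bounds
    for real quadratic forms suffice. *)
Lemma loo_form_sqr_norm n p (z : R[i]) (A : 'M[R]_(n, p)) (j : 'I_p) (v : R) :
  (0 < n)%N -> let B := (Num.sqrt n%:R)^-1 *: A in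
  let G := resolvent (replace_col j B 0) z in
  normc (loo_form z B j - v%:C * gram_stieltjes z (replace_col j B 0)) ^+ 2 =
  n%:R ^- 2 * (quad_dev (\matrix_(k, l) Re (G k l)) v (fun i => A i j) ^+ 2 +
               quad_dev (\matrix_(k, l) Im (G k l)) v (fun i => A i j) ^+ 2).
Proof.
move=> n0 B G; have nR : (0 : R) < n%:R by rewrite ltr0n.
have nC : n%:R = (n%:R : R)%:C :> R[i] by rewrite rmorph_nat.
have -> : loo_form z B j - v%:C * gram_stieltjes z (replace_col j B 0) =
  ((n%:R : R)^-1)%:C * (\sum_k \sum_l (A k j * A l j)%:C * G k l -
              v%:C * \sum_k G k k).
  rewrite mulrBr /gram_stieltjes -/G; congr (_ - _); last first.
    by rewrite nC -fmorphV /mxtrace mulrA mulrC.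
  rewrite /loo_form /resolvent_form mxE mulr_sumr; apply: eq_bigr => k _.
  rewrite !mxE !mulr_sumr; apply: eq_bigr => l _; rewrite !mxE -/G.
  rewrite !rmorphM /=.
  have -> : ((n%:R : R)^-1)%:C = ((Num.sqrt (n%:R : R))^-1)%:C *
     ((Num.sqrt (n%:R : R))^-1)%:C.
    by rewrite -rmorphM -expr2 exprVn sqr_sqrtr// ltW.
  ring.
rewrite normcM exprMn normc_real real_normK ?num_real// exprVn; congr (_ * _).
rewrite normc_sqr; congr (_ ^+ 2 + _ ^+ 2).
  rewrite cReD cReN cReMr !cRe_sum; congr (_ - _ * _).
    apply: eq_bigr => k _; rewrite cRe_sum; apply: eq_bigr => l _.
    by rewrite cReMr mxE mulrC.
  by apply: eq_bigr => k _; rewrite mxE.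
rewrite cImD cImN cImMr !cIm_sum; congr (_ - _ * _).
  apply: eq_bigr => k _; rewrite cIm_sum; apply: eq_bigr => l _.
  by rewrite cImMr mxE mulrC.
by apply: eq_bigr => k _; rewrite mxE.
Qed.

Section one_dimension.
Variables (n p : nat) (Y : T -> 'M[R]_(n, p)) (z : R[i]).
Variables (v : 'I_p -> R) (C K : R).
Hypothesis z0 : 0 < Im z.
Hypothesis n0 : (0 < n)%N.
Hypothesis mY : forall i j, measurable_fun setT (fun t => Y t i j).
Hypothesis Yind : independent_columns P Y.
Hypothesis v0 : forall j, 0 <= v j.
Hypothesis vC : forall j, v j <= C.
Hypothesis Yquad : forall j (M : 'M[R]_n),
  (\int[P]_t (quad_dev M (v j) (fun i => Y t i j) ^+ 2)%:E <=
   (K * \sum_k \sum_l M k l ^+ 2)%:E)%E.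

Let scaled (A : 'M[R]_(n, p)) := (Num.sqrt n%:R)^-1 *: A.
Let y := Im z.
Let kappa := normc z / y.

Let loo_err j A := normc (loo_form z (scaled A) j -
  (v j)%:C * gram_stieltjes z (replace_col j (scaled A) 0)).

Let nR : (0 : R) < n%:R. Proof. by rewrite ltr0n. Qed.

Let scaled_measurable d' (S : measurableType d') (X : S -> 'M[R]_(n, p)) :
  (forall i j, measurable_fun setT (fun s => X s i j)) ->
  forall i j, measurable_fun setT (fun s => scaled (X s) i j).
Proof.
by move=> mX i j; under eq_fun do rewrite mxE; exact: measurable_funM.
Qed.

Let loo_err_measurable j : mx_measurable (fun A => loo_err j A ^+ 2).
Proof.
move=> d' S X mX; apply: measurable_normc_sqr; apply: cmeasurableD.
  by apply: cmeasurable_loo_form => //; exact: scaled_measurable.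
apply: cmeasurableN; apply: cmeasurableM; first exact: cmeasurable_cst.
apply: cmeasurable_gram_stieltjes => // i l.
under eq_fun do rewrite replace_colE.
by case: (l == j); [by under eq_fun do rewrite mxE; exact: measurable_cst
                   |exact: scaled_measurable].
Qed.

Let quad_measurable j (M : 'M[R]_n) :
  measurable_fun setT (fun t => quad_dev M (v j) (fun i => Y t i j)).
Proof.
apply: measurable_funB => //; apply: measurable_sum => k.
apply: measurable_sum => l; apply: measurable_funM => //.
exact: measurable_funM.
Qed.

Let loo_err_integral_le j :
  (\int[P]_t (loo_err j (Y t) ^+ 2)%:E <= (K / (n%:R * y ^+ 2))%:E)%E.
Proof.
(* The sign of [K] is obtained by testing [Yquad] on the identity matrix. *)
have K0 : 0 <= K.
  have := Yquad j 1%:M; have -> : \sum_k \sum_l (1%:M : 'M[R]_n) k l ^+ 2 = n%:R.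
    under eq_bigr => k _.
      rewrite (bigD1 k)//= big1 => [|l /negPf lk]; last first.
        by rewrite mxE eq_sym lk expr0n.
      rewrite mxE eqxx expr1n addr0; over.
    by rewrite sumr_const card_ord.
  move=> h; rewrite -(pmulr_lge0 _ nR) -lee_fin; apply: le_trans h.
  by apply: integral_ge0 => t _; rewrite lee_fin sqr_ge0.
(* After resampling column [j], the resolvent without this column depends on [t] alone and is a
   fixed matrix in the inner integral, where the column is read at [t']; [Yquad] then applies to its
   real and imaginary parts. *)
rewrite (Yind j (h := fun A => loo_err j A ^+ 2))//; last by move=> A; exact: sqr_ge0.
have step t : (\int[P]_t' (loo_err j (replace_col j (Y t) (Y t')) ^+ 2)%:E <=
    (K / (n%:R * y ^+ 2))%:E)%E.
  pose G := resolvent (replace_col j (scaled (Y t)) 0) z.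
  have E t' : loo_err j (replace_col j (Y t) (Y t')) ^+ 2 = n%:R ^- 2 *
      (quad_dev (\matrix_(k, l) Re (G k l)) (v j) (fun i => Y t' i j) ^+ 2 +
       quad_dev (\matrix_(k, l) Im (G k l)) (v j) (fun i => Y t' i j) ^+ 2).
    rewrite /loo_err loo_form_sqr_norm//.
    have -> : replace_col j (scaled (replace_col j (Y t) (Y t'))) 0 =
        replace_col j (scaled (Y t)) 0.
      by apply/matrixP => k l; rewrite !mxE; case: (l == j).
    have -> : (fun i => replace_col j (Y t) (Y t') i j) = (fun i => Y t' i j).
      by apply/funext => i; rewrite mxE eqxx.
    by [].
  under eq_integral => t' _ do rewrite E EFinM EFinD.
  have n2 : (0 <= (n%:R ^- 2)%:E :> \bar R)%E by rewrite lee_fin invr_ge0 sqr_ge0.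
  have mq M : measurable_fun setT (fun t' : T =>
      (quad_dev M (v j) (fun i => Y t' i j) ^+ 2)%:E).
    by apply/measurable_EFinP/measurable_funX.
  rewrite ge0_integralZl//; last 2 first.
  - exact: emeasurable_funD.
  - by move=> t' _; rewrite -EFinD lee_fin addr_ge0// sqr_ge0.
  rewrite ge0_integralD//; last 2 first.
  - by move=> t' _; rewrite lee_fin sqr_ge0.
  - by move=> t' _; rewrite lee_fin sqr_ge0.
  apply: le_trans (lee_wpmul2l n2 (leeD (Yquad j _) (Yquad j _))) _.
  rewrite -EFinD -EFinM lee_fin -mulrDr mulrCA.
  have -> : K / (n%:R * y ^+ 2) = K * (n%:R ^- 2 * (n%:R / y ^+ 2)).
    by field; rewrite !gt_eqF.
  rewrite ler_wpM2l// ler_wpM2l ?invr_ge0 ?sqr_ge0//.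
  apply: le_trans (resolvent_entries_sum_le (replace_col j (scaled (Y t)) 0) z0).
  rewrite -big_split /=; apply: ler_sum => k _; rewrite -big_split /=.
  by apply: ler_sum => l _; rewrite !mxE normc_sqr.
apply: (@le_trans _ _ (\int[P]_t (K / (n%:R * y ^+ 2))%:E)%E); last first.
  by rewrite -(EFin_Rintegral (integrable_EFin_cst P _)) Rintegral_prob_cst.
apply: ge0_le_integral => //.
- by move=> t _; apply: integral_ge0 => t' _; rewrite lee_fin sqr_ge0.
- rewrite -[X in measurable_fun _ X]/(fubini_F P (fun u : T * T =>
    (loo_err j (replace_col j (Y u.1) (Y u.2)) ^+ 2)%:E)).
  apply: measurable_fun_fubini_tonelli_F => [|u]; last by rewrite lee_fin sqr_ge0.
  apply/measurable_EFinP; apply: loo_err_measurable => i l.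
  under eq_fun do rewrite replace_colE.
  case: (l == j); first exact: (measurableT_comp (mY i l) measurable_snd).
  exact: (measurableT_comp (mY i l) measurable_fst).
Qed.

Lemma MP_defect_second_moment :
  (\int[P]_t (normc (MP_defect z v (scaled (Y t))) ^+ 2)%:E <=
   (2 * kappa ^+ 4 * (p%:R / n%:R) ^+ 2 * ((K + C ^+ 2) / y ^+ 2) / n%:R)%:E)%E.
Proof.
(* [D] is the cost of leaving out a column. In [q], the 2 comes from [(a + b)^2 <= 2 (a^2 + b^2)],
   [kappa ^+ 4] from the square of the Lipschitz constant, and [p] from Cauchy-Schwarz over the
   columns. *)
pose D := C / (n%:R * y); pose q := 2 * n%:R ^- 2 * kappa ^+ 4 * p%:R.
have q0 : 0 <= q.
  by rewrite /q mulr_ge0// mulr_ge0 ?exprn_even_ge0// mulr_ge0// invr_ge0 sqr_ge0.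
have pw A : normc (MP_defect z v (scaled A)) ^+ 2 <=
    q * \sum_j (loo_err j A ^+ 2 + D ^+ 2).
  apply: (@le_trans _ _ ((n%:R^-1 * \sum_j kappa ^+ 2 * (loo_err j A + D)) ^+ 2)).
    have S0 : 0 <= n%:R^-1 * \sum_j kappa ^+ 2 *
        (normc (loo_form z (scaled A) j - (v j)%:C *
          gram_stieltjes z (replace_col j (scaled A) 0)) + C / (n%:R * Im z)).
      by apply: le_trans (MP_defect_le z0 v0 vC (scaled A) n0); exact: normc_ge0.
    rewrite ler_pXn2r ?nnegrE ?normc_ge0//.
    exact: (MP_defect_le z0 v0 vC (scaled A) n0).
  rewrite -mulr_sumr; set S := \sum_j (loo_err j A + D); set W := \sum_j _.
  have -> : (n%:R^-1 * (kappa ^+ 2 * S)) ^+ 2 = n%:R ^- 2 * kappa ^+ 4 * S ^+ 2.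
    by field; rewrite gt_eqF.
  have -> : q * W = n%:R ^- 2 * kappa ^+ 4 * (p%:R * (2 * W)) by rewrite /q; ring.
  have k4 : 0 <= kappa ^+ 4 by exact: exprn_even_ge0.
  rewrite ler_wpM2l ?(mulr_ge0 _ k4) ?invr_ge0 ?sqr_ge0//.
  apply: le_trans (sqr_sum_le _) _; rewrite ler_wpM2l//.
  rewrite mulr_sumr; apply: ler_sum => j _.
  by have := sqr_ge0 (loo_err j A - D); nra.
have mL j : measurable_fun setT (fun t => (loo_err j (Y t) ^+ 2)%:E).
  by apply/measurable_EFinP; exact: loo_err_measurable.
apply: (@le_trans _ _ (\int[P]_t (q%:E * \sum_j ((loo_err j (Y t) ^+ 2)%:E +
    (D ^+ 2)%:E)))%E).
  apply: ge0_le_integral => //.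
  - by move=> t _; rewrite lee_fin sqr_ge0.
  - apply/measurable_EFinP; apply: measurable_normc_sqr.
    by apply: cmeasurable_MP_defect => //; exact: scaled_measurable.
  - apply: emeasurable_funM => //; apply: emeasurable_sum => j _.
    exact: emeasurable_funD.
  move=> t _; apply: le_trans (_ : (q * \sum_j (loo_err j (Y t) ^+ 2 + D ^+ 2))%:E <= _)%E.
    by rewrite lee_fin.
  by rewrite EFinM -sumEFin.
have mS j : measurable_fun setT (fun t : T => ((loo_err j (Y t) ^+ 2)%:E + (D ^+ 2)%:E)%E).
  exact: emeasurable_funD.
have S0 j t : (0 <= (loo_err j (Y t) ^+ 2)%:E + (D ^+ 2)%:E)%E.
  by rewrite -EFinD lee_fin addr_ge0 ?sqr_ge0.
rewrite ge0_integralZl//; last 2 first.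
- exact: emeasurable_sum.
- by move=> t _; apply: sume_ge0.
rewrite ge0_integral_sum//.
apply: (@le_trans _ _ (q%:E * \sum_(j < p) (K / (n%:R * y ^+ 2) + D ^+ 2)%:E)%E).
  rewrite lee_wpmul2l ?lee_fin//; apply: lee_sum => j _.
  rewrite ge0_integralD//; last 2 first.
  - by move=> t _; rewrite lee_fin sqr_ge0.
  - by move=> t _; rewrite lee_fin sqr_ge0.
  rewrite EFinD leeD//.
  by rewrite -(EFin_Rintegral (integrable_EFin_cst P _)) Rintegral_prob_cst.
rewrite sumEFin -EFinM lee_fin sumr_const card_ord -[_ *+ p]mulr_natl.
have -> : 2 * kappa ^+ 4 * (p%:R / n%:R) ^+ 2 * ((K + C ^+ 2) / y ^+ 2) / n%:R =
    q * (p%:R * (K / (n%:R * y ^+ 2) + C ^+ 2 / (n%:R * y ^+ 2))).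
  by rewrite /q; field; rewrite !gt_eqF.
(* The square of [D] is of order [n^-2]; it is weakened to order [n^-1], using [1 <= n], to join the
   fluctuation term. *)
rewrite ler_wpM2l// ler_wpM2l// lerD2l /D expr_div_n.
rewrite ler_wpM2l ?sqr_ge0// lef_pV2 ?posrE ?exprn_gt0 ?mulr_gt0 ?exprn_gt0//.
rewrite exprMn ler_wpM2r ?sqr_ge0// expr2 ler_peMr// ?ler1n// ltW//.
Qed.

End one_dimension.

Variables (p : nat -> nat) (Y : forall n, T -> 'M[R]_(n, p n)).
Variables (v : forall n, 'I_(p n) -> R) (C K Kp : R).
Hypothesis mY : forall n i j, measurable_fun setT (fun t => Y n t i j).
Hypothesis Yind : forall n, independent_columns P (Y n).
Hypothesis v0 : forall n (j : 'I_(p n)), 0 <= v j.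
Hypothesis vC : forall n (j : 'I_(p n)), v j <= C.
Hypothesis pK : forall n, (0 < n)%N -> (p n)%:R <= Kp * n%:R.
Hypothesis Yquad : forall n (j : 'I_(p n)) (M : 'M[R]_n), (0 < n)%N ->
  (\int[P]_t (quad_dev M (v j) (fun i => Y n t i j) ^+ 2)%:E <=
   (K * \sum_k \sum_l M k l ^+ 2)%:E)%E.

Lemma MP_defect_ae_cvg0 (z : R[i]) : 0 < Im z ->
  {ae P, forall t, normc (MP_defect z (@v n) ((Num.sqrt n%:R)^-1 *: Y n t))
     @[n --> \oo] --> 0}.
Proof.
move=> z0; pose kappa := normc z / Im z.
pose F n (A : 'M[R]_(n, p n)) := MP_defect z (@v n) ((Num.sqrt n%:R)^-1 *: A).
have C0 n (j : 'I_(p n)) : 0 <= C by exact: le_trans (v0 j) (vC j).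
(* The signs of [C] and [K] are forced only when a column exists; truncation at 0 gives constants
   valid for all sizes. *)
pose C' := Num.max 0 C; have C'0 : 0 <= C' by rewrite le_max lexx.
have vC' n (j : 'I_(p n)) : v j <= C' by rewrite le_max vC orbT.
have K0 : 0 <= Num.max 0 K by rewrite le_max lexx.
pose K' := Num.max 0 K.
have Yquad' n (j : 'I_(p n)) (M : 'M[R]_n) : (0 < n)%N ->
  (\int[P]_t (quad_dev M (v j) (fun i => Y n t i j) ^+ 2)%:E <=
   (K' * \sum_k \sum_l M k l ^+ 2)%:E)%E.
  move=> n0; apply: le_trans (Yquad j M n0) _; rewrite lee_fin ler_wpM2r//.
    by do 2 (apply: sumr_ge0 => ? _); exact: sqr_ge0.
  by rewrite le_max lexx orbT.
have Kp0 : 0 <= Kp.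
  by have := pK (ltn0Sn 0); rewrite mulr1; apply: le_trans.
pose E0 := 2 * kappa ^+ 4 * Kp ^+ 2 * ((K' + C' ^+ 2) / Im z ^+ 2).
have pn n : (0 < n)%N -> (p n)%:R / n%:R <= Kp.
  by move=> n0; rewrite ler_pdivrMr ?ltr0n// pK.
have mscaled n d' (S : measurableType d') (X : S -> 'M[R]_(n, p n)) :
    (forall i j, measurable_fun setT (fun s => X s i j)) ->
    forall i j, measurable_fun setT (fun s => ((Num.sqrt n%:R)^-1 *: X s) i j).
  by move=> mX i j; under eq_fun do rewrite mxE; exact: measurable_funM.
have E2 n : (0 < n)%N ->
    (\int[P]_t (normc (F n (Y n t)) ^+ 2)%:E <= (E0 / n%:R)%:E)%E.
  move=> n0.
  apply: le_trans (MP_defect_second_moment z0 n0 (@mY n) (@Yind n) (@v0 n)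
    (@vC' n) (fun j M => Yquad' n j M n0)) _.
  rewrite lee_fin ler_wpM2r ?invr_ge0// ler_wpM2r//.
    by rewrite divr_ge0 ?sqr_ge0// addr_ge0 ?sqr_ge0.
  have k4 : 0 <= kappa ^+ 4 by exact: exprn_even_ge0.
  rewrite ler_wpM2l ?(mulr_ge0 _ k4)//.
  by rewrite ler_pXn2r ?nnegrE ?divr_ge0// pn.
have bd n A : normc (F n A) <= (1 + kappa) * (1 + (p n)%:R / n%:R).
  exact: MP_defect_bounded.
pose c := 2 * (normc z + Kp * (kappa ^+ 2 * C')) / Im z.
have df n A B k : (0 < n)%N -> replace_col k A 0 = replace_col k B 0 ->
    normc (F n A - F n B) <= c / n%:R.
  move=> n0 AB; have nR : (0 : R) < n%:R by rewrite ltr0n.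
  have sAB : replace_col k ((Num.sqrt n%:R)^-1 *: A) 0 =
      replace_col k ((Num.sqrt n%:R)^-1 *: B) 0.
    by rewrite -[0](scaler0 _ (Num.sqrt n%:R)^-1) !replace_colZ AB.
  apply: le_trans (MP_defect_bounded_diff z0 (@v0 n) (@vC' n) sAB) _.
  have -> : c / n%:R = (normc z + Kp * (kappa ^+ 2 * C')) * (2 / (n%:R * Im z)).
    by rewrite /c; field; rewrite !gt_eqF.
  have D0 : 0 <= 2 / (n%:R * Im z) by rewrite divr_ge0// ltW// mulr_gt0.
  have k2 : 0 <= kappa ^+ 2 * C' by rewrite (mulr_ge0 (sqr_ge0 _)).
  by rewrite ler_wpM2r// lerD2l ler_wpM2r// pn.
have e0 : E0 / n%:R @[n --> \oo] --> 0.
  rewrite -[X in _ --> X](mulr0 E0); apply: cvgM; first exact: cvg_cst.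
  apply/gtr0_cvgV0; last exact: cvgr_idn.
  by apply: filterS (nbhs_infty_gt 0) => n; rewrite ltr0n.
(* Concentration concerns real functions, so it is applied to the real and imaginary parts of the
   defect. *)
have main (g : R[i] -> R) : (forall w, `|g w| <= normc w) ->
    (forall w1 w2, g (w1 - w2) = g w1 - g w2) ->
    (forall n, mx_measurable (fun A => g (F n A))) ->
    {ae P, forall t, g (F n (Y n t)) @[n --> \oo] --> 0}.
  move=> gle gB mg; apply: (@bounded_difference_ae_cvg0 _ _ _ P p Y mY Yind
    (fun n A => g (F n A)) (fun n => (1 + kappa) * (1 + (p n)%:R / n%:R))
    (fun n => E0 / n%:R) c Kp) => //.
  - by move=> n A; apply: le_trans (gle _) (bd _ _).
  - by move=> n A B k n0 AB; rewrite -gB; apply: le_trans (gle _) _; exact: df AB.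
  move=> n n0; apply: le_trans _ (E2 n n0); apply: ge0_le_integral => //.
  - by move=> t _; rewrite lee_fin sqr_ge0.
  - by apply/measurable_EFinP/measurable_funX; apply: mg.
  - apply/measurable_EFinP; apply: measurable_normc_sqr.
    by apply: cmeasurable_MP_defect => //; exact: mscaled.
  move=> t _; rewrite lee_fin -real_normK ?num_real//.
  by rewrite ler_pXn2r ?nnegrE ?normc_ge0.
have mRe n : mx_measurable (fun A => Re (F n A)).
  by move=> d' S X mX; have [] := cmeasurable_MP_defect (@v n) z0 (mscaled _ _ _ _ mX).
have mIm n : mx_measurable (fun A => Im (F n A)).
  by move=> d' S X mX; have [] := cmeasurable_MP_defect (@v n) z0 (mscaled _ _ _ _ mX).
have hRe := main (@complex.Re R) (@Re_le_normc R)
  (fun w1 w2 => etrans (cReD _ _) (congr1 _ (cReN _))) mRe.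
have hIm := main (@complex.Im R) (@Im_le_normc R)
  (fun w1 w2 => etrans (cImD _ _) (congr1 _ (cImN _))) mIm.
apply: filterS2 hRe hIm => t hR hI.
have hS : `|Re (F n (Y n t))| + `|Im (F n (Y n t))| @[n --> \oo] --> 0.
  rewrite -[X in _ --> X](addr0 0); apply: cvgD.
    by rewrite -[X in _ --> X](normr0 R); exact: cvg_norm.
  by rewrite -[X in _ --> X](normr0 R); exact: cvg_norm.
apply: squeeze_cvgr (cvg_cst 0) hS; apply: nearW => n.
by rewrite normc_ge0 normc_le.
Qed.

End random_matrices.

(** * Stieltjes transforms and limits of measures *)

Section complex_continuity.
Variable R : realType.
Implicit Types f g : R -> R[i].

Definition ccontinuous f := continuous (fun x => Re (f x)) /\
  continuous (fun x => Im (f x)).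

Lemma ccontinuous_cst (c : R[i]) : ccontinuous (fun=> c).
Proof. by split => x; exact: cvg_cst. Qed.

Lemma ccontinuous_id : ccontinuous (fun x => x%:C).
Proof. by split => x; [exact: cvg_id|exact: cvg_cst]. Qed.

Lemma ccontinuousD f g : ccontinuous f -> ccontinuous g ->
  ccontinuous (fun x => f x + g x).
Proof.
move=> [f1 f2] [g1 g2]; split => x.
  by under eq_fun do rewrite cReD; apply: continuousD; [exact: f1|exact: g1].
by under eq_fun do rewrite cImD; apply: continuousD; [exact: f2|exact: g2].
Qed.

Lemma ccontinuousM f g : ccontinuous f -> ccontinuous g ->
  ccontinuous (fun x => f x * g x).
Proof.
move=> [f1 f2] [g1 g2]; split => x.
  under eq_fun do rewrite cReM.
  by apply: cvgB; apply: cvgM; [exact: f1|exact: g1|exact: f2|exact: g2].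
under eq_fun do rewrite cImM.
by apply: cvgD; apply: cvgM; [exact: f1|exact: g2|exact: f2|exact: g1].
Qed.

Lemma ccontinuousV f : ccontinuous f -> (forall x, f x != 0) ->
  ccontinuous (fun x => (f x)^-1).
Proof.
move=> [f1 f2] f0.
have n0 x : Re (f x) ^+ 2 + Im (f x) ^+ 2 != 0.
  by rewrite -normc_sqr gt_eqF// exprn_gt0// normc_gt0.
have cn : continuous (fun x => (Re (f x) ^+ 2 + Im (f x) ^+ 2)^-1).
  move=> x; apply: cvgV; first exact: n0.
  by apply: cvgD; [exact: cvgM (f1 x) (f1 x)|exact: cvgM (f2 x) (f2 x)].
split => x.
  under eq_fun do rewrite cRe_inv normc_sqr.
  by apply: cvgM; [exact: f1|exact: cn].
under eq_fun do rewrite cIm_inv normc_sqr.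
by apply: cvgM; [apply: cvgN; exact: f2|exact: cn].
Qed.

Lemma ccontinuous_cmeasurable f : ccontinuous f -> cmeasurable f.
Proof. by move=> [f1 f2]; split; exact: continuous_measurable_fun. Qed.

Lemma real_sub_neq0 (z : R[i]) (x : R) : 0 < Im z -> x%:C - z != 0.
Proof.
move=> z0; apply/eqP => /(congr1 (@complex.Im R)); rewrite cImD cImN /= add0r.
by move/eqP; rewrite oppr_eq0 gt_eqF.
Qed.

Lemma normc_real_sub (z : R[i]) (x : R) : 0 < Im z ->
  normc ((x%:C - z)^-1) <= (Im z)^-1.
Proof.
move=> z0; rewrite normcV lef_pV2 ?posrE// ?normc_gt0 ?real_sub_neq0//.
rewrite -normcN; apply: le_trans (Im_le_normc _).
by rewrite cImN cImD cImN /= add0r opprK ler_norm.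
Qed.

Lemma ccontinuous_stieltjes_kernel (z : R[i]) : 0 < Im z ->
  ccontinuous (fun x => (x%:C - z)^-1).
Proof.
move=> z0; apply: ccontinuousV => [|x]; last exact: real_sub_neq0.
by apply: ccontinuousD; [exact: ccontinuous_id|exact: ccontinuous_cst].
Qed.

Lemma neq0_1Dreal (m : R[i]) (t : R) : 0 < Im m -> 1 + t%:C * m != 0.
Proof.
move=> m0; apply/eqP => h; have := congr1 (@complex.Im R) h.
rewrite cImD cImMr /= add0r => /eqP; rewrite mulf_eq0 (gt_eqF m0) orbF => /eqP t0.
by move: h; rewrite t0 mul0r addr0 => /eqP; rewrite oner_eq0.
Qed.

(** The imaginary part of the denominator is [t * Im m]. The bound holds for every real [t], which
    makes the parts of the kernel admissible test functions for weak convergence. *)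
Lemma normc_MP_kernel (m : R[i]) (t : R) : 0 < Im m ->
  normc (t%:C / (1 + t%:C * m)) <= (Im m)^-1.
Proof.
move=> m0; have n0 := neq0_1Dreal t m0.
rewrite normcM normcV normc_real ler_pdivrMr ?normc_gt0//.
rewrite -ler_pdivrMl ?invr_gt0// invrK.
apply: le_trans (Im_le_normc _).
by rewrite cImD cImMr /= add0r normrM (gtr0_norm m0) mulrC.
Qed.

Lemma ccontinuous_MP_kernel (m : R[i]) : 0 < Im m ->
  ccontinuous (fun t => t%:C / (1 + t%:C * m)).
Proof.
move=> m0; apply: ccontinuousM; first exact: ccontinuous_id.
apply: ccontinuousV => [|t]; last exact: neq0_1Dreal.
apply: ccontinuousD; first exact: ccontinuous_cst.
by apply: ccontinuousM; [exact: ccontinuous_id|exact: ccontinuous_cst].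
Qed.

End complex_continuity.

Section complex_integrals.
Variables (R : realType) (mu : probability R R).
Implicit Types f g : R -> R[i].

Let intRe f b : cmeasurable f -> (forall x, normc (f x) <= b) ->
  mu.-integrable setT (EFin \o (fun x => Re (f x))).
Proof.
move=> [f1 _] fb; apply: (@integrable_bounded _ _ _ _ _ b) => // x.
exact: le_trans (Re_le_normc _) (fb x).
Qed.

Let intIm f b : cmeasurable f -> (forall x, normc (f x) <= b) ->
  mu.-integrable setT (EFin \o (fun x => Im (f x))).
Proof.
move=> [_ f2] fb; apply: (@integrable_bounded _ _ _ _ _ b) => // x.
exact: le_trans (Im_le_normc _) (fb x).
Qed.

Lemma measurable_normc f : cmeasurable f -> measurable_fun setT (fun x => normc (f x)).
Proof.
move=> mf; have -> : (fun x => normc (f x)) = (fun x => Num.sqrt (normc (f x) ^+ 2)).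
  by apply/funext => x; rewrite sqrtr_sqr ger0_norm// normc_ge0.
apply: (measurableT_comp (f := @Num.sqrt R)); last exact: measurable_normc_sqr.
by apply: continuous_measurable_fun; exact: sqrt_continuous.
Qed.

(** Multiplication by the conjugate of the integral [I] aligns the phase: [|I|^2] is the integral of
    the real part of the conjugate of [I] times [f], which is at most [|I| * |f|]. *)
Lemma normc_cintegral_le f b : cmeasurable f -> (forall x, normc (f x) <= b) ->
  normc (cintegral mu f) <= \int[mu]_x normc (f x).
Proof.
move=> mf fb; set I := cintegral mu f.
have [->|I0] := eqVneq I 0.
  by rewrite normc0; apply: Rintegral_ge0 => x _; exact: normc_ge0.
have Ip : 0 < normc I by rewrite normc_gt0.
rewrite -(ler_pM2l Ip) -expr2 normc_sqr !expr2.
rewrite [X in X * _ + _]/= [X in _ * X + _]/=.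
have fR := intRe mf fb; have fI := intIm mf fb.
have nf : mu.-integrable setT (EFin \o (fun x => normc (f x))).
  apply: (@integrable_bounded _ _ _ _ _ b); first exact: measurable_normc.
  by move=> x; rewrite ger0_norm ?normc_ge0.
rewrite -[X in X + _]RintegralZl// -[X in _ + X]RintegralZl//.
rewrite -RintegralZl// -RintegralD//; last 2 first.
- exact: integrable_EFinZ.
- exact: integrable_EFinZ.
apply: le_Rintegral => //.
- by apply: integrable_EFinD; exact: integrable_EFinZ.
- exact: integrable_EFinZ.
move=> x _; rewrite -normcM.
change (Re I * Re (f x) + Im I * Im (f x) <= normc (I * f x)).
have -> : normc (I * f x) = normc (I^* * f x).
  by rewrite !normcM; congr (_ * _); case: (I) => a c /=; rewrite sqrrN.
apply: le_trans (Re_le_normc _); apply: le_trans (ler_norm _).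
by case: (I) (f x) => a c [a' c'] /=; rewrite mulNr opprK.
Qed.

Lemma cintegralB f g b : cmeasurable f -> cmeasurable g ->
  (forall x, normc (f x) <= b) -> (forall x, normc (g x) <= b) ->
  cintegral mu (fun x => f x - g x) = cintegral mu f - cintegral mu g.
Proof.
move=> mf mg fb gb; apply: complex_eq; rewrite ?cReD ?cImD ?cReN ?cImN /=.
  rewrite -RintegralB//; [|exact: intRe fb|exact: intRe gb].
  by apply: eq_Rintegral => x _; rewrite cReD cReN.
rewrite -RintegralB//; [|exact: intIm fb|exact: intIm gb].
by apply: eq_Rintegral => x _; rewrite cImD cImN.
Qed.

End complex_integrals.

(** * Uniqueness in the Marchenko-Pastur equation *)

Section MP_uniqueness.
Variables (R : realType) (gamma : R) (H : probability R R).
Hypothesis gamma_gt0 : 0 < gamma.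

Let g (m : R[i]) (t : R) : R[i] := t%:C / (1 + t%:C * m).

Let gm m : 0 < Im m -> cmeasurable (g m).
Proof. by move=> m0; exact/ccontinuous_cmeasurable/ccontinuous_MP_kernel. Qed.

Let g2_int m : 0 < Im m -> H.-integrable setT (EFin \o (fun t => normc (g m t) ^+ 2)).
Proof.
move=> m0; apply: (@integrable_bounded _ _ _ _ _ ((Im m)^-1 ^+ 2)).
  exact/measurable_normc_sqr/gm.
move=> t; rewrite ger0_norm ?sqr_ge0//.
rewrite ler_pXn2r ?nnegrE ?normc_ge0 ?invr_ge0 ?(ltW m0)//.
exact: normc_MP_kernel.
Qed.

Let Im_g m t : 0 < Im m -> Im (g m t) = - Im m * normc (g m t) ^+ 2.
Proof.
move=> m0; have n0 := neq0_1Dreal t m0.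
rewrite /g cImMr cIm_inv cImD cImMr /= add0r normcM normcV normc_real exprMn.
by rewrite exprVn real_normK ?num_real//; ring.
Qed.

(** Imaginary parts of the equation are compared, with [Im (g m t) = - Im m * |g m t|^2]. For
    [0 < Im z] the value is strictly below [|m|^-2], and this strictness is what makes the solution
    unique. *)
Lemma MP_second_moment (z m : R[i]) : 0 < Im m -> MP_equation gamma H z m ->
  gamma * \int[H]_t (normc (g m t) ^+ 2) = (normc m ^+ 2)^-1 - Im z / Im m.
Proof.
move=> m0 /(congr1 (@complex.Im R)); rewrite cImD cIm_inv cImMr /=.
under eq_Rintegral do rewrite -/(g _ _) Im_g//.
rewrite RintegralZl//; last exact: g2_int.
have m00 : Im m != 0 by rewrite gt_eqF.
move=> h; apply: (mulfI m00).
have -> : Im m * ((normc m ^+ 2)^-1 - Im z / Im m) = - (Im z + - Im m / normc m ^+ 2).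
  by field; rewrite !gt_eqF// normc_gt0 Im_gt0_neq0.
by rewrite h; ring.
Qed.

(** Subtracting the equations and cancelling [m2 - m1] would give
    [1 / (m1 m2) = gamma * \int g1 g2]. By a weighted mean inequality and the second moment identity
    the right side is strictly smaller in modulus than the left. *)
Lemma MP_unique (z m1 m2 : R[i]) : 0 < Im z -> 0 < Im m1 -> 0 < Im m2 ->
  MP_equation gamma H z m1 -> MP_equation gamma H z m2 -> m1 = m2.
Proof.
move=> z0 m10 m20 e1 e2; apply/eqP; apply/negP => /negP m12.
have n1 : 0 < normc m1 by rewrite normc_gt0 Im_gt0_neq0.
have n2 : 0 < normc m2 by rewrite normc_gt0 Im_gt0_neq0.
have m1n : m1 != 0 by rewrite Im_gt0_neq0.
have m2n : m2 != 0 by rewrite Im_gt0_neq0.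
have d0 : 0 < normc (m2 - m1) by rewrite normc_gt0 subr_eq0 eq_sym.
have I1 := MP_second_moment m10 e1; have I2 := MP_second_moment m20 e2.
have gdiff t : g m1 t - g m2 t = (m2 - m1) * (g m1 t * g m2 t).
  rewrite /g; field; rewrite !neq0_1Dreal//.
have : m1^-1 - m2^-1 = gamma%:C * cintegral H (fun t => g m1 t - g m2 t).
  rewrite (@cintegralB _ H _ _ ((Im m1)^-1 + (Im m2)^-1)) //; [|exact: gm|exact: gm| |].
  - move: e1 e2; rewrite /MP_equation -!/(g _ _) => e1 e2.
    by rewrite mulrBr -e1 -e2; ring.
  - move=> t; apply: le_trans (normc_MP_kernel t m10) _.
    by rewrite lerDl invr_ge0 ltW.
  - move=> t; apply: le_trans (normc_MP_kernel t m20) _.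
    by rewrite lerDr invr_ge0 ltW.
move/(congr1 (@normc R)); apply/eqP; rewrite gt_eqF//.
have -> : normc (m1^-1 - m2^-1) = normc (m2 - m1) / (normc m1 * normc m2).
  by rewrite -normcM -normcV -normcM; congr normc; field; rewrite ?m1n ?m2n.
rewrite normcM normc_real gtr0_norm//.
(* This weight makes both main terms equal: [al / |m1|^2 = al^-1 / |m2|^2 = 1 / (|m1| |m2|)]. *)
pose al := normc m1 / normc m2; have al0 : 0 < al by exact: divr_gt0.
pose h t := normc (m2 - m1) / 2 *
  (al * normc (g m1 t) ^+ 2 + al^-1 * normc (g m2 t) ^+ 2).
have mgd : cmeasurable (fun t => g m1 t - g m2 t).
  by apply: cmeasurableD; [exact: gm|apply: cmeasurableN; exact: gm].
have gdb t : normc (g m1 t - g m2 t) <= (Im m1)^-1 + (Im m2)^-1.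
  apply: le_trans (le_normcD _ _) _; rewrite normcN.
  by apply: lerD; exact: normc_MP_kernel.
have hi : H.-integrable setT (EFin \o h).
  apply: integrable_EFinZ; apply: integrable_EFinD; apply: integrable_EFinZ;
  exact: g2_int.
apply: (@le_lt_trans _ _ (gamma * \int[H]_t h t)).
  rewrite ler_pM2l//; apply: le_trans (normc_cintegral_le H mgd gdb) _.
  apply: le_Rintegral => //.
    apply: (@integrable_bounded _ _ _ _ _ ((Im m1)^-1 + (Im m2)^-1)).
      exact: measurable_normc.
    by move=> t; rewrite ger0_norm ?normc_ge0.
  move=> t _; rewrite gdiff normcM (normcM (g m1 t)) /h -mulrA ler_pM2l//.
  rewrite ler_pdivlMl//.
  move: (normc (g m1 t)) (normc (g m2 t)) => a b.
  have : 0 <= al^-1 * (al * a - b) ^+ 2 by rewrite mulr_ge0 ?sqr_ge0 ?invr_ge0 ?ltW.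
  have -> : al^-1 * (al * a - b) ^+ 2 = al * a ^+ 2 + al^-1 * b ^+ 2 - 2 * (a * b).
    by field; rewrite gt_eqF.
  by rewrite subr_ge0.
rewrite RintegralZl//; last first.
  by apply: integrable_EFinD; apply: integrable_EFinZ; exact: g2_int.
rewrite RintegralD//; last 2 first.
- by apply: integrable_EFinZ; exact: g2_int.
- by apply: integrable_EFinZ; exact: g2_int.
rewrite !RintegralZl//; last 2 first.
- exact: g2_int.
- exact: g2_int.
move: I1 I2; set J1 := \int[H]_t _; set J2 := \int[H]_t _ => I1 I2.
have -> : gamma * (normc (m2 - m1) / 2 * (al * J1 + al^-1 * J2)) =
  normc (m2 - m1) * (2^-1 * (al * (gamma * J1) + al^-1 * (gamma * J2))).
  by ring.
rewrite ltr_pM2l// I1 I2 /al.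
have y1 : 0 < Im z / Im m1 by exact: divr_gt0.
have y2 : 0 < Im z / Im m2 by exact: divr_gt0.
move: n1 n2 y1 y2; move: (normc m1) (normc m2) (Im z / Im m1) (Im z / Im m2).
move=> a b p q a0 b0 p0 q0; rewrite -subr_gt0.
have -> : (a * b)^-1 - 2^-1 * (a / b * ((a ^+ 2)^-1 - p) + (a / b)^-1 *
   ((b ^+ 2)^-1 - q)) = 2^-1 * (a / b * p + b / a * q).
  by field; rewrite !gt_eqF.
by rewrite mulr_gt0// addr_gt0// mulr_gt0// divr_gt0.
Qed.

End MP_uniqueness.

(** * Limits along ultrafilters *)

Section ultrafilter_limits.
Variable R : realType.

Lemma ultra_bounded_cvg (U : set_system nat) (u : nat -> R) (a b : R) :
  UltraFilter U -> (forall n, a <= u n <= b) ->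
  exists l : R, u n @[n --> U] --> l.
Proof.
move=> UU uab; have := @segment_compact R a b (u @ U) _ _.
case=> [|l [lab lcl]].
  by rewrite /fmap /=; apply: filterS filterT => n _ /=; rewrite in_itv /= uab.
exists l => V Vl.
have [//|nV] := in_ultra_setVsetC (u @^-1` V) UU.
by have [x [/= nVx Vx]] := lcl (~` V) V nV Vl.
Qed.

(** If the set of indices where [u] is close to [l] were not eventual, the trace of [\oo] on its
    complement would be a proper filter, and an ultrafilter above it would contain both this set and
    its complement. *)
Lemma cvg_ultraP (u : nat -> R) (l : R) :
  (forall U : set_system nat, UltraFilter U -> \oo `<=` U -> u n @[n --> U] --> l) ->
  u n @[n --> \oo] --> l.
Proof.
move=> h; apply/cvgrPdist_lt => e e0; apply: contrapT => nA.
pose A := [set n | `|l - u n| < e].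
have WF : ProperFilter (within (~` A) \oo).
  apply: Build_ProperFilter => W0; apply: nA.
  move: W0; rewrite /within /= => W0.
  by apply: (filterS _ W0) => n An; apply: contrapT => nAn; exact: An nAn.
have [U [UU WU]] := ultraFilterLemma WF.
have ooU : \oo `<=` U by move=> B ooB; apply: WU; apply: filterS ooB => n + _.
have UA : U A by move/cvgrPdist_lt : (h U UU ooU); apply.
have UnA : U (~` A) by apply: WU; exact: withinT.
have /filter_ex[n []//] : U (A `&` ~` A) by exact: filterI.
Qed.

End ultrafilter_limits.

(** * Distribution functions and Helly selection *)

Section measures_from_distribution_functions.
Variable R : realType.

Lemma probability_of_cdf (F : R -> R) : nondecreasing F ->
  (forall x, F y @[y --> x^'+] --> F x) ->
  F x @[x --> -oo] --> (0 : R) -> F x @[x --> +oo] --> (1 : R) ->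
  exists mu : probability R R, forall x, mu `]-oo, x]%classic = (F x)%:E.
Proof.
move=> Fnd Frc F0 F1.
pose Fc : cumulativeBounded (0 : R) (1 : R) := HB.pack F
  (isCumulative.Build R _ R F Fnd Frc) (isCumulativeBounded.Build R 0 1 F F0 F1).
pose P : probability (measurableTypeR R) R := lebesgue_stieltjes_measure Fc.
(* The Stieltjes measure lives on [measurableTypeR R]; its push-forward under the identity is a
   measure on [R]. *)
pose idR : measurableTypeR R -> R := idfun.
pose X : {mfun measurableTypeR R >-> R} := HB.pack idR
  (isMeasurableFun.Build _ _ _ _ idR (@measurable_id _ _ setT)).
exists (distribution P X) => x; exact: (cdf_lebesgue_stieltjes_id Fc x).
Qed.

Lemma probability_eq_itvNy (mu nu : probability R R) :
  (forall x, mu `]-oo, x]%classic = nu `]-oo, x]%classic) ->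
  forall A, measurable A -> mu A = nu A.
Proof.
move=> mn; have mnoc (a b : R) : mu `]a, b]%classic = nu `]a, b]%classic.
  have E (P : probability R R) : a <= b -> P `]a, b]%classic =
      (P `]-oo, b]%classic - P `]-oo, a]%classic)%E.
    move=> ab; have -> : `]a, b]%classic = `]-oo, b]%classic `\` `]-oo, a]%classic.
      apply/seteqP; split=> x /=; rewrite !in_itv/=.
        by move=> /andP[ax ->]; split => //; apply/negP; rewrite -ltNge.
      by move=> [xb /negP]; rewrite -ltNge => ->.
    rewrite measureD// ?setIidr//; first exact: subset_itvl.
    by rewrite -ge0_fin_numE// fin_num_measure.
  have [ab|ba] := leP a b; first by rewrite !E// !mn.
  by rewrite set_itv_ge ?measure0// bnd_simp -leNgt ltW.
move=> A mA; apply: (@measure_unique _ _ _ (@ocitv R)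
  (fun k => `](- k%:R), k%:R]%classic)) => //.
- exact: ocitvI.
- by move=> i; exact: is_ocitv.
- apply/seteqP; split=> // x _; exists (Num.bound x) => //=; rewrite in_itv/=.
  have := archi_boundP (normr_ge0 x); rewrite /Num.bound normr_id.
  rewrite ltr_norml => /andP[-> /ltW ->//].
- by move=> _ [[a b] /= _ <-]; exact: mnoc.
- by move=> k; rewrite -ge0_fin_numE// fin_num_measure.
Qed.

Let e (a x : R) : R := (x <= a)%R%:R.

Let measurable_e a : measurable_fun setT (e a).
Proof.
have -> : e a = \1_`]-oo, a].
  apply/funext => x; rewrite /e indicE; congr (nat_of_bool _)%:R.
  by apply/idP/idP => [xa|/set_mem]; rewrite ?inE /= in_itv.
exact: measurable_indic.
Qed.

Let e_int (mu : probability R R) a : mu.-integrable setT (EFin \o e a).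
Proof.
apply: (@integrable_bounded _ _ _ _ _ 1) => [|x]; first exact: measurable_e.
by rewrite ger0_norm ?ler0n// lern1 leq_b1.
Qed.

Let integral_e (mu : probability R R) a : \int[mu]_x e a x = fine (mu `]-oo, a]%classic).
Proof.
have -> : e a = \1_`]-oo, a].
  apply/funext => x; rewrite /e indicE; congr (nat_of_bool _)%:R.
  by apply/idP/idP => [xa|/set_mem]; rewrite ?inE /= in_itv.
by rewrite /Rintegral integral_indic// setIT.
Qed.

(** The difference of the two [e] terms is the indicator of a cell open on the left and closed on
    the right, so the integral of the sum only involves values of the distribution function. *)
Definition step_sum (c v : nat -> R) (m : nat) (x : R) : R :=
  \sum_(i < m) v i * (e (c i.+1) x - e (c i) x).

(** The factor of [B] is the indicator of the complement of the gridded interval, where the step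
    function vanishes and [f] is only bounded. *)
Let step_sum_dist (f : R -> R) (c v : nat -> R) (m : nat) (eps B : R) :
  0 <= eps -> (forall i j, (i <= j)%N -> c i <= c j) ->
  (forall x, `|f x| <= B) ->
  (forall i x, (i < m)%N -> c i < x <= c i.+1 -> `|f x - v i| <= eps) ->
  forall x, `|f x - step_sum c v m x| <= eps + B * (e (c 0%N) x + 1 - e (c m) x).
Proof.
move=> eps0 cnd fB fv x.
have c0m k : c 0%N <= c k by apply: cnd.
have H k : (k <= m)%N ->
    [/\ x <= c 0%N -> step_sum c v k x = 0,
        c k < x -> step_sum c v k x = 0 &
        c 0%N < x <= c k -> `|f x - step_sum c v k x| <= eps].
  elim: k => [|k IHk] km; rewrite /step_sum.
    by split => [_|_|/andP[/lt_le_trans h /h]]; rewrite ?big_ord0// ltxx.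
  have [h1 h2 h3] := IHk (ltnW km); rewrite big_ord_recr /= -/(step_sum c v k x).
  split => [xc|xc|/andP[cx xc]].
  - by rewrite h1// /e (le_trans xc (c0m k)) (le_trans xc (c0m k.+1)) subrr mulr0 addr0.
  - have ck : c k < x by apply: le_lt_trans xc; exact: cnd.
    by rewrite h2// /e !leNgt xc ck subrr mulr0 addr0.
  have [xk|kx] := leP x (c k).
    by rewrite /e xk (le_trans xk (cnd _ _ (leqnSn k))) subrr mulr0 addr0 h3// cx.
  have e1 : e (c k.+1) x = 1 by rewrite /e xc.
  have e2 : e (c k) x = 0 by rewrite /e leNgt kx.
  by rewrite h2// add0r e1 e2 subr0 mulr1; apply: fv => //; rewrite kx.
have [h1 h2 h3] := H m (leqnn m).
have B0 : 0 <= B by apply: le_trans (fB x).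
have [xc|cx] := leP x (c 0%N).
  rewrite h1// subr0 /e xc (le_trans xc (c0m m)) addrK mulr1.
  by apply: le_trans (fB x) _; rewrite lerDr.
have [xm|mx] := leP x (c m).
  apply: le_trans (h3 _) _; first by rewrite cx.
  have e1 : e (c 0%N) x = 0 by rewrite /e leNgt cx.
  have e2 : e (c m) x = 1 by rewrite /e xm.
  by rewrite e1 e2 add0r subrr mulr0 addr0.
have e1 : e (c 0%N) x = 0 by rewrite /e leNgt cx.
have e2 : e (c m) x = 0 by rewrite /e leNgt mx.
rewrite h2// subr0 e1 e2 add0r subr0 mulr1.
by apply: le_trans (fB x) _; rewrite lerDr.
Qed.

Lemma integral_step_approx (mu : probability R R) (f : R -> R) (c v : nat -> R)
    (m : nat) (eps B : R) : continuous f ->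
  0 <= eps -> (forall i j, (i <= j)%N -> c i <= c j) ->
  (forall x, `|f x| <= B) ->
  (forall i x, (i < m)%N -> c i < x <= c i.+1 -> `|f x - v i| <= eps) ->
  `|\int[mu]_x f x - \sum_(i < m) v i * (fine (mu `]-oo, c i.+1]%classic) -
     fine (mu `]-oo, c i]%classic))| <=
  eps + B * (fine (mu `]-oo, c 0%N]%classic) + 1 - fine (mu `]-oo, c m]%classic)).
Proof.
move=> cf eps0 cnd fB fv.
have mf : measurable_fun setT f by exact: continuous_measurable_fun.
have fi : mu.-integrable setT (EFin \o f) by exact: integrable_bounded fB.
have ei a := e_int mu a.
have ti i : mu.-integrable setT (EFin \o (fun x => v i * (e (c i.+1) x - e (c i) x))).
  by apply: integrable_EFinZ; exact: integrable_EFinB.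
have si k : mu.-integrable setT (EFin \o step_sum c v k).
  elim: k => [|k IHk].
    apply: eq_integrable (integrable_EFin_cst mu 0) => // x _ /=.
    by rewrite /step_sum big_ord0.
  apply: eq_integrable (integrable_EFinD IHk (ti k)) => // x _ /=.
  by rewrite /step_sum big_ord_recr.
have sE k : \int[mu]_x step_sum c v k x =
    \sum_(i < k) v i * (fine (mu `]-oo, c i.+1]%classic) - fine (mu `]-oo, c i]%classic)).
  elim: k => [|k IHk].
    rewrite big_ord0 -[RHS](Rintegral_prob_cst mu); apply: eq_Rintegral => x _.
    by rewrite /step_sum big_ord0.
  rewrite big_ord_recr /= -IHk -!integral_e -RintegralB// -RintegralZl//; last first.
    exact: integrable_EFinB.
  rewrite -RintegralD//; apply: eq_Rintegral => x _.
  by rewrite /step_sum big_ord_recr.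
rewrite -sE -RintegralB//.
have di : mu.-integrable setT (EFin \o (fun x => f x - step_sum c v m x)).
  exact: integrable_EFinB.
apply: le_trans (le_normr_Rintegral _ di) _ => //.
have -> : eps + B * (fine (mu `]-oo, c 0%N]%classic) + 1 - fine (mu `]-oo, c m]%classic)) =
  \int[mu]_x (eps + B * (e (c 0%N) x + 1 - e (c m) x)).
  have i1 : mu.-integrable setT (EFin \o (fun x => e (c 0%N) x + 1)).
    by apply: integrable_EFinD => //; exact: integrable_EFin_cst.
  have i2 : mu.-integrable setT (EFin \o (fun x => e (c 0%N) x + 1 - e (c m) x)).
    exact: integrable_EFinB.
  rewrite RintegralD//; last 2 first.
  - exact: integrable_EFin_cst.
  - exact: integrable_EFinZ.
  rewrite Rintegral_prob_cst RintegralZl// RintegralB// RintegralD//; last first.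
    exact: integrable_EFin_cst.
  by rewrite Rintegral_prob_cst !integral_e.
apply: le_Rintegral => //.
- exact: integrable_norm.
- apply: integrable_EFinD; first exact: integrable_EFin_cst.
  apply: integrable_EFinZ; apply: integrable_EFinB => //.
  by apply: integrable_EFinD => //; exact: integrable_EFin_cst.
by move=> x _; apply: step_sum_dist.
Qed.

(** Only [x] is confined to the segment: the points compared with grid points may overshoot its
    right end. *)
Lemma unif_continuous_segment (f : R -> R) (a b eps : R) : continuous f -> 0 < eps ->
  exists2 dl, 0 < dl & forall x y, a <= x <= b -> `|x - y| < dl -> `|f x - f y| <= eps.
Proof.
move=> cf eps0.
have nc : near_covering `[a, b]%classic.
  exact/compact_near_coveringP/segment_compact.
have : \forall dl \near 0^'+, `[a, b]%classic `<=`
    (fun x => forall y, `|x - y| < dl -> `|f x - f y| <= eps).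
  apply: nc => x _; have e2 : 0 < eps / 2 by exact: divr_gt0.
  have /cvgrPdist_lt/(_ _ e2) := cf x.
  rewrite -nbhs_nearE => /nbhs_ballP[r /= r0 xr]; have r2 : 0 < r / 2 by exact: divr_gt0.
  exists (ball x (r / 2), [set dl | dl < r / 2]) => /=.
    by split; [exact: nbhsx_ballx|exact: nbhs_right_lt].
  move=> [x' dl] [/= xx' dlr] y x'y.
  have fx' : `|f x - f x'| < eps / 2.
    by apply: xr; apply: lt_trans xx' _; rewrite ltr_pdivrMr// mulr_natr mulr2n ltrDl.
  have fy : `|f x - f y| < eps / 2.
    apply: xr; rewrite /ball /= -(subrKA x'); apply: le_lt_trans (ler_normD _ _) _.
    rewrite (splitr r) ltrD//; exact: lt_trans x'y dlr.
  rewrite -(subrKA (f x)) (le_trans (ler_normD _ _))// (splitr eps) lerD ?ltW//.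
  by rewrite distrC.
move=> h; have /filter_ex[dl [dlP dl0]] : \forall dl \near 0^'+,
    `[a, b]%classic `<=` (fun x => forall y, `|x - y| < dl -> `|f x - f y| <= eps) /\
    0 < dl.
  by apply: filterI => //; exact: nbhs_right_gt.
by exists dl => // x y xab; apply: dlP; rewrite /= in_itv.
Qed.

End measures_from_distribution_functions.

Section helly.
Variables (R : realType) (U : set_system nat) (mu_ : nat -> probability R R).
Hypothesis UU : UltraFilter U.
Let g n x : R := fine (mu_ n `]-oo, x]%classic).
Hypothesis g_tight : forall e : R, 0 < e -> exists M, \forall n \near U, 1 - e <= g n M.
Hypothesis g_neg : forall n x, x < 0 -> g n x = 0.

Let UF : ProperFilter U := @ultra_proper _ _ UU.

Let g_ge0 n x : 0 <= g n x. Proof. exact: fine_ge0. Qed.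

Let g_le1 n x : g n x <= 1.
Proof. by rewrite -lee_fin fineK ?fin_num_measure ?probability_le1. Qed.

Let g_nd n x y : x <= y -> g n x <= g n y.
Proof.
move=> xy; rewrite fine_le ?fin_num_measure// le_measure ?inE//.
by apply: subset_itvl; rewrite bnd_simp.
Qed.

(** The distribution functions converge pointwise along [U] to [G], which need not be
    right-continuous; the measure is built from a regularization [F]. Riemann-Stieltjes sums compare
    the integrals. As [F] and [G] can differ at jumps, the grid is kept fixed for [mu] but shifted
    slightly to the right for [mu_ n]. *)
Lemma helly_ultra : exists mu : probability R R,
  (forall x, x < 0 -> mu `]-oo, x]%classic = 0%E) /\
  forall f : R -> R, continuous f -> bounded_fun f ->
    \int[mu_ n]_x f x @[n --> U] --> \int[mu]_x f x.
Proof.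
have GP x : {l : R | g n x @[n --> U] --> l}.
  apply: cid; apply: (@ultra_bounded_cvg _ _ _ 0 1) => // n.
  by rewrite g_ge0 g_le1.
pose G x := sval (GP x); have Gc x : g n x @[n --> U] --> G x := svalP (GP x).
have G_ge0 x : 0 <= G x by apply: (cvgr_to_ge (Gc x)); exact: nearW.
have G_le1 x : G x <= 1 by apply: (cvgr_to_le (Gc x)); exact: nearW.
have G_nd x y : x <= y -> G x <= G y.
  by move=> xy; apply: (ler_cvg_to (Gc x) (Gc y)); apply: nearW => n; exact: g_nd.
have G_neg x : x < 0 -> G x = 0.
  move=> x0; apply/eqP; rewrite eq_le G_ge0 andbT; apply: (cvgr_to_le (Gc x)).
  by apply: nearW => n; rewrite g_neg.
(* The infimum over points strictly to the right turns [G] into a right-continuous function. *)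
pose A x := [set G y | y in [set y | x < y]].
have AI x : has_inf (A x).
  split; first by exists (G (x + 1)), (x + 1) => //=; rewrite ltrDl.
  by exists 0 => _ [y _ <-].
pose F x := inf (A x).
have FG x y : x < y -> F x <= G y.
  by move=> xy; apply: ge_inf; [exact: (AI x).2|exists y].
have GF x : G x <= F x.
  by apply: lb_le_inf; [exact: (AI x).1|move=> _ [y /= xy <-]; exact/G_nd/ltW].
have Fad x (e : R) : 0 < e -> exists2 y, x < y & G y < F x + e.
  by move=> e0; have [_ [y xy <-] ye] := inf_adherent e0 (AI x); exists y.
have F_nd : nondecreasing F.
  move=> x y; rewrite le_eqVlt => /predU1P[->//|xy].
  exact: le_trans (FG _ _ xy) (GF y).
have F_neg x : x < 0 -> F x = 0.
  move=> x0; apply/eqP; rewrite eq_le (le_trans (G_ge0 x) (GF x)) andbT.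
  have x2 : x / 2 < 0 by rewrite pmulr_llt0.
  by rewrite -(G_neg _ x2); apply: FG; lra.
have F_le1 x : F x <= 1 by apply: le_trans (G_le1 (x + 1)); apply: FG; rewrite ltrDl.
have F_rc x : F y @[y --> x^'+] --> F x.
  apply/cvgrPdist_le => e e0; have [y xy ye] := Fad x _ e0; near=> t.
  have xt : x < t by near: t; exact: nbhs_right_gt.
  have xFt : F x <= F t by exact/F_nd/ltW.
  have tFy : F t <= G y by apply: FG; near: t; exact: nbhs_right_lt.
  by rewrite ler_norml; apply/andP; split; lra.
have F_ny : F x @[x --> -oo] --> (0 : R).
  by apply: cvg_near_cst; near=> x; apply: F_neg; near: x; exact: nbhs_ninfty_lt.
have G_M (e : R) : 0 < e -> exists M, 1 - e <= G M.
  move=> e0; have [M hM] := g_tight e0; exists M; exact: (cvgr_to_ge (Gc M)).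
have F_y : F x @[x --> +oo] --> (1 : R).
  apply/cvgrPdist_le => e e0; have [M GM] := G_M _ e0; near=> t.
  rewrite ger0_norm ?subr_ge0// lerBlDr -lerBlDl (le_trans GM)// (le_trans (GF M))//.
  by apply: F_nd; near: t; apply: nbhs_pinfty_ge; exact: num_real.
have [mu muF] := probability_of_cdf F_nd F_rc F_ny F_y.
exists mu; split => [x x0|f cf [B0 [_ fB0]]]; first by rewrite muF F_neg.
have [B Bp fB] : exists2 B, 0 < B & forall x, `|f x| <= B.
  exists (`|B0| + 1); first by rewrite ltr_pwDr.
  by move=> x; apply: fB0 => //=; apply: le_lt_trans (ler_norm _) _; rewrite ltrDl.
apply/cvgrPdist_le => e e0.
(* Each integral is within [2 e1] of its step sum, one [e1] for oscillation and one for the mass off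
   the grid; comparing the two sums costs the fifth. *)
pose e1 := e / 5; have e10 : 0 < e1 by rewrite divr_gt0.
pose dl0 := e1 / B; have dl00 : 0 < dl0 by rewrite divr_gt0.
have [M0 gM0] := g_tight dl00.
pose M := Num.max M0 0.
have M_ge0 : 0 <= M by rewrite le_max lexx orbT.
have gM : \forall n \near U, 1 - dl0 <= g n M.
  by apply: filterS gM0 => n /le_trans; apply; apply: g_nd; rewrite le_max lexx.
have GM : 1 - dl0 <= G M by exact: (cvgr_to_ge (Gc M)).
have [dl dlp unif] := unif_continuous_segment (- 1) M cf e10.
pose m := (Num.bound (2 * (M + 1) / dl)).+1.
have mp : 0 < m%:R :> R by rewrite ltr0n.
pose h := (M + 1) / m%:R.
have M1 : 0 < M + 1 by rewrite ltr_wpDl.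
have h0 : 0 < h by rewrite divr_gt0.
have hdl : h < dl / 2.
  rewrite ltr_pdivrMr// -ltr_pdivrMl ?divr_gt0// invf_div mulrC mulrA (mulrC _ 2).
  have q0 : 0 <= 2 * (M + 1) / dl by rewrite divr_ge0 ?mulr_ge0 ?ltW.
  by apply: lt_trans (archi_boundP q0) _; rewrite ltr_nat.
(* The grid starts at [-1], where all distribution functions vanish with room for a shift, and ends
   at [M], beyond which the mass is at most [dl0]. *)
pose c i : R := - 1 + i%:R * h.
have c0 : c 0%N = -1 by rewrite /c mul0r addr0.
have cm : c m = M by rewrite /c mulrC divfK ?gt_eqF// addrC addrK.
have cS i : c i.+1 = c i + h by rewrite /c -natr1 mulrDl mul1r addrA.
have c_nd i j : (i <= j)%N -> c i <= c j.
  by move=> ij; rewrite lerD2l ler_pM2r// ler_nat.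
have vE (tau : R) i x : 0 <= tau -> tau < dl / 2 -> (i < m)%N ->
    c i + tau < x <= c i.+1 + tau -> `|f x - f (c i)| <= e1.
  move=> t0 tdl im /andP[cx xc]; rewrite distrC; apply: unif.
    by rewrite -c0 -cm !c_nd// ltnW.
  rewrite distrC ger0_norm; last by rewrite subr_ge0 ltW// (le_lt_trans _ cx)// lerDl.
  by rewrite ltrBlDl (le_lt_trans xc)// cS; lra.
(* Each of the [m] cells contributes at most [2 * B * eta], for a total of [e1]. *)
pose eta := e1 / (2 * (m%:R * B)).
have eta0 : 0 < eta by rewrite divr_gt0// !mulr_gt0.
(* Just to the right of a grid point, [G] lies between [F] at that point and a slightly larger
   value. The bound [dl / 2] keeps shifted cells within the modulus of continuity, and [1 / 2] keeps
   the first shifted point negative. *)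
have [tau [[tau0 taudl] [tau1 tauG]]] : exists tau, (0 < tau /\ tau < dl / 2) /\
    (tau < 1 / 2 /\ forall i : 'I_m.+1, F (c i) <= G (c i + tau) <= F (c i) + eta / 2).
  have H : \forall tau \near (0 : R)^'+, (0 < tau /\ tau < dl / 2) /\
    (tau < 1 / 2 /\ forall i : 'I_m.+1, F (c i) <= G (c i + tau) <= F (c i) + eta / 2).
    apply: filterI.
      by apply: filterI; [exact: nbhs_right_gt|apply: nbhs_right_lt; rewrite divr_gt0].
    apply: filterI; first by apply: nbhs_right_lt; rewrite divr_gt0.
    apply: (@filter_forall R 'I_m.+1
      (fun i => [set t | F (c i) <= G (c i + t) <= F (c i) + eta / 2]) (nbhs (0 : R)^'+)) => i.
    have eta20 : 0 < eta / 2 by rewrite divr_gt0.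
    have [y cy ye] := Fad (c i) _ eta20; near=> tau; apply/andP; split.
      by apply: FG; rewrite ltrDl.
    rewrite (le_trans _ (ltW ye))// G_nd// -lerBrDl.
    by near: tau; apply: nbhs_right_ltW; rewrite subr_gt0.
  exact: filter_ex H.
have NG : \forall n \near U, forall i : 'I_m.+1,
    `|G (c i + tau) - g n (c i + tau)| <= eta / 2.
  apply: (@filter_forall nat 'I_m.+1
    (fun i => [set n | `|G (c i + tau) - g n (c i + tau)| <= eta / 2]) U) => i.
  have /cvgrPdist_le := Gc (c i + tau).
  by apply; rewrite divr_gt0.
apply: filterS2 NG gM => n nG ngM.
have muE x : fine (mu `]-oo, x]%classic) = F x by rewrite muF.
have Bdl : B * dl0 = e1 by rewrite mulrC divfK ?gt_eqF.
have S1 : `|\int[mu]_x f x - \sum_(i < m) f (c i) * (F (c i.+1) - F (c i))| <= e1 + e1.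
  under eq_bigr do rewrite -!muE.
  have fv i x : (i < m)%N -> c i < x <= c i.+1 -> `|f x - f (c i)| <= e1.
    move=> im cx; apply: (vE 0) => //; first by rewrite divr_gt0.
    by rewrite !addr0.
  apply: le_trans (integral_step_approx mu cf (ltW e10) c_nd fB fv) _.
  rewrite lerD2l -Bdl ler_pM2l// !muE c0 F_neg ?add0r ?ltrN10// cm lerBlDr -lerBlDl.
  exact: le_trans GM (GF M).
have S2 : `|\int[mu_ n]_x f x -
    \sum_(i < m) f (c i) * (g n (c i.+1 + tau) - g n (c i + tau))| <= e1 + e1.
  have ct_nd i j : (i <= j)%N -> c i + tau <= c j + tau by move=> ij; rewrite lerD2r c_nd.
  have fv i x : (i < m)%N -> c i + tau < x <= c i.+1 + tau -> `|f x - f (c i)| <= e1.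
    by move=> im cx; apply: (vE tau) => //; exact: ltW.
  apply: le_trans (integral_step_approx (mu_ n) cf (ltW e10) ct_nd fB fv) _.
  rewrite lerD2l -Bdl ler_pM2l// -!/(g _ _) c0 g_neg ?add0r; last by lra.
  rewrite cm lerBlDr -lerBlDl (le_trans ngM)// g_nd// lerDl ltW//.
pose a i := F (c i) - g n (c i + tau).
have aE i : (i <= m)%N -> `|a i| <= eta.
  rewrite -ltnS => im; have := tauG (Ordinal im); have := nG (Ordinal im); rewrite /= /a.
  rewrite !ler_norml => /andP[h1 h2] /andP[h3 h4]; apply/andP; split; lra.
have S3 : `|\sum_(i < m) f (c i) * (F (c i.+1) - F (c i)) -
    \sum_(i < m) f (c i) * (g n (c i.+1 + tau) - g n (c i + tau))| <= e1.
  rewrite -sumrB (le_trans (ler_norm_sum _ _ _))//.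
  have -> : e1 = \sum_(i < m) (B * (eta + eta)).
    rewrite sumr_const card_ord -mulr_natl /eta; field; rewrite !gt_eqF//.
  apply: ler_sum => i _; rewrite -mulrBr normrM ler_pM//.
  have -> : F (c i.+1) - F (c i) - (g n (c i.+1 + tau) - g n (c i + tau)) = a i.+1 - a i.
    by rewrite /a; ring.
  by rewrite (le_trans (ler_normB _ _))// lerD// aE// ltnW.
have -> : e = e1 + e1 + e1 + (e1 + e1) by rewrite /e1; field.
move: S1 S2 S3; move: (\sum_(i < m) _) (\sum_(i < m) _) (\int[mu]_x _) (\int[mu_ n]_x _).
move=> s1 s2 i1 i2; rewrite !ler_norml => /andP[h1 h2] /andP[h3 h4] /andP[h5 h6].
apply/andP; split; lra.
Unshelve. all: by end_near.
Qed.

End helly.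

Section supported_nonneg.
Variables (R : realType) (mu : probability R R).

Lemma nonneg_supportP : mu `[0, +oo[%classic = 1%E <->
  forall x, x < 0 -> mu `]-oo, x]%classic = 0%E.
Proof.
have cE : ~` `[0, +oo[%classic = `]-oo, 0[%classic :> set R.
  apply/seteqP; split => x /=; rewrite !in_itv/= andbT ?ltNge; first by move/negP.
  by move=> x0; apply/negP.
split => [m1 x x0|h].
  apply/eqP; rewrite eq_le measure_ge0 andbT.
  have <- : mu `]-oo, 0[%classic = 0%E.
    by rewrite -cE probability_setC// m1 subee.
  apply: le_measure; rewrite ?inE//; apply: subset_itvl; rewrite bnd_simp //.
suff m0 : mu `]-oo, 0[%classic = 0%E.
  by rewrite -[X in mu X]setCK cE probability_setC// m0 sube0.
have mN : mu.-negligible `]-oo, (0 : R)[%classic.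
  apply: (@negligibleS _ _ _ mu (\bigcup_k `]-oo, - k.+1%:R^-1]%classic)).
    move=> x /=; rewrite in_itv/= => x0; exists (Num.bound (- x)^-1) => //=.
    rewrite in_itv/= lerNr -[X in _ <= X]invrK lef_pV2 ?posrE ?invr_gt0 ?oppr_gt0//.
    have := @archi_boundP R (- x)^-1; rewrite invr_ge0 oppr_ge0 (ltW x0) => /(_ isT)/ltW.
    by move=> /le_trans; apply; rewrite ler_nat.
  apply: negligible_bigcup => k; exists `]-oo, - k.+1%:R^-1]%classic; split => //.
  by apply: h; rewrite oppr_lt0 invr_gt0.
by apply/negligibleP.
Qed.

(** Composition with a map that is the identity on a set of full mass turns bounds on [D] into
    pointwise bounds on the whole line. *)
Lemma Rintegral_support (D : set R) (phi f : R -> R) : measurable D -> mu D = 1%E ->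
  measurable_fun setT phi -> (forall x, D x -> phi x = x) -> measurable_fun setT f ->
  \int[mu]_x f x = \int[mu]_x f (phi x).
Proof.
move=> mD D1 mphi phiD mf; congr fine; apply: ae_eq_integral => //.
- exact/measurable_EFinP.
- apply/measurable_EFinP; exact: (measurableT_comp mf mphi).
have m0 : mu (~` D) = 0%E by rewrite probability_setC// D1 subee.
exists (~` D); split => //; first exact: measurableC.
by move=> x /= h Dx; apply: h => _; rewrite phiD.
Qed.

Lemma Rintegral_nonneg_support (f : R -> R) : mu `[0, +oo[%classic = 1%E ->
  measurable_fun setT f -> \int[mu]_x f x = \int[mu]_x f (Num.max x 0).
Proof.
move=> mu1 mf.
have mm : measurable_fun setT (fun x : R => Num.max x 0) by exact: measurable_maxr.
apply: (@Rintegral_support `[0, +oo[%classic _ f _ mu1 mm _ mf) => //.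
by move=> x /=; rewrite in_itv/= andbT => x0; rewrite (max_idPl x0).
Qed.

End supported_nonneg.

Lemma dominated_Rintegral_cvg (R : realType) (mu : probability R R)
    (f_ : nat -> R -> R) (f : R -> R) :
  (forall n, measurable_fun setT (f_ n)) -> measurable_fun setT f ->
  (forall n x, `|f_ n x| <= 1) -> (forall x, f_ n x @[n --> \oo] --> f x) ->
  \int[mu]_x f_ n x @[n --> \oo] --> \int[mu]_x f x.
Proof.
move=> mf_ mf f1 ff.
have mF n : measurable_fun setT (EFin \o f_ n) by exact/measurable_EFinP.
have mFf : measurable_fun setT (EFin \o f) by exact/measurable_EFinP.
have fi : mu.-integrable setT (EFin \o f).
  apply: (@integrable_bounded _ _ _ _ _ 1) => // x.
  by apply: (cvgr_to_le (cvg_norm (ff x))); apply: nearW => n; exact: f1.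
have [_ _ h] : ([/\ mu.-integrable setT (EFin \o f),
  [sequence \int[mu]_x `|(EFin \o f_ n) x - (EFin \o f) x|]_n @ \oo --> 0 &
  [sequence \int[mu]_x ((EFin \o f_ n) x)]_n @ \oo --> \int[mu]_x ((EFin \o f) x)])%E.
  apply: (@dominated_convergence _ _ _ mu _ measurableT _ _ (cst 1%E)) => //.
  - by apply: aeW => x _; apply: cvg_EFin; [exact: nearW|exact: ff].
  - exact: integrable_EFin_cst.
  - by apply: aeW => x n _; rewrite /= lee_fin.
by apply: fine_cvg; rewrite EFin_Rintegral.
Qed.

(** * Measures on the half-line are determined by their Stieltjes transforms *)

Section stieltjes_inversion.
Variables (R : realType) (mu nu : probability R R).
Hypotheses (mu1 : mu `[0, +oo[%classic = 1%E) (nu1 : nu `[0, +oo[%classic = 1%E).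

(** The bounded test functions on which [mu] and [nu] agree. The class is stable under linear
    combinations and uniform limits; the resolvent identity brings in products of the kernels [r l],
    and polynomials in one kernel converge boundedly to the indicator of a half-line. *)
Let same (f : R -> R) := [/\ measurable_fun setT f,
  exists B : R, forall x, `|f x| <= B & \int[mu]_x f x = \int[nu]_x f x].

Let same_cst c : same (fun=> c).
Proof.
split => //; first by exists `|c|.
by rewrite !Rintegral_prob_cst.
Qed.

Let sameB f g : same f -> same g -> same (fun x => f x - g x).
Proof.
move=> [mf [B fB] ef] [mg [B' gB] eg]; split; first exact: measurable_funB.
  exists (B + B') => x; exact: le_trans (ler_normB _ _) (lerD (fB x) (gB x)).
by rewrite !RintegralB ?ef ?eg//; exact: integrable_bounded.
Qed.

Let sameZ c f : same f -> same (fun x => c * f x).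
Proof.
move=> [mf [B fB] ef]; split; first exact: measurable_funM.
  by exists (`|c| * B) => x; rewrite normrM ler_wpM2l.
by rewrite !RintegralZl ?ef//; exact: integrable_bounded fB.
Qed.

Let same_lim (f : R -> R) (B : R) : measurable_fun setT f -> (forall x, `|f x| <= B) ->
  (forall e, 0 < e -> exists2 g, same g & forall x, `|f x - g x| <= e) -> same f.
Proof.
move=> mf fB h; split => //; first by exists B.
apply/eqP; rewrite -subr_eq0 -normr_le0; apply/ler_addgt0Pl => e e0; rewrite addr0.
have e2 : 0 < e / 2 by rewrite divr_gt0.
have [g [mg [B' gB] eg] fg] := h _ e2.
have fi (P : probability R R) := @integrable_bounded _ _ _ P _ _ mf fB.
have gi (P : probability R R) := @integrable_bounded _ _ _ P _ _ mg gB.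
have h1 := Rintegral_dist_le (fi mu) (gi mu) fg.
have h2 := Rintegral_dist_le (fi nu) (gi nu) fg.
move: h1 h2; rewrite eg !ler_norml => /andP[h1 h2] /andP[h3 h4].
by apply/andP; split; lra.
Qed.

(** The Stieltjes kernel at the negative real point [- l], with [x] truncated at 0 so that it stays
    bounded off the support. *)
Let r (l x : R) : R := (Num.max x 0 + l)^-1.

Let r_bounds l x : 0 < l -> 0 < r l x <= l^-1.
Proof.
move=> l0; have m0 : 0 <= Num.max x 0 by rewrite le_max lexx orbT.
have h : 0 < Num.max x 0 + l by rewrite ltr_wpDl.
by rewrite invr_gt0 h lef_pV2 ?posrE// lerDr.
Qed.

Let mr l : 0 < l -> measurable_fun setT (r l).
Proof.
move=> l0; have -> : r l = (fun u => (`|u| + l)^-1) \o (fun x => Num.max x 0).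
  by apply/funext => x; rewrite /r /= ger0_norm// le_max lexx orbT.
apply: measurableT_comp; last exact: measurable_maxr.
apply: continuous_measurable_fun => u.
apply: cvgV; first by rewrite gt_eqF// ltr_wpDl.
by apply: cvgD; [apply: cvg_norm; exact: cvg_id|exact: cvg_cst].
Qed.

Hypothesis same_stieltjes : forall z, 0 < Im z -> stieltjes mu z = stieltjes nu z.

Let same_r l : 0 < l -> same (r l).
Proof.
move=> l0; apply: (@same_lim _ l^-1); first exact: mr.
  by move=> x; have /andP[h1 h2] := r_bounds x l0; rewrite gtr0_norm.
(* The point [- l] is approached from the upper half-plane; with [w = u + l >= l] the error
   [y^2 / (w (w^2 + y^2))] is at most [y^2 / l^3 = e]. *)
move=> e e0; pose y := Num.sqrt (e * l ^+ 3).
have el : 0 < e * l ^+ 3 by rewrite mulr_gt0// exprn_gt0.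
have y0 : 0 < y by rewrite sqrtr_gt0.
pose z : R[i] := (- l) +i* y.
have z0 : 0 < Im z by [].
have kz := ccontinuous_cmeasurable (ccontinuous_stieltjes_kernel z0).
exists (fun x => Re ((Num.max x 0)%:C - z)^-1).
  split.
  - apply: (measurableT_comp (f := fun x : R => Re (x%:C - z)^-1) (g := fun x : R => Num.max x 0)).
      exact: kz.1.
    exact: measurable_maxr.
  - exists (Im z)^-1 => x; exact: le_trans (Re_le_normc _) (normc_real_sub _ z0).
  - rewrite -!(@Rintegral_nonneg_support _ _ (fun x => Re (x%:C - z)^-1))//; [|exact: kz.1..].
    exact: (congr1 (@complex.Re R) (same_stieltjes z0)).
move=> x; set u := Num.max x 0.
have u0 : 0 <= u by rewrite le_max lexx orbT.
rewrite cRe_inv normc_sqr cReD cReN cImD cImN /= opprK add0r sqrrN /r -/u.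
set w := u + l; have lw : l <= w by rewrite lerDr.
have w0 : 0 < w by apply: lt_le_trans lw.
have wy : 0 < w ^+ 2 + y ^+ 2 by rewrite addr_gt0// exprn_gt0.
have -> : w^-1 - w / (w ^+ 2 + y ^+ 2) = y ^+ 2 / (w * (w ^+ 2 + y ^+ 2)).
  by field; rewrite !gt_eqF.
rewrite ger0_norm; last by rewrite divr_ge0 ?sqr_ge0// mulr_ge0// ltW.
rewrite ler_pdivrMr ?mulr_gt0// sqr_sqrtr ?(ltW el)// ler_pM2l// exprS.
rewrite ler_pM ?(ltW l0) ?exprn_ge0 ?(ltW l0)//.
have l2 : l ^+ 2 <= w ^+ 2 by rewrite lerXn2r ?nnegrE ?(ltW l0) ?(ltW w0).
by apply: le_trans l2 _; rewrite lerDl -exprS ltW.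
Qed.

(* r_l r_m = (r_l - r_m) / (m - l) when l and m differ; equal parameters are
   separated by a small perturbation. *)
Let same_prod (s : seq R) : all (fun l => 0 < l) s ->
  same (fun x => \prod_(l <- s) r l x).
Proof.
elim: {s}(size s) {-2}s (leqnn (size s)) => [|n IHn] [|l s]//=.
- by move=> _ _; under eq_fun do rewrite big_nil; exact: same_cst.
- by move=> _ _; under eq_fun do rewrite big_nil; exact: same_cst.
case: s => [|m s] sn /=.
  by move=> /andP[l0 _]; under eq_fun do rewrite big_seq1; exact: same_r.
move=> /and3P[l0 m0 s0].
have bnd s' : all (fun l => 0 < l) s' -> exists B, forall x, 0 <= \prod_(l <- s') r l x <= B.
  elim: s' => [_|k s' IHs' /= /andP[k0 /IHs'[B hB]]].
    by exists 1 => x; rewrite big_nil ler01 lexx.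
  exists (k^-1 * B) => x; rewrite big_cons; have /andP[h1 h2] := r_bounds x k0.
  have /andP[h3 h4] := hB x; apply/andP; split; first exact: mulr_ge0 (ltW h1) h3.
  exact: ler_pM (ltW h1) h3 h2 h4.
have neq l' m' : 0 < l' -> 0 < m' -> l' != m' ->
    same (fun x => \prod_(k <- [:: l', m' & s]) r k x).
  move=> l'0 m'0 lm.
  have -> : (fun x => \prod_(k <- [:: l', m' & s]) r k x) =
      (fun x => (m' - l')^-1 *
        (\prod_(k <- l' :: s) r k x - \prod_(k <- m' :: s) r k x)).
    apply/funext => x; rewrite !big_cons; move: (\prod_(_ <- s) _) => q.
    have /andP[+ _] := r_bounds x l'0; have /andP[+ _] := r_bounds x m'0.
    rewrite /r !invr_gt0 => h1 h2; field.
    by rewrite subr_eq0 (eq_sym m') lm !gt_eqF.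
  by apply: sameZ; apply: sameB; apply: IHn => //=; rewrite ?l'0 ?m'0.
have [lm|] := eqVneq l m; last exact: neq.
rewrite -lm.
have [B hB] := bnd _ s0.
have B0 : 0 <= B by have /andP[h1 h2] := hB 0; exact: le_trans h1 h2.
have mp s' : all (fun l => 0 < l) s' -> measurable_fun setT (fun x => \prod_(l <- s') r l x).
  elim: s' => [_|k s' IHs' /= /andP[k0 /IHs' ms']].
    under eq_fun do rewrite big_nil.
    exact: measurable_cst.
  under eq_fun do rewrite big_cons.
  by apply: measurable_funM => //; exact: mr.
have [B' hB'] : exists B', forall x, 0 <= \prod_(k <- [:: l, l & s]) r k x <= B'.
  by apply: bnd; rewrite /= l0.
apply: (@same_lim _ B').
- by apply: mp; rewrite /= l0.
- by move=> x; have /andP[h1 h2] := hB' x; rewrite ger0_norm.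
(* With [q] the product of the other factors, the perturbation changes the product by
   [h * r l x ^+ 2 * r (l + h) x * q], which is at most [h * l^-3 * B]. *)
move=> e e0; pose h := e * l ^+ 3 / (B + 1).
have l3 : 0 < l ^+ 3 by exact: exprn_gt0.
have B1 : 0 < B + 1 by rewrite ltr_wpDl.
have h0 : 0 < h by rewrite divr_gt0// mulr_gt0.
have lh : 0 < l + h by rewrite addr_gt0.
exists (fun x => \prod_(k <- [:: l, l + h & s]) r k x).
  by apply: neq => //; rewrite -subr_eq0 opprD addNKr oppr_eq0 gt_eqF.
move=> x; rewrite !big_cons; have := hB x; move: (\prod_(_ <- s) _) => q /andP[q0 qB].
have /andP[a0 al] := r_bounds x l0; have /andP[b0 bl] := r_bounds x lh.
have e1 : r l x - r (l + h) x = h * (r l x * r (l + h) x).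
  move: a0 b0; rewrite /r !invr_gt0 => a0 b0; field.
  by rewrite !gt_eqF// addrA.
have bl' : r (l + h) x <= l^-1.
  by apply: le_trans bl _; rewrite lef_pV2 ?posrE// lerDl ltW.
move: (r l x) (r (l + h) x) a0 al b0 bl bl' e1 => a c a0 al c0 _ cl e1.
have -> : a * (a * q) - a * (c * q) = h * (a * (a * c) * q).
  by rewrite -mulrA -mulrBr -mulrBl e1; ring.
have p0 : 0 <= a * (a * c) * q by rewrite !mulr_ge0 ?(ltW a0) ?(ltW c0).
rewrite ger0_norm; last exact: mulr_ge0 (ltW h0) p0.
have -> : e = h * (l^-1 * (l^-1 * l^-1) * (B + 1)).
  by rewrite /h; field; rewrite !gt_eqF.
rewrite ler_pM2l// ler_pM ?mulr_ge0 ?(ltW a0) ?(ltW c0)//.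
  by rewrite ler_pM ?mulr_ge0 ?(ltW a0) ?(ltW c0)// ler_pM ?(ltW a0) ?(ltW c0).
by rewrite (le_trans qB)// lerDl.
Qed.

Let same_binomial l n N j : 0 < l ->
  same (fun x => r l x ^+ j * (1 - r l x ^+ n) ^+ N).
Proof.
move=> l0; elim: N j => [|N IHN] j.
  under eq_fun do rewrite expr0 mulr1.
  have -> : (fun x => r l x ^+ j) = (fun x => \prod_(k <- nseq j l) r k x).
    by apply/funext => x; rewrite big_nseq -/(iter _ _ _) iter_mulr_1.
  by apply: same_prod; rewrite all_nseq l0 orbT.
have -> : (fun x => r l x ^+ j * (1 - r l x ^+ n) ^+ N.+1) =
    (fun x => r l x ^+ j * (1 - r l x ^+ n) ^+ N -
              r l x ^+ (j + n) * (1 - r l x ^+ n) ^+ N).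
  by apply/funext => x; rewrite exprS exprD; ring.
exact: sameB.
Qed.

Let bernoulli_ge (u : R) N : 0 <= u -> 1 + N%:R * u <= (1 + u) ^+ N.
Proof.
move=> u0; elim: N => [|N IHN]; first by rewrite mul0r addr0.
have u1 : 0 <= 1 + u by rewrite addr_ge0.
rewrite exprS; apply: le_trans (ler_wpM2l u1 IHN).
have -> : (1 + u) * (1 + N%:R * u) = 1 + N.+1%:R * u + N%:R * u ^+ 2.
  by rewrite -natr1; ring.
by rewrite lerDl mulr_ge0// sqr_ge0.
Qed.

Let bernoulli_le (u : R) N : 0 <= u <= 1 -> 1 - N%:R * u <= (1 - u) ^+ N.
Proof.
move=> /andP[u0 u1]; elim: N => [|N IHN]; first by rewrite mul0r subr0.
have v0 : 0 <= 1 - u by rewrite subr_ge0.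
rewrite exprS; apply: le_trans (ler_wpM2l v0 IHN).
have -> : (1 - u) * (1 - N%:R * u) = 1 - N.+1%:R * u + N%:R * u ^+ 2.
  by rewrite -natr1; ring.
by rewrite lerDl mulr_ge0// sqr_ge0.
Qed.

(** With [c = s^2], Bernoulli's inequality bounds [n * s ^+ n], and one factor [s ^+ n] is left to
    tend to 0. *)
Let cvg_mul_expr (c : R) : 0 < c < 1 -> n%:R * c ^+ n @[n --> \oo] --> (0 : R).
Proof.
move=> /andP[c0 c1]; pose s := Num.sqrt c.
have s0 : 0 < s by rewrite sqrtr_gt0.
have cs : c = s ^+ 2 by rewrite sqr_sqrtr// ltW.
have s1 : s < 1 by rewrite -(ltr_pXn2r (n := 2)) ?nnegrE ?(ltW s0)// -cs expr1n.
have si : 0 < s^-1 - 1 by rewrite subr_gt0 invf_gt1.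
apply: (@squeeze_cvgr _ _ _ _ (cst 0) (fun n => (s^-1 - 1)^-1 * s ^+ n)).
- apply: nearW => n; have sn : 0 < s ^+ n by exact: exprn_gt0.
  apply/andP; split; first by rewrite mulr_ge0// exprn_ge0// ltW.
  rewrite cs -exprM mulnC exprM expr2 mulrA ler_pM2r// -ler_pdivlMr// ler_pdivlMl//.
  have := @bernoulli_ge (s^-1 - 1) n (ltW si); rewrite addrC -(addrC 1) subrKC exprVn.
  by apply: le_trans; rewrite mulrC lerDr.
- exact: cvg_cst.
rewrite -[X in _ --> X](mulr0 (s^-1 - 1)^-1); apply: cvgM; first exact: cvg_cst.
by apply: cvg_expr; rewrite ger0_norm// ltW.
Qed.

(** Bernoulli's inequality bounds the power below by [1 - n * (k q)^n]. The exponent [n * k ^ n] is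
    the device of the elementary proof of the Stone-Weierstrass theorem: it places a sharp threshold
    at [q = 1 / k]. *)
Let cvg_binomial_lt1 (k : nat) (q : R) : (0 < k)%N -> 0 < q -> k%:R * q < 1 ->
  (1 - q ^+ n) ^+ (n * k ^ n) @[n --> \oo] --> (1 : R).
Proof.
move=> k0 q0 kq; have k1 : 1 <= k%:R :> R by rewrite ler1n.
have q1 : q <= 1.
  by rewrite (le_trans _ (ltW kq))// -[leLHS]mul1r ler_wpM2r// ltW.
have qn n : 0 <= q ^+ n <= 1 by rewrite exprn_ge0 ?exprn_ile1 ?(ltW q0).
apply: (@squeeze_cvgr _ _ _ _ (fun n => 1 - n%:R * (k%:R * q) ^+ n) (cst 1)).
- apply: nearW => n; have /andP[h1 h2] := qn n; apply/andP; split.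
    have := @bernoulli_le _ (n * k ^ n) (qn n).
    by rewrite natrM natrX exprMn mulrA.
  by rewrite exprn_ile1 ?subr_ge0// lerBlDr lerDl.
- rewrite -[X in _ --> X](subr0 1); apply: cvgB; first exact: cvg_cst.
  by apply: cvg_mul_expr; rewrite kq mulr_gt0// (lt_le_trans _ k1).
- exact: cvg_cst.
Qed.

(** Here [(1 - u)^N <= (1 + u)^-N <= (1 + N u)^-1] with [u = q^n] and [N u >= n]. The factor [n] in
    the exponent is what makes the boundary case [k q = 1] tend to 0 as well. *)
Let cvg_binomial_ge1 (k : nat) (q : R) : 0 < q <= 1 -> 1 <= k%:R * q ->
  (1 - q ^+ n) ^+ (n * k ^ n) @[n --> \oo] --> (0 : R).
Proof.
move=> /andP[q0 q1] kq.
apply: (@squeeze_cvgr _ _ _ _ (cst 0) (@harmonic R)); [|exact: cvg_cst|exact: cvg_harmonic].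
apply: nearW => n; have q0n : 0 <= q ^+ n by rewrite exprn_ge0// ltW.
have q1n : q ^+ n <= 1 by rewrite exprn_ile1// ltW.
have q1n0 : 0 <= 1 - q ^+ n by rewrite subr_ge0.
rewrite exprn_ge0//= /harmonic/=.
set N := (n * k ^ n)%N; set u := q ^+ n.
have u1 : 0 < (1 + u) ^+ N by rewrite exprn_gt0// ltr_wpDr.
have h1 : (1 - u) ^+ N * (1 + u) ^+ N <= 1.
  have e : (1 - u) * (1 + u) = 1 - u ^+ 2 by ring.
  have e2 : 1 - u ^+ 2 <= 1 by rewrite lerBlDr lerDl sqr_ge0.
  have e3 : 0 <= 1 - u ^+ 2 by rewrite -e mulr_ge0// addr_ge0.
  by rewrite -exprMn e; exact: exprn_ile1.
have h2 : n.+1%:R <= (1 + u) ^+ N.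
  apply: le_trans (bernoulli_ge _ q0n); rewrite -natr1 addrC lerD2l.
  rewrite /N natrM natrX -mulrA -exprMn ler_peMr// exprn_ege1//.
have n1 : 0 < n.+1%:R :> R by rewrite ltr0n.
rewrite -(ler_pM2r n1) mulVf ?gt_eqF//; apply: le_trans h1.
by rewrite ler_wpM2l// exprn_ge0.
Qed.

Let same_itvy a : 0 <= a -> mu `]a, +oo[%classic = nu `]a, +oo[%classic.
Proof.
(* With [l = k - a], the threshold [k * r l x < 1] means that [x] exceeds [a]; and [k >= a + 1]
   gives [l >= 1], so that [r l] takes values at most 1. *)
move=> a0; pose k := (Num.bound a).+1; pose l := k%:R - a.
have ak : a + 1 <= k%:R.
  by rewrite /k -[k in _ <= k%:R]addn1 natrD lerD2r ltW// archi_boundP.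
have l1 : 1 <= l by rewrite lerBrDl.
have l0 : 0 < l by apply: lt_le_trans l1.
have k0 : 0 < k%:R :> R by rewrite ltr0n.
pose f n x := (1 - r l x ^+ n) ^+ (n * k ^ n).
have rl x : 0 < r l x <= 1.
  have /andP[-> h] := r_bounds x l0; apply: le_trans h _.
  by rewrite invf_le1.
have sf n : same (f n).
  have := @same_binomial l n (n * k ^ n) 0 l0.
  by under eq_fun do rewrite expr0 mul1r.
pose g (x : R) : R := \1_`]a, +oo[ x.
have mg : measurable_fun setT g by exact: measurable_indic.
have fg x : f n x @[n --> \oo] --> g x.
  have xl : 0 < Num.max x 0 + l by rewrite ltr_wpDl// le_max lexx orbT.
  rewrite /g indicE; have [ax|xa] := ltP a x.
    rewrite mem_set/= ?in_itv/= ?ax//; apply: cvg_binomial_lt1 => //.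
      by have /andP[] := rl x.
    rewrite /r ltr_pdivrMr// mul1r -ltrBlDr /l opprB addrC subrK.
    by rewrite lt_max ax.
  rewrite memNset/= ?in_itv/= ?andbT; last by apply/negP; rewrite -leNgt.
  apply: cvg_binomial_ge1 => //.
  rewrite /r ler_pdivlMr// mul1r -lerBrDr /l opprB addrC subrK.
  by rewrite ge_max xa a0.
have f1 n x : `|f n x| <= 1.
  have /andP[h1 h2] := rl x; have h3 : 0 <= 1 - r l x ^+ n.
    by rewrite subr_ge0 exprn_ile1// ltW.
  by rewrite ger0_norm ?exprn_ge0// exprn_ile1// lerBlDr lerDl exprn_ge0// ltW.
have cvgP (P : probability R R) : \int[P]_x f n x @[n --> \oo] --> \int[P]_x g x.
  by apply: dominated_Rintegral_cvg => // n; case: (sf n).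
have gE (P : probability R R) : \int[P]_x g x = fine (P `]a, +oo[%classic).
  by rewrite /g /Rintegral integral_indic// setIT.
have E : \int[mu]_x g x = \int[nu]_x g x.
  have h := cvgP mu; have h' := cvgP nu.
  have e n : \int[mu]_x f n x = \int[nu]_x f n x by case: (sf n).
  rewrite (_ : (fun n => \int[mu]_x f n x) = (fun n => \int[nu]_x f n x)) in h; last exact/funext.
  exact: (cvg_unique _ h h').
by rewrite -[LHS]fineK ?fin_num_measure// -[RHS]fineK ?fin_num_measure// -!gE E.
Qed.

Lemma stieltjes_inj A : measurable A -> mu A = nu A.
Proof.
apply: probability_eq_itvNy => x; have [x0|x0] := ltP x 0.
  by rewrite (nonneg_supportP mu).1// (nonneg_supportP nu).1.
have cE : ~` `]x, +oo[%classic = `]-oo, x]%classic :> set R.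
  apply/seteqP; split => y /=; rewrite !in_itv/= andbT ?leNgt; first by move/negP.
  by move=> y0; apply/negP.
by rewrite -cE !probability_setC// same_itvy.
Qed.

End stieltjes_inversion.

Section stieltjes_estimates.
Variables (R : realType).
Implicit Types (mu H : probability R R) (z m : R[i]).

Lemma normc_cintegral_le_cst mu (f : R -> R[i]) b : cmeasurable f ->
  (forall x, normc (f x) <= b) -> normc (cintegral mu f) <= b.
Proof.
move=> mf fb; apply: le_trans (normc_cintegral_le mu mf fb) _.
have nb x : 0 <= normc (f x) <= b by rewrite normc_ge0 fb.
by have /andP[] := Rintegral_bounds mu (measurable_normc mf) nb.
Qed.

Lemma cintegral_dist_le mu (f g : R -> R[i]) b e : cmeasurable f -> cmeasurable g ->
  (forall x, normc (f x) <= b) -> (forall x, normc (g x) <= b) ->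
  (forall x, normc (f x - g x) <= e) ->
  normc (cintegral mu f - cintegral mu g) <= e.
Proof.
move=> mf mg fb gb fg; rewrite -(cintegralB mu mf mg fb gb).
by apply: normc_cintegral_le_cst => //; exact: cmeasurableD mf (cmeasurableN mg).
Qed.

Lemma normc_stieltjes_le mu z : 0 < Im z -> normc (stieltjes mu z) <= (Im z)^-1.
Proof.
move=> z0; apply: normc_cintegral_le_cst => [|x]; last exact: normc_real_sub.
exact/ccontinuous_cmeasurable/ccontinuous_stieltjes_kernel.
Qed.

Lemma stieltjes_dist_le mu z z' : 0 < Im z -> 0 < Im z' ->
  normc (stieltjes mu z - stieltjes mu z') <= normc (z - z') / (Im z * Im z').
Proof.
move=> z0 z'0; have mk (w : R[i]) : 0 < Im w -> cmeasurable (fun x : R => (x%:C - w)^-1).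
  by move=> w0; exact/ccontinuous_cmeasurable/ccontinuous_stieltjes_kernel.
apply: (@cintegral_dist_le _ _ _ ((Im z)^-1 + (Im z')^-1)).
- exact: mk.
- exact: mk.
- by move=> x; rewrite (le_trans (normc_real_sub x z0))// lerDl invr_ge0 ltW.
- by move=> x; rewrite (le_trans (normc_real_sub x z'0))// lerDr invr_ge0 ltW.
move=> x; have n1 := real_sub_neq0 x z0; have n2 := real_sub_neq0 x z'0.
have -> : (x%:C - z)^-1 - (x%:C - z')^-1 = (z - z') * ((x%:C - z)^-1 * (x%:C - z')^-1).
  by field; rewrite n1 n2.
rewrite !normcM ler_wpM2l ?normc_ge0// invfM ler_pM ?normc_ge0//; exact: normc_real_sub.
Qed.

Definition MP_integral H m : R[i] := cintegral H (fun t => t%:C / (1 + t%:C * m)).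

Lemma normc_MP_integral_le H m : 0 < Im m -> normc (MP_integral H m) <= (Im m)^-1.
Proof.
move=> m0; apply: normc_cintegral_le_cst => [|x]; last exact: normc_MP_kernel.
exact/ccontinuous_cmeasurable/ccontinuous_MP_kernel.
Qed.

Lemma MP_integral_dist_le H m m' : 0 < Im m -> 0 < Im m' ->
  normc (MP_integral H m - MP_integral H m') <= normc (m - m') / (Im m * Im m').
Proof.
move=> z0 z'0; have mk (w : R[i]) : 0 < Im w -> cmeasurable (fun t : R => t%:C / (1 + t%:C * w)).
  by move=> w0; exact/ccontinuous_cmeasurable/ccontinuous_MP_kernel.
apply: (@cintegral_dist_le _ _ _ ((Im m)^-1 + (Im m')^-1)).
- exact: mk.
- exact: mk.
- by move=> x; rewrite (le_trans (normc_MP_kernel x z0))// lerDl invr_ge0 ltW.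
- by move=> x; rewrite (le_trans (normc_MP_kernel x z'0))// lerDr invr_ge0 ltW.
move=> x; have n1 := neq0_1Dreal x z0; have n2 := neq0_1Dreal x z'0.
have -> : x%:C / (1 + x%:C * m) - x%:C / (1 + x%:C * m') =
    (m' - m) * ((x%:C / (1 + x%:C * m)) * (x%:C / (1 + x%:C * m'))).
  by field; rewrite n1 n2.
rewrite !(normcM (m' - m)) (normcM (x%:C / (1 + x%:C * m))) normcB.
by rewrite ler_wpM2l ?normc_ge0// invfM ler_pM ?normc_ge0//; exact: normc_MP_kernel.
Qed.

Lemma Im_stieltjes_gt0 mu z : 0 < Im z -> 0 < Im (stieltjes mu z).
Proof.
move=> z0; pose f x := Im (x%:C - z)^-1.
have f0 x : 0 < f x.
  rewrite /f cIm_inv divr_gt0 ?exprn_gt0 ?normc_gt0 ?real_sub_neq0//.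
  by rewrite cImD cImN /= add0r opprK.
have mf : measurable_fun setT f.
  exact: (ccontinuous_cmeasurable (ccontinuous_stieltjes_kernel z0)).2.
rewrite /stieltjes /cintegral /= -/f lt_neqAle eq_sym; apply/andP; split; last first.
  by apply: Rintegral_ge0 => x _; exact: (ltW (f0 x)).
apply/eqP => I0.
have fi : mu.-integrable setT (EFin \o f).
  apply: (@integrable_bounded _ _ _ _ _ (Im z)^-1) => // x.
  exact: le_trans (Im_le_normc _) (normc_real_sub x z0).
have : (\int[mu]_x `|(EFin \o f) x| = 0)%E.
  under eq_integral => x _ do rewrite /= gtr0_norm//.
  by rewrite -EFin_Rintegral// I0.
move/(ae_eq_integral_abs mu measurableT (measurable_int _ fi)) => ae0.
have : mu.-negligible setT.
  apply: negligibleS ae0 => x _ /= h; have := h I.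
  by move=> -[] /eqP; rewrite gt_eqF.
move=> hN; have h : mu setT = 0%E by apply/negligibleP.
have := probability_setT mu.
by rewrite h => /eqP; rewrite eq_sym onee_eq0.
Qed.

End stieltjes_estimates.

(** * Approximate solutions and their limits *)

Section MP_limits.
Variables (R : realType) (F : set_system nat).
Hypothesis FF : ProperFilter F.

(** The limiting defect is a constant dominated by errors that tend to 0. The filter and the points
    [z_] are general because there are two uses: at fixed [z] along an ultrafilter, and along
    rational points that approach an arbitrary [z]. *)
Lemma MP_equation_limit (z_ m_ : nat -> R[i]) (c_ : nat -> R)
    (H_ : nat -> probability R R) (z w : R[i]) (gamma b : R) (H : probability R R) :
  0 < Im w -> (forall n, 0 < Im (m_ n)) -> (forall n, normc (m_ n) <= b) ->
  normc (z_ n - z) @[n --> F] --> (0 : R) ->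
  normc (m_ n - w) @[n --> F] --> (0 : R) ->
  c_ n @[n --> F] --> gamma ->
  normc (MP_integral (H_ n) w - MP_integral H w) @[n --> F] --> (0 : R) ->
  normc (1 + z_ n * m_ n - (c_ n)%:C * (m_ n * MP_integral (H_ n) (m_ n)))
    @[n --> F] --> (0 : R) ->
  MP_equation gamma H z w.
Proof.
move=> w0 m0 mb zc mc cc Hc Ec; set J := MP_integral H w.
pose X := 1 + z * w - gamma%:C * (w * J).
suff X0 : X = 0.
  have wn := Im_gt0_neq0 w0; rewrite /MP_equation -/(MP_integral H w) -/J.
  apply: (mulIf wn); rewrite mulrDl mulVf//.
  move/eqP: X0; rewrite subr_eq0 => /eqP; rewrite addrC => ->; ring.
have b0 : 0 <= b by apply: le_trans (normc_ge0 _) (mb 0%N).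
have Imc : Im (m_ n) @[n --> F] --> Im w.
  apply/cvgrPdist_le => e e0; have /cvgrPdist_le/(_ _ e0) := mc.
  apply: filterS => n; rewrite sub0r normrN ger0_norm ?normc_ge0//.
  by apply: le_trans; rewrite distrC -cImN -cImD; exact: Im_le_normc.
pose B n := normc (1 + z_ n * m_ n - (c_ n)%:C * (m_ n * MP_integral (H_ n) (m_ n))) +
  normc z * normc (m_ n - w) + normc (z_ n - z) * b + `|gamma - c_ n| * normc (w * J) +
  `|c_ n| * (normc w * normc (MP_integral (H_ n) w - J) +
     normc (m_ n - w) * (Im w)^-1 + b * (normc (m_ n - w) * (Im w * Im (m_ n))^-1)).
have XB n : normc X <= B n.
  set E := 1 + z_ n * m_ n - (c_ n)%:C * (m_ n * MP_integral (H_ n) (m_ n)).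
  have -> : X = E + z * (w - m_ n) + (z - z_ n) * m_ n - (gamma - c_ n)%:C * (w * J) -
     (c_ n)%:C * (w * (J - MP_integral (H_ n) w) + (w - m_ n) * MP_integral (H_ n) w +
       m_ n * (MP_integral (H_ n) w - MP_integral (H_ n) (m_ n))).
    by rewrite /X /E rmorphB/=; ring.
  rewrite /B -/E.
  have nB (u v : R[i]) : normc (u - v) <= normc u + normc v.
    by rewrite -(normcN v) le_normcD.
  apply: le_trans (nB _ _) _; apply: lerD.
    apply: le_trans (nB _ _) _; apply: lerD; last by rewrite normcM normc_real.
    apply: le_trans (le_normcD _ _) _; apply: lerD; last first.
      by rewrite normcM normcB ler_wpM2l ?normc_ge0.
    by apply: le_trans (le_normcD _ _) _; rewrite lerD2l normcM normcB.
  rewrite normcM normc_real ler_wpM2l//.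
  apply: le_trans (le_normcD _ _) _; apply: lerD.
    apply: le_trans (le_normcD _ _) _; apply: lerD; first by rewrite normcM normcB.
    by rewrite normcM normcB ler_wpM2l ?normc_ge0// normc_MP_integral_le.
  rewrite normcM ler_pM ?normc_ge0// normcB (normcB (m_ n)).
  rewrite normcB; exact: MP_integral_dist_le.
have B0 : B n @[n --> F] --> (0 : R).
  rewrite (_ : 0 = 0 + normc z * 0 + 0 * b + `|gamma - gamma| * normc (w * J) +
    `|gamma| * (normc w * 0 + 0 * (Im w)^-1 + b * (0 * (Im w * Im w)^-1))); last first.
    by rewrite subrr normr0; ring.
  have cvn : `|c_ n| @[n --> F] --> `|gamma| by exact: cvg_norm.
  have cvd : `|gamma - c_ n| @[n --> F] --> `|gamma - gamma|.
    by apply: cvg_norm; apply: cvgB => //; exact: cvg_cst.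
  have cst (k : R) : k @[n --> F] --> k by exact: cvg_cst.
  have iv : (Im w * Im (m_ n))^-1 @[n --> F] --> (Im w * Im w)^-1.
    by apply: cvgV; [rewrite mulf_neq0 ?gt_eqF|exact: cvgM].
  apply: cvgD; last first.
    apply: cvgM => //; apply: cvgD; last by apply: cvgM => //; exact: cvgM.
    by apply: cvgD; exact: cvgM.
  apply: cvgD; last exact: cvgM.
  apply: cvgD; last exact: cvgM.
  by apply: cvgD => //; exact: cvgM.
apply: eq0_normc; apply/eqP; rewrite eq_le normc_ge0 andbT.
by apply: (cvgr_to_ge B0); apply: nearW.
Qed.

End MP_limits.

Lemma cintegral_cvg (R : realType) (F : set_system nat) (mu_ : nat -> probability R R)
    (mu : probability R R) (k : R -> R[i]) (b : R) : Filter F -> ccontinuous k ->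
  (forall x, normc (k x) <= b) ->
  (forall f : R -> R, continuous f -> bounded_fun f ->
    \int[mu_ n]_x f x @[n --> F] --> \int[mu]_x f x) ->
  normc (cintegral (mu_ n) k - cintegral mu k) @[n --> F] --> (0 : R).
Proof.
move=> FF [k1 k2] kb h.
have bd (f : R -> R) : (forall x, `|f x| <= b) -> bounded_fun f.
  move=> fb; exists b; split; first exact: num_real.
  by move=> x /ltW xb t _; exact: le_trans (fb t) xb.
have cR := h _ k1 (bd _ (fun x => le_trans (Re_le_normc _) (kb x))).
have cI := h _ k2 (bd _ (fun x => le_trans (Im_le_normc _) (kb x))).
apply: (@squeeze_cvgr _ _ _ _ (cst 0)
  (fun n => `|\int[mu_ n]_x Re (k x) - \int[mu]_x Re (k x)| +
            `|\int[mu_ n]_x Im (k x) - \int[mu]_x Im (k x)|)).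
- by apply: nearW => n; rewrite normc_ge0; exact: normc_le.
- exact: cvg_cst.
rewrite -[X in _ --> X](addr0 0); apply: cvgD.
  by rewrite -(normr0 R) -(subrr (\int[mu]_x Re (k x))); apply: cvg_norm; apply: cvgB => //; exact: cvg_cst.
by rewrite -(normr0 R) -(subrr (\int[mu]_x Im (k x))); apply: cvg_norm; apply: cvgB => //; exact: cvg_cst.
Qed.

Section MP_convergence.
Variables (R : realType) (gamma C : R) (H : probability R R).
Variables (mu_ H_ : nat -> probability R R) (c_ : nat -> R).
Hypothesis gamma_gt0 : 0 < gamma.
Hypothesis mu_pos : forall n, mu_ n `[0, +oo[%classic = 1%E.
Hypothesis c_cvg : c_ n @[n --> \oo] --> gamma.
Hypothesis H_cvg : forall f : R -> R, continuous f -> bounded_fun f ->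
  \int[H_ n]_x f x @[n --> \oo] --> \int[H]_x f x.
Hypothesis C0 : 0 <= C.
Hypothesis H_supp : forall n, H_ n `[0, C]%classic = 1%E.
Hypothesis defect_cvg : forall q r : rat, 0 < ratr r :> R ->
  let z : R[i] := ratr q +i* ratr r in
  normc (1 + z * stieltjes (mu_ n) z -
    (c_ n)%:C * (stieltjes (mu_ n) z * MP_integral (H_ n) (stieltjes (mu_ n) z)))
    @[n --> \oo] --> (0 : R).

(** On the support [t] is nonnegative, so the denominator has real part at least 1. Unlike
    [(Im w)^-1], the bound [C] does not degenerate as [w] tends to 0, which tightness requires. *)
Lemma normc_MP_integral_supp n w : 0 <= Re w -> 0 < Im w ->
  normc (MP_integral (H_ n) w) <= C.
Proof.
move=> Rw Iw; pose k (t : R) := t%:C / (1 + t%:C * w).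
pose phi t : R := Num.min (Num.max t 0) C.
have mphi : measurable_fun setT phi.
  by apply: measurable_minr => //; exact: measurable_maxr.
have phiE t : `[0, C]%classic t -> phi t = t.
  by rewrite /= in_itv/= /phi => /andP[t0 tC]; rewrite (max_idPl t0) (min_idPl tC).
have mk : cmeasurable k by exact/ccontinuous_cmeasurable/ccontinuous_MP_kernel.
have -> : MP_integral (H_ n) w = cintegral (H_ n) (fun t => k (phi t)).
  apply: complex_eq => /=.
    exact: (Rintegral_support (f := fun t => Re (k t)) _ (H_supp n) mphi phiE mk.1).
  exact: (Rintegral_support (f := fun t => Im (k t)) _ (H_supp n) mphi phiE mk.2).
apply: normc_cintegral_le_cst => [|t].
  split; [exact: (measurableT_comp mk.1 mphi)|exact: (measurableT_comp mk.2 mphi)].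
have p0 : 0 <= phi t by rewrite le_min C0 le_max lexx orbT.
have pC : phi t <= C by rewrite ge_min lexx orbT.
have n1 : 1 <= normc (1 + (phi t)%:C * w).
  apply: le_trans (Re_le_normc _); rewrite cReD cReMr /= ger0_norm.
    by rewrite lerDl mulr_ge0.
  by rewrite addr_ge0// mulr_ge0.
rewrite /k normcM normcV normc_real ger0_norm// ler_pdivrMr ?(lt_le_trans _ n1)//.
by rewrite (le_trans pC)// ler_peMr.
Qed.

(** At [z = i y] the real part of [1 + z * m] is the integral of [x^2 / (x^2 + y^2)], at least half
    the mass beyond [y]. The approximate equation makes it close to [c * m * J] with [|m| <= 1 / y]
    and [|J| <= C], which is small for [y] large. *)
Lemma MP_tight (e : R) : 0 < e ->
  exists M, \forall n \near \oo, 1 - e <= fine (mu_ n `]-oo, M]%classic).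
Proof.
(* [y] is an integer so that [i y] is one of the rational points of [defect_cvg]; its size gives
   [(|gamma| + 1) * C / y <= e / 4], where [|gamma| + 1] eventually bounds [c_ n]. *)
move=> e0; pose K := (Num.bound (4 * (`|gamma| + 1) * C / e)).+1; pose y : R := K%:R.
have y0 : 0 < y by rewrite ltr0n.
pose z : R[i] := 0 +i* y; have z0 : 0 < Im z by [].
have zE : ratr (0 : rat) +i* ratr K%:R = z by rewrite rmorph0 ratr_nat.
have r0 : 0 < ratr (K%:R : rat) :> R by rewrite ratr_nat.
have Cy : (`|gamma| + 1) * (C / y) <= e / 4.
  have q0 : 0 <= 4 * (`|gamma| + 1) * C / e.
    by rewrite divr_ge0 ?(ltW e0)// mulr_ge0// mulr_ge0// addr_ge0.
  have : 4 * (`|gamma| + 1) * C / e <= y.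
    by apply: le_trans (ltW (archi_boundP q0)) _; rewrite ler_nat.
  rewrite ler_pdivrMr// mulrA ler_pdivrMr// => h.
  lra.
have e4 : 0 < e / 4 by rewrite divr_gt0.
have c1 : \forall n \near \oo, `|c_ n| <= `|gamma| + 1.
  have /cvgrPdist_le/(_ 1 ltr01) := c_cvg; apply: filterS => n h.
  by rewrite -lerBlDl (le_trans (lerB_dist _ _))// distrC.
have := @defect_cvg 0 K%:R r0; cbv zeta; rewrite zE => /cvgrPdist_le/(_ _ e4) dc.
exists y; apply: filterS2 c1 dc => n c1; set w := stieltjes (mu_ n) z.
rewrite sub0r normrN (ger0_norm (normc_ge0 _)) => dn.
have kz := ccontinuous_cmeasurable (ccontinuous_stieltjes_kernel z0).
have Iw : 0 < Im w by exact: Im_stieltjes_gt0.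
have Rw : 0 <= Re w.
  rewrite /w /= (Rintegral_nonneg_support (f := fun x => Re (x%:C - z)^-1) (mu_pos n))//; last exact: kz.1.
  apply: Rintegral_ge0 => x _; rewrite cRe_inv divr_ge0 ?sqr_ge0//.
  by rewrite cReD cReN /= subr0 le_max lexx orbT.
have wy : normc w <= y^-1 by exact: (normc_stieltjes_le (mu_ n) z0).
have Jn : normc ((c_ n)%:C * (w * MP_integral (H_ n) w)) <= e / 4.
  apply: le_trans Cy; rewrite normcM normc_real ler_pM ?normc_ge0// normcM mulrC.
  by rewrite ler_pM ?normc_ge0// normc_MP_integral_supp.
have R1 : 1 - y * Im w <= e / 2.
  have -> : 1 - y * Im w = Re (1 + z * w) by rewrite /z; case: (w) => a b /=; ring.
  apply: le_trans (ler_norm _) (le_trans (Re_le_normc _) _).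
  rewrite -(subrK ((c_ n)%:C * (w * MP_integral (H_ n) w)) (1 + z * w)).
  apply: le_trans (le_normcD _ _) _.
  have -> : e / 2 = e / 4 + e / 4 by field.
  exact: lerD.
(* It dominates [y^2 / (x^2 + y^2)], which is at most 1, and at most [1 / 2] beyond [y]. *)
pose g (x : R) : R := 2^-1 + 2^-1 * \1_`]-oo, y] x.
have mi : measurable_fun setT (\1_`]-oo, y] : R -> R) by exact: measurable_indic.
have ii : (mu_ n).-integrable setT (EFin \o (\1_`]-oo, y] : R -> R)).
  apply: (@integrable_bounded _ _ _ _ _ 1) => // x.
  by rewrite indicE ger0_norm ?ler0n// lern1 leq_b1.
have Ig : \int[mu_ n]_x g x = 2^-1 + 2^-1 * fine (mu_ n `]-oo, y]%classic).
  rewrite RintegralD//; [|exact: integrable_EFin_cst|exact: integrable_EFinZ].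
  by rewrite Rintegral_prob_cst RintegralZl// [in LHS]/Rintegral integral_indic// setIT.
have : y * Im w <= \int[mu_ n]_x g x.
  rewrite /w /= -RintegralZl//; last first.
    apply: (@integrable_bounded _ _ _ _ _ (Im z)^-1); first exact: kz.2.
    by move=> x; exact: le_trans (Im_le_normc _) (normc_real_sub x z0).
  rewrite /g; apply: le_Rintegral => //.
  - apply: integrable_EFinZ.
    apply: (@integrable_bounded _ _ _ _ _ (Im z)^-1); first exact: kz.2.
    by move=> x; exact: le_trans (Im_le_normc _) (normc_real_sub x z0).
  - by apply: integrable_EFinD; [exact: integrable_EFin_cst|exact: integrable_EFinZ].
  move=> x _; rewrite /z /= !subr0 sub0r sqrrN mulNr opprK.
  have y2 : 0 < y ^+ 2 by rewrite exprn_gt0.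
  have s0 : 0 < x ^+ 2 + y ^+ 2 by rewrite ltr_wpDl// sqr_ge0.
  rewrite mulrA -expr2 ler_pdivrMr// indicE.
  have [xy|yx] := leP x y.
    rewrite mem_set/= ?in_itv//= mulr1.
    have x2 := sqr_ge0 x; lra.
  rewrite memNset/= ?in_itv/= ?leNgt ?yx// mulr0 addr0.
  have xy2 : y ^+ 2 <= x ^+ 2 by rewrite lerXn2r ?nnegrE ?(ltW y0) ?(ltW (lt_trans y0 yx))// ltW.
  lra.
rewrite Ig; move: R1; move: (y * Im w) (fine _) => a b; lra.
Qed.

(** The equation is obtained first at rational points, where the defect is known to vanish in the
    limit, and extends to the upper half-plane by continuity of the Stieltjes transform of [mu]. *)
Lemma MP_ultra_limit (U : set_system nat) (mu : probability R R) :
  UltraFilter U -> \oo `<=` U -> mu `[0, +oo[%classic = 1%E ->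
  (forall f : R -> R, continuous f -> bounded_fun f ->
    \int[mu_ n]_x f x @[n --> U] --> \int[mu]_x f x) ->
  MP_stieltjes gamma H mu.
Proof.
move=> UU Uoo mu1 mu_U; have UF : ProperFilter U by exact: ultra_proper.
have toU (V : topologicalType) (u : nat -> V) (l : V) : u n @[n --> \oo] --> l -> u n @[n --> U] --> l.
  by move=> h A /h; exact: Uoo.
have Eq (q r : rat) : 0 < ratr r :> R ->
    MP_equation gamma H (ratr q +i* ratr r) (stieltjes mu (ratr q +i* ratr r)).
  move=> r0; set z := _ +i* _; have z0 : 0 < Im z by [].
  apply: (@MP_equation_limit _ U _ (fun=> z) (fun n => stieltjes (mu_ n) z) c_ H_ _ _ _ (Im z)^-1).
  - exact: Im_stieltjes_gt0.
  - by move=> n; exact: Im_stieltjes_gt0.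
  - by move=> n; exact: normc_stieltjes_le.
  - by rewrite subrr normc0; exact: cvg_cst.
  - apply: cintegral_cvg mu_U; first exact: ccontinuous_stieltjes_kernel.
    by move=> x; exact: normc_real_sub.
  - exact: toU.
  - apply: toU; apply: cintegral_cvg H_cvg.
      exact/ccontinuous_MP_kernel/Im_stieltjes_gt0.
    by move=> x; exact/normc_MP_kernel/Im_stieltjes_gt0.
  - by apply: toU; exact: defect_cvg.
split=> // z z0.
have Sz := Im_stieltjes_gt0 mu z0; suff E : MP_equation gamma H z (stieltjes mu z).
  by split => // m m0 Em; exact: (@MP_unique _ gamma H gamma_gt0 z).
(* Approximation from above keeps all imaginary parts above [Im z], so that [(Im z)^-1] bounds all
   the transforms. *)
have rat_above (x : R) (n : nat) : exists q : rat, x < ratr q /\ ratr q - x < n.+1%:R^-1.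
  have [|q] := @rat_in_itvoo R x (x + n.+1%:R^-1); first by rewrite ltrDl invr_gt0.
  by rewrite in_itv/= -ltrBlDl => /andP[h1 h2]; exists q.
have [q_ qP] := choice (rat_above (Re z)); have [r_ rP] := choice (rat_above (Im z)).
pose z_ n : R[i] := ratr (q_ n) +i* ratr (r_ n).
have zz n : Im z < Im (z_ n) by case: (rP n).
have z_0 n : 0 < Im (z_ n) by exact: lt_trans (zz n).
have zc : normc (z_ n - z) @[n --> \oo] --> (0 : R).
  apply: (@squeeze_cvgr _ _ _ _ (cst 0) (fun n => harmonic n + harmonic n)).
  - apply: nearW => n; rewrite normc_ge0/= (le_trans (normc_le _))// /harmonic/=.
    have [h1 h2] := qP n; have [h3 h4] := rP n.
    by rewrite cReD cReN cImD cImN /= !gtr0_norm ?subr_gt0// lerD// ltW.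
  - exact: cvg_cst.
  - by rewrite -[X in _ --> X](addr0 0); apply: cvgD; exact: cvg_harmonic.
apply: (@MP_equation_limit _ \oo _ z_ (fun n => stieltjes mu (z_ n)) (fun=> gamma)
  (fun=> H) _ _ _ (Im z)^-1) => //.
- by move=> n; exact: Im_stieltjes_gt0.
- move=> n; apply: le_trans (normc_stieltjes_le mu (z_0 n)) _.
  by rewrite lef_pV2 ?posrE// ltW.
- apply: (@squeeze_cvgr _ _ _ _ (cst 0) (fun n => normc (z_ n - z) * ((Im z)^-1 * (Im z)^-1))).
  + apply: nearW => n; rewrite normc_ge0/= (le_trans (stieltjes_dist_le mu (z_0 n) z0))//.
    rewrite invfM ler_wpM2l ?normc_ge0// ler_wpM2r ?invr_ge0 ?(ltW z0)//.
    by rewrite lef_pV2 ?posrE// ltW.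
  + exact: cvg_cst.
  + by rewrite -[X in _ --> X](mul0r ((Im z)^-1 * (Im z)^-1)); apply: cvgM => //; exact: cvg_cst.
- exact: cvg_cst.
- by rewrite subrr normc0; exact: cvg_cst.
apply: cvg_near_cst; apply: nearW => n; have := Eq (q_ n) (r_ n) (z_0 n).
rewrite -/(z_ n) /MP_equation -/(MP_integral H _) => e.
have mn := Im_gt0_neq0 (Im_stieltjes_gt0 mu (z_0 n)).
rewrite [stieltjes mu (z_ n) * _]mulrC mulrA -e mulrDl mulVf// (addrC 1) subrr.
exact: normc0.
Qed.

(** A single ultrafilter above [\oo] already supplies the law; uniqueness shows that every other one
    yields the same law, and this is convergence along [\oo]. *)
Theorem MP_convergence : exists mu : probability R R,
  generalized_MP gamma H mu /\
  forall f : R -> R, continuous f -> bounded_fun f ->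
    \int[mu_ n]_x f x @[n --> \oo] --> \int[mu]_x f x.
Proof.
have neg n x : x < 0 -> fine (mu_ n `]-oo, x]%classic) = 0.
  by move=> x0; rewrite (nonneg_supportP (mu_ n)).1.
have lim (U : set_system nat) : UltraFilter U -> \oo `<=` U ->
    exists mu : probability R R, MP_stieltjes gamma H mu /\
      forall f : R -> R, continuous f -> bounded_fun f ->
        \int[mu_ n]_x f x @[n --> U] --> \int[mu]_x f x.
  move=> UU Uoo; have [|mu [mu0 muc]] := @helly_ultra R U mu_ UU _ neg.
    by move=> e e0; have [M hM] := MP_tight e0; exists M; exact: Uoo.
  exists mu; split => //; apply: MP_ultra_limit muc => //.
  exact/(nonneg_supportP mu).2.
have uniq (mu mu' : probability R R) : MP_stieltjes gamma H mu ->
    MP_stieltjes gamma H mu' -> forall B, measurable B -> mu' B = mu B.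
  move=> [m1 hm] [m1' hm'] B mB; apply: stieltjes_inj => // z z0.
  have [_ _ h] := hm z z0; have [s0 e _] := hm' z z0; exact: h.
have [U0 [U0U U0oo]] := @ultraFilterLemma nat \oo _.
have [mu [MPmu _]] := lim U0 U0U U0oo.
exists mu; split; first by split => // mu' /(uniq _ _ MPmu).
move=> f cf bf; apply: cvg_ultraP => U UU Uoo.
have [mu' [MPmu' h]] := lim U UU Uoo.
have -> : \int[mu]_x f x = \int[mu']_x f x; last exact: h.
congr fine; apply: eq_measure_integral => A mA _; exact: uniq MPmu' MPmu _ mA.
Qed.
End MP_convergence.

(** * Quadratic forms of independent and of permuted columns *)

Section products_of_independent.
Context d (T : measurableType d) (R : realType) (P : probability T R).
Implicit Types f g : T -> R.

Lemma integrable_dominated f g : measurable_fun setT f -> (forall t, `|f t| <= g t) ->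
  P.-integrable setT (EFin \o g) -> P.-integrable setT (EFin \o f).
Proof.
move=> mf fg; apply: le_integrable => //; first exact/measurable_EFinP.
by move=> t _; rewrite /= lee_fin (le_trans (fg t))// ler_norm.
Qed.

Lemma integrable_EFin_sum (I : Type) (s : seq I) (f : I -> T -> R) :
  (forall i, P.-integrable setT (EFin \o f i)) ->
  P.-integrable setT (EFin \o (fun t => \sum_(i <- s) f i t)).
Proof.
move=> fi; elim: s => [|i s IHs].
  apply: eq_integrable (integrable_EFin_cst P 0) => // t _ /=.
  by rewrite big_nil.
apply: eq_integrable (integrable_EFinD (fi i) IHs) => // t _ /=.
by rewrite big_cons.
Qed.

Lemma Rintegral_sum (I : Type) (s : seq I) (f : I -> T -> R) :
  (forall i, P.-integrable setT (EFin \o f i)) ->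
  \int[P]_t (\sum_(i <- s) f i t) = \sum_(i <- s) \int[P]_t f i t.
Proof.
move=> fi; elim: s => [|i s IHs].
  rewrite big_nil -[RHS](Rintegral_prob_cst P); apply: eq_Rintegral => t _.
  by rewrite big_nil.
rewrite big_cons -IHs -RintegralD//; last exact: integrable_EFin_sum.
by apply: eq_Rintegral => t _; rewrite big_cons.
Qed.

Lemma integral_independentM (f g : T -> R) :
  measurable_fun setT f -> measurable_fun setT g ->
  (forall A B, measurable A -> measurable B ->
    P (f @^-1` A `&` g @^-1` B) = P (f @^-1` A) * P (g @^-1` B))%E ->
  forall u v : R -> R, measurable_fun setT u -> measurable_fun setT v ->
  (forall x, 0 <= u x) -> (forall x, 0 <= v x) ->
  (\int[P]_t (u (f t) * v (g t))%:E = \int[P]_t (u (f t))%:E * \int[P]_t (v (g t))%:E)%E.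
Proof.
move=> mf mg fg u v mu mv u0 v0.
have mh : measurable_fun [set: R * R] (fun x : R * R => (u x.1 * v x.2)%:E).
  apply/measurable_EFinP; apply: measurable_funM.
    exact: (measurableT_comp mu measurable_fst).
  exact: (measurableT_comp mv measurable_snd).
rewrite (decoupling mf mg fg mh); last by move=> x; rewrite lee_fin mulr_ge0.
have muf : measurable_fun setT (fun t => (u (f t))%:E).
  by apply/measurable_EFinP; exact: (measurableT_comp mu mf).
have mvg : measurable_fun setT (fun t => (v (g t))%:E).
  by apply/measurable_EFinP; exact: (measurableT_comp mv mg).
under eq_integral => t _.
  under eq_integral => t' _ do rewrite /= EFinM.
  rewrite ge0_integralZl//; last 2 first.
  - by move=> t' _; rewrite lee_fin.
  - by rewrite lee_fin.
  over.
rewrite ge0_integralZr//; first by move=> t _; rewrite lee_fin.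
by apply: integral_ge0 => t _; rewrite lee_fin.
Qed.

Lemma Rintegral_independentM (f g : T -> R) :
  P.-integrable setT (EFin \o f) -> P.-integrable setT (EFin \o g) ->
  P.-integrable setT (EFin \o (fun t => f t * g t)) ->
  (forall A B, measurable A -> measurable B ->
    P (f @^-1` A `&` g @^-1` B) = P (f @^-1` A) * P (g @^-1` B))%E ->
  \int[P]_t (f t * g t) = \int[P]_t f t * \int[P]_t g t.
Proof.
(* Positive and negative parts reduce the claim to nonnegative factors; both are dominated by [|x|],
   so integrability passes to all four products. *)
move=> fi gi fgi fg; pose p (x : R) := Num.max x 0; pose q (x : R) := Num.max (- x) 0.
have mf : measurable_fun setT f by apply/measurable_EFinP/(measurable_int P).
have mg : measurable_fun setT g by apply/measurable_EFinP/(measurable_int P).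
have mp : measurable_fun setT p by exact: measurable_maxr.
have mq : measurable_fun setT q by apply: measurable_maxr => //; exact: measurableT_comp.
have p0 x : 0 <= p x by rewrite le_max lexx orbT.
have q0 x : 0 <= q x by rewrite le_max lexx orbT.
have pq x : x = p x - q x.
  rewrite /p /q; have [x0|x0] := leP 0 x.
    by rewrite (max_idPr _) ?subr0// oppr_le0.
  by rewrite (max_idPl _) ?oppr_ge0 ?ltW// sub0r opprK.
have pn x : `|p x| <= `|x|.
  by rewrite ger0_norm// ge_max normr_ge0 ler_norm.
have qn x : `|q x| <= `|x|.
  by rewrite ger0_norm// ge_max normr_ge0 -normrN ler_norm.
have comp_int (u : R -> R) (k : T -> R) : measurable_fun setT u -> (forall x, `|u x| <= `|x|) ->
    P.-integrable setT (EFin \o k) -> P.-integrable setT (EFin \o (u \o k)).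
  move=> mu un ki; apply: (@integrable_dominated _ (fun t => `|k t|)).
  - by apply: measurableT_comp => //; apply/measurable_EFinP/(measurable_int P).
  - by move=> t /=.
  - exact: integrable_norm.
have E (u v : R -> R) : measurable_fun setT u -> measurable_fun setT v ->
    (forall x, 0 <= u x) -> (forall x, 0 <= v x) ->
    (forall x, `|u x| <= `|x|) -> (forall x, `|v x| <= `|x|) ->
    P.-integrable setT (EFin \o (fun t => u (f t) * v (g t))) /\
    \int[P]_t (u (f t) * v (g t)) = \int[P]_t u (f t) * \int[P]_t v (g t).
  move=> mu mv u0 v0 un vn; have i1 : P.-integrable setT (EFin \o (fun t => u (f t) * v (g t))).
    apply: (@integrable_dominated _ (fun t => `|f t * g t|)).
    - by apply: measurable_funM; exact: measurableT_comp.
    - by move=> t; rewrite !normrM ler_pM.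
    - exact: integrable_norm.
  split => //; apply: EFin_inj; rewrite EFinM !EFin_Rintegral//; last 2 first.
  - exact: comp_int.
  - exact: comp_int.
  exact: integral_independentM.
have [i1 e1] := E p p mp mp p0 p0 pn pn; have [i2 e2] := E p q mp mq p0 q0 pn qn.
have [i3 e3] := E q p mq mp q0 p0 qn pn; have [i4 e4] := E q q mq mq q0 q0 qn qn.
have D (k : T -> R) : P.-integrable setT (EFin \o k) ->
    \int[P]_t k t = \int[P]_t p (k t) - \int[P]_t q (k t).
  move=> ki; rewrite -RintegralB//; [|exact: comp_int..].
  by apply: eq_Rintegral => t _.
rewrite (D f)// (D g)// mulrBl !mulrBr -e1 -e2 -e3 -e4 -!RintegralB//; last first.
- exact: integrable_EFinB.
- exact: integrable_EFinB.
apply: eq_Rintegral => t _; rewrite {1}(pq (f t)) {1}(pq (g t)); ring.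
Qed.

(** Expanding the square leaves only the diagonal terms. *)
Lemma orthogonal_sum_le (J : finType) (f : J -> T -> R) (c : J -> R) (K : R) :
  (forall a, measurable_fun setT (f a)) ->
  (forall a, P.-integrable setT (EFin \o (fun t => f a t ^+ 2))) ->
  (forall a, \int[P]_t (f a t ^+ 2) <= K) ->
  (forall a b, a != b -> \int[P]_t (f a t * f b t) = 0) ->
  P.-integrable setT (EFin \o (fun t => (\sum_a c a * f a t) ^+ 2)) /\
  \int[P]_t ((\sum_a c a * f a t) ^+ 2) <= K * \sum_a c a ^+ 2.
Proof.
move=> mf f2i f2K fab.
have fi a b : P.-integrable setT (EFin \o (fun t => f a t * f b t)).
  apply: (@integrable_dominated _ (fun t => f a t ^+ 2 + f b t ^+ 2)).
  - exact: measurable_funM.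
  - move=> t; rewrite ler_norml; apply/andP; split.
      by have := sqr_ge0 (f a t + f b t); have := sqr_ge0 (f a t); have := sqr_ge0 (f b t); nra.
    by have := sqr_ge0 (f a t - f b t); have := sqr_ge0 (f a t); have := sqr_ge0 (f b t); nra.
  - exact: integrable_EFinD.
have SE t : (\sum_a c a * f a t) ^+ 2 = \sum_a \sum_b (c a * c b) * (f a t * f b t).
  rewrite expr2 mulr_suml; apply: eq_bigr => a _; rewrite mulr_sumr.
  by apply: eq_bigr => b _; ring.
under eq_Rintegral do rewrite SE.
have i1 a b : P.-integrable setT (EFin \o (fun t => (c a * c b) * (f a t * f b t))).
  exact: integrable_EFinZ.
have i2 a := integrable_EFin_sum (index_enum J) (i1 a).
split.
  apply: eq_integrable (integrable_EFin_sum (index_enum J) i2) => // t _.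
  by rewrite /= SE.
rewrite Rintegral_sum// mulr_sumr; apply: ler_sum => a _.
rewrite Rintegral_sum// (bigD1 a)//= big1 ?addr0 => [|b ba].
  by rewrite RintegralZl// -expr2 mulrC ler_wpM2r ?sqr_ge0//; exact: f2K.
by rewrite RintegralZl// fab ?mulr0// eq_sym.
Qed.

End products_of_independent.

Lemma second_moment_bounds d (T : measurableType d) (R : realType)
    (P : probability T R) (X : T -> R) : measurable_fun setT X ->
  P.-integrable setT (EFin \o (fun t => X t ^+ 4)) ->
  P.-integrable setT (EFin \o (fun t => X t ^+ 2)) /\
  0 <= \int[P]_t (X t ^+ 2) <= 1 + \int[P]_t (X t ^+ 4).
Proof.
move=> mX X4; have X4' : P.-integrable setT (EFin \o (fun t => 1 + X t ^+ 4)).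
  by apply: integrable_EFinD => //; exact: integrable_EFin_cst.
have b t : X t ^+ 2 <= 1 + X t ^+ 4.
  rewrite (exprM _ 2 2); move: (X t ^+ 2) => a.
  by have := sqr_ge0 (a - 2^-1); nra.
have X2 : P.-integrable setT (EFin \o (fun t => X t ^+ 2)).
  apply: integrable_dominated X4'; first exact: measurable_funX.
  by move=> t; rewrite ger0_norm ?sqr_ge0.
split => //; apply/andP; split; first by apply: Rintegral_ge0 => t _; exact: sqr_ge0.
apply: (@le_trans _ _ (\int[P]_t (1 + X t ^+ 4))); first exact: le_Rintegral.
by rewrite RintegralD ?Rintegral_prob_cst//; exact: integrable_EFin_cst.
Qed.

Section independent_entries.
Context d (T : measurableType d) (R : realType) (P : probability T R).
Variables (n : nat) (X : 'I_n -> T -> R) (K : R).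
Hypothesis mX : forall i, measurable_fun setT (X i).
Hypothesis Xind : mutually_independent P (fun i => sigma_RV (X i)).
Hypothesis X4 : forall i, P.-integrable setT (EFin \o (fun t => X i t ^+ 4)).
Hypothesis X4K : forall i, \int[P]_t (X i t ^+ 4) <= K.
Hypothesis X1 : forall i, \int[P]_t X i t = 0.

Let F i := sigma_RV (X i).

Lemma sigma_RV_measurable i : F i `<=` measurable.
Proof. by move=> _ [A mA <-]; exact: mX. Qed.

Lemma sigma_RV_setT i : F i setT.
Proof. by exists setT => //; rewrite preimage_setT setTI. Qed.

Lemma sigma_RV_setI i : setI_closed (F i).
Proof.
move=> _ _ [A mA <-] [B mB <-]; exists (A `&` B); first exact: measurableI.
by rewrite preimage_setI setIACA setIid.
Qed.

Let G (J : {set 'I_n}) := \bigcup_(i in [set` J]) F i.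

(** [g] is a function of the entries other than [X k], encoded by measurability for the
    sigma-algebra they generate, so that sums and products need no separate argument. *)
Let free (k : 'I_n) (g : T -> R) :=
  @measurable_fun _ _ (g_sigma_algebraType (G [set~ k])) _ setT g.

Let free_X k l : l != k -> free k (X l).
Proof.
move=> lk _ A mA; apply: sub_sigma_algebra; exists l; first by rewrite /= !finset.inE.
by exists A.
Qed.

Let free_indep k (g : T -> R) (phi : R -> R) : measurable_fun setT phi ->
  free k g -> forall A B, measurable A -> measurable B ->
  (P ((fun t => phi (X k t)) @^-1` A `&` g @^-1` B) =
   P ((fun t => phi (X k t)) @^-1` A) * P (g @^-1` B))%E.
Proof.
move=> mphi gk A B mA mB.
have h := @grouping_independent _ _ _ _ _ _ sigma_RV_measurable sigma_RV_setT
  sigma_RV_setI Xind [set k] [set~ k].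
apply: h; first by rewrite disjoints1 !finset.inE eqxx.
  apply: sub_sigma_algebra; exists k; first by rewrite /= !finset.inE.
  exists (phi @^-1` A); last by rewrite setTI.
  by rewrite -[X in measurable X]setTI; exact: mphi.
by have := gk measurableT B mB; rewrite setTI.
Qed.

Let L2 (f : T -> R) := measurable_fun setT f /\ P.-integrable setT (EFin \o (fun t => f t ^+ 2)).

Let mul_le_sqr (a b : R) : `|a * b| <= a ^+ 2 + b ^+ 2.
Proof.
have h1 := sqr_ge0 (a + b); have h2 := sqr_ge0 (a - b).
have h3 := sqr_ge0 a; have h4 := sqr_ge0 b.
rewrite sqrrD in h1; rewrite sqrrB in h2; rewrite !mulr2n in h1 h2.
by rewrite ler_norml; apply/andP; split; lra.
Qed.

Let L2M f g : L2 f -> L2 g -> P.-integrable setT (EFin \o (fun t => f t * g t)).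
Proof.
move=> [mf fi] [mg gi]; apply: (@integrable_dominated _ _ _ _ _ (fun t => f t ^+ 2 + g t ^+ 2)).
- exact: measurable_funM.
- by move=> t; exact: mul_le_sqr.
- exact: integrable_EFinD.
Qed.

Let L2_cst c : L2 (fun=> c).
Proof. by split; [exact: measurable_cst|exact: integrable_EFin_cst]. Qed.

Let L2_integrable f : L2 f -> P.-integrable setT (EFin \o f).
Proof.
move=> lf; apply: eq_integrable (L2M lf (L2_cst 1)) => // t _.
by rewrite /= mulr1.
Qed.

Let L2D f g : L2 f -> L2 g -> L2 (fun t => f t + g t).
Proof.
move=> lf lg; split; first exact: measurable_funD lf.1 lg.1.
have i1 := integrable_EFinD (integrable_EFinD lf.2 (integrable_EFinZ 2 (L2M lf lg))) lg.2.
by apply: eq_integrable i1 => // t _; rewrite /= sqrrD mulr_natl.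
Qed.

Let L2XX i j : L2 (fun t => X i t * X j t).
Proof.
split; first exact: measurable_funM.
apply: (@integrable_dominated _ _ _ _ _ (fun t => X i t ^+ 4 + X j t ^+ 4)).
- by apply: measurable_funX; exact: measurable_funM.
- by move=> t; rewrite exprMn; apply: le_trans (mul_le_sqr _ _) _; rewrite -!exprM.
- exact: integrable_EFinD.
Qed.

Let L2X2 i : L2 (fun t => X i t ^+ 2).
Proof. by have [h1 h2] := L2XX i i; split. Qed.

Let L2X i : L2 (X i).
Proof. by split => //; exact: L2_integrable (L2X2 i). Qed.

Let w i := \int[P]_t (X i t ^+ 2).

Let L2C i : L2 (fun t => X i t ^+ 2 - w i).
Proof. by apply: L2D (L2X2 i) (L2_cst _). Qed.

Let int_C i : \int[P]_t (X i t ^+ 2 - w i) = 0.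
Proof.
rewrite RintegralB//; [|exact: L2_integrable (L2X2 i)|exact: integrable_EFin_cst].
by rewrite Rintegral_prob_cst subrr.
Qed.

Let freeM k f g : free k f -> free k g -> free k (fun t => f t * g t).
Proof. exact: measurable_funM. Qed.

Let free_C k l : l != k -> free k (fun t => X l t ^+ 2 - w l).
Proof.
move=> lk; apply: measurable_funB; last exact: measurable_cst.
by apply: measurable_funX; exact: free_X.
Qed.

Let orth k (phi : R -> R) (f g : T -> R) : measurable_fun setT phi ->
  (forall t, f t = phi (X k t)) -> free k g ->
  P.-integrable setT (EFin \o f) -> P.-integrable setT (EFin \o g) ->
  P.-integrable setT (EFin \o (fun t => f t * g t)) ->
  \int[P]_t f t = 0 -> \int[P]_t (f t * g t) = 0.
Proof.
move=> mphi /funext -> gk fi gi fgi f0; rewrite Rintegral_independentM// ?f0 ?mul0r//.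
by move=> A B mA mB; exact: free_indep.
Qed.

Let orth_CC k l : k != l ->
  \int[P]_t ((X k t ^+ 2 - w k) * (X l t ^+ 2 - w l)) = 0.
Proof.
move=> kl; apply: (@orth k (fun x => x ^+ 2 - w k)) => //.
- by apply: measurable_funB => //; exact: measurable_funX.
- by apply: free_C; rewrite eq_sym.
- exact: L2_integrable.
- exact: L2_integrable.
- exact: L2M.
Qed.

Let orth_XC k i j : i != j ->
  \int[P]_t ((X k t ^+ 2 - w k) * (X i t * X j t)) = 0.
Proof.
move=> ij; wlog ik : i j ij / i != k.
  move=> W; have [ik|] := eqVneq i k; last exact: W.
  under eq_Rintegral do rewrite (mulrC (X i _)).
  by apply: W; rewrite -?ik eq_sym.
under eq_Rintegral => t _.
  rewrite (_ : _ * _ = X i t * ((X k t ^+ 2 - w k) * X j t)); last by ring.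
  over.
apply: (@orth i id) => //.
- by apply: freeM; [apply: free_C|apply: free_X]; rewrite eq_sym.
- exact: L2_integrable.
- exact: L2M.
have := L2M (L2XX i j) (L2C k); apply: eq_integrable => // t _ /=.
by congr EFin; ring.
Qed.

Let orth_X3 m i j k : m != i -> m != j -> m != k ->
  \int[P]_t (X m t * (X i t * (X j t * X k t))) = 0.
Proof.
move=> mi mj mk; apply: (@orth m id) => //.
- by apply: freeM; [|apply: freeM]; apply: free_X; rewrite eq_sym.
- exact: L2_integrable.
- exact: L2M.
have := L2M (L2XX m i) (L2XX j k); apply: eq_integrable => // t _ /=.
by congr EFin; ring.
Qed.

Let K_ge0 (i : 'I_n) : 0 <= K.
Proof.
by apply: le_trans (X4K i); apply: Rintegral_ge0 => t _; rewrite (exprM _ 2 2) sqr_ge0.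
Qed.

(** The form is expanded in an orthogonal family: [X k ^ 2 - w k] with coefficient [M k k], and
    [X k * X l] for [k < l] with coefficient [M k l + M l k]. Each member has second moment at most
    [K], and the 2 comes from squaring the sum of two coefficients. *)
Lemma quad_dev_second_moment (M : 'M[R]_n) :
  let q t := \sum_k \sum_l M k l * (X k t * X l t) - \sum_k M k k * w k in
  P.-integrable setT (EFin \o (fun t => q t ^+ 2)) /\
  \int[P]_t (q t ^+ 2) <= 2 * K * \sum_k \sum_l M k l ^+ 2.
Proof.
move=> q.
pose f (a : 'I_n * 'I_n) : T -> R := if a.1 == a.2 then (fun t => X a.1 t ^+ 2 - w a.1)
  else if (a.1 < a.2)%N then (fun t => X a.1 t * X a.2 t) else (fun=> 0).
pose c (a : 'I_n * 'I_n) : R := if a.1 == a.2 then M a.1 a.1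
  else if (a.1 < a.2)%N then M a.1 a.2 + M a.2 a.1 else 0.
have tri (g : 'I_n -> 'I_n -> R) : \sum_k \sum_l g k l =
    \sum_k \sum_l (if k == l then g k k else if (k < l)%N then g k l + g l k else 0).
  pose A (k l : 'I_n) : R := if k == l then g k k else if (k < l)%N then g k l else 0.
  pose B (k l : 'I_n) : R := if k == l then 0 else if (k < l)%N then g l k else 0.
  transitivity (\sum_k \sum_l A k l + \sum_k \sum_l B k l).
    rewrite [X in _ + X]exchange_big -big_split; apply: eq_bigr => k _ /=.
    rewrite -big_split; apply: eq_bigr => l _ /=; rewrite /A /B (eq_sym l).
    case: (eqVneq k l) => [->|kl]; first by rewrite addr0.
    by case: ltngtP => [||/val_inj/eqP]; rewrite ?addr0 ?add0r// (negbTE kl).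
  rewrite -big_split; apply: eq_bigr => k _; rewrite -big_split; apply: eq_bigr => l _.
  by rewrite /A /B /=; case: eqP => _; [rewrite addr0|case: ifP; rewrite ?addr0].
have qE t : q t = \sum_a c a * f a t.
  rewrite /q -(pair_bigA _ (fun k l => c (k, l) * f (k, l) t)) /= tri -sumrB.
  apply: eq_bigr => k _; rewrite (bigD1 k)//= [RHS](bigD1 k)//= /c /f /= eqxx.
  rewrite addrAC; congr (_ + _); first by ring.
  apply: eq_bigr => l lk; rewrite eq_sym (negbTE lk).
  by case: ifP => _ /=; ring.
have cE : \sum_a c a ^+ 2 <= 2 * \sum_k \sum_l M k l ^+ 2.
  rewrite -(pair_bigA _ (fun k l => c (k, l) ^+ 2)) /= [in leRHS]tri mulr_sumr.
  apply: ler_sum => k _; rewrite mulr_sumr; apply: ler_sum => l _; rewrite /c /=.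
  case: ifP => _; first by have := sqr_ge0 (M k k); lra.
  case: ifP => _; last by rewrite expr0n mulr0.
  by have := sqr_ge0 (M k l - M l k); rewrite sqrrB sqrrD !mulr2n; lra.
have [||||i1 i2] := @orthogonal_sum_le _ _ _ P _ f c K.
- move=> [k l]; rewrite /f /=; case: ifP => _; first exact: (L2C k).1.
  by case: ifP => _; [exact: (L2XX k l).1|exact: measurable_cst].
- move=> [k l]; rewrite /f /=; case: ifP => _; first exact: (L2C k).2.
  by case: ifP => _; [exact: (L2XX k l).2|exact: (L2_cst 0).2].
- move=> [k l]; rewrite /f /=; case: ifP => _.
    under eq_Rintegral => t _.
      rewrite (_ : _ ^+ 2 = X k t ^+ 4 - 2 * w k * (X k t ^+ 2 - w k) - w k ^+ 2); last by ring.
      over.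
    rewrite RintegralB//; last 2 first.
    + by apply: integrable_EFinB => //; apply: integrable_EFinZ; exact: L2_integrable.
    + exact: integrable_EFin_cst.
    rewrite RintegralB//; last by apply: integrable_EFinZ; exact: L2_integrable.
    rewrite RintegralZl//; last exact: L2_integrable.
    rewrite int_C Rintegral_prob_cst mulr0 subr0 lerBlDr (le_trans (X4K k))// lerDl.
    exact: sqr_ge0.
  case: ifP => _.
    have h : \int[P]_t ((X k t * X l t) ^+ 2) <= \int[P]_t (2^-1 * (X k t ^+ 4 + X l t ^+ 4)).
      apply: le_Rintegral => //; first exact: (L2XX k l).2.
        by apply: integrable_EFinZ; exact: integrable_EFinD.
      by move=> t _; have := sqr_ge0 (X k t ^+ 2 - X l t ^+ 2); rewrite exprMn; nra.
    apply: le_trans h _; rewrite RintegralZl//; last exact: integrable_EFinD.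
    rewrite RintegralD//; have := X4K k; have := X4K l; lra.
  by rewrite expr0n Rintegral_prob_cst; exact: K_ge0 k.
- move=> [k l] [k' l'] /=; rewrite /f /= xpair_eqE => ne.
  case: (eqVneq k l) ne => [<-|kl] ne.
    case: (eqVneq k' l') ne => [<-|k'l'] ne.
      by apply: orth_CC; move: ne; rewrite andbb.
    case: ifP => _; first exact: orth_XC.
    by under eq_Rintegral do rewrite mulr0; rewrite Rintegral_prob_cst.
  case: (ltnP k l) => [klt|_]; last first.
    by under eq_Rintegral do rewrite mul0r; rewrite Rintegral_prob_cst.
  case: (eqVneq k' l') ne => [<-|k'l'] ne.
    by under eq_Rintegral do rewrite mulrC; exact: orth_XC.
  case: (ltnP k' l') => [klt'|_]; last first.
    by under eq_Rintegral do rewrite mulr0; rewrite Rintegral_prob_cst.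
  (* Two distinct increasing pairs leave an index of the first outside the second; the corresponding
     centred factor is independent of the other three. *)
  have [kk'|kk'] := boolP ((k != k') && (k != l')).
    have /andP[h1 h2] := kk'; under eq_Rintegral do rewrite -mulrA.
    exact: orth_X3.
  have ll' : (l != k') && (l != l').
    apply: contraNT ne; move: kk'; rewrite !negb_and !negbK.
    move=> /orP[/eqP e1|/eqP e1] /orP[/eqP e2|/eqP e2]; rewrite ?e1 ?e2 ?eqxx//.
    - by move: kl; rewrite e1 e2 eqxx.
    - by move: klt klt'; rewrite e1 e2 => /ltn_trans h /h; rewrite ltnn.
    - by move: kl; rewrite e1 e2 eqxx.
  have /andP[h1 h2] := ll'; under eq_Rintegral do rewrite (mulrC (X k _)) -mulrA.
  by apply: orth_X3 => //; rewrite eq_sym.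
split.
  by apply: eq_integrable i1 => // t _; rewrite /= -qE.
under eq_Rintegral do rewrite qE.
apply: le_trans i2 _; rewrite [2 * K]mulrC -mulrA.
have [n0|] := posnP n; last by move=> n0; rewrite ler_wpM2l// (K_ge0 (Ordinal n0)).
have no (i : 'I_n) : False by case: i => i; rewrite n0.
rewrite [X in _ * X <= _]big1 => [|a _]; last by case: (no a.1).
by rewrite big1 ?mulr0// => k; case: (no k).
Qed.

End independent_entries.

(** * Averages over uniform permutations *)

Section permutation_average.
Variables (R : realFieldType) (n : nat) (u dd : 'I_n -> R) (C : R).
Hypothesis u0 : \sum_i u i = 0.
Hypothesis uC : forall i, u i ^+ 2 <= C.

(** Up to the factor [n!], the covariance of the values at [k] and [l] under a uniform
    permutation. *)
Let S k l : R := \sum_(sg : 'S_n) u (sg k) * u (sg l).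

Let S_tperm (k l k' l' : 'I_n) (t : 'S_n) : t k = k' -> t l = l' -> S k l = S k' l'.
Proof.
move=> <- <-; rewrite /S (reindex_inj (mulgI t)) /=.
by apply: eq_bigr => sg _; rewrite !permM.
Qed.

Let S_diag k l : S k k = S l l.
Proof. by apply: (S_tperm (t := tperm k l)); rewrite tpermL. Qed.

Let S_off k l l' : l != k -> l' != k -> S k l = S k l'.
Proof.
move=> lk l'k; apply: (S_tperm (t := tperm l l')); last by rewrite tpermL.
by rewrite tpermD.
Qed.

Let S_sum k : \sum_l S k l = 0.
Proof.
rewrite exchange_big big1 // => sg _; rewrite -mulr_sumr.
have -> : \sum_i u (sg i) = \sum_i u i by rewrite [RHS](reindex_inj (@perm_inj _ sg)).
by rewrite u0 mulr0.
Qed.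

(* Exchangeability makes the covariances of the [u (sg k)] equal off the
   diagonal, and the constraint [u0] makes them nonpositive. *)
Lemma perm_average_sqr_le :
  \sum_(sg : 'S_n) (\sum_k dd k * u (sg k)) ^+ 2 <= 2 * C * n`!%:R * \sum_k dd k ^+ 2.
Proof.
have -> : \sum_(sg : 'S_n) (\sum_k dd k * u (sg k)) ^+ 2 =
    \sum_k \sum_l dd k * dd l * S k l.
  under eq_bigr => sg _.
    rewrite expr2 mulr_suml; under eq_bigr do rewrite mulr_sumr.
    over.
  rewrite exchange_big; apply: eq_bigr => k _; rewrite exchange_big; apply: eq_bigr => l _.
  by rewrite /S mulr_sumr; apply: eq_bigr => sg _; ring.
have SC k : 0 <= S k k <= C * n`!%:R.
  apply/andP; split; first by apply: sumr_ge0 => sg _; rewrite -expr2 sqr_ge0.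
  rewrite -(card_Sn n) mulr_natr -sumr_const.
  by apply: ler_sum => sg _; rewrite -expr2.
(* For [n <= 1] the constraint forces [u = 0]; afterwards the divisor [n - 1] is positive. *)
have [n1|n1] := leqP n 1.
  have u00 i : u i = 0.
    move: u0; rewrite (bigD1 i)//= big1 ?addr0// => j /eqP[].
    by apply: val_inj => /=; have := ltn_ord i; have := ltn_ord j; lia.
  rewrite big1 => [|k _]; last first.
    by rewrite big1 // => l _; rewrite /S big1 ?mulr0// => sg _; rewrite u00 mul0r.
  case: (posnP n) => [n0|n0]; last first.
    have C0 : 0 <= C by apply: le_trans (uC (Ordinal n0)); exact: sqr_ge0.
    by rewrite !mulr_ge0// sumr_ge0// => k _; exact: sqr_ge0.
  by rewrite big1 ?mulr0// => k _; have := ltn_ord k; rewrite {2}n0.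
pose i0 : 'I_n := Ordinal (ltnW n1); pose s := S i0 i0; pose m : R := n%:R - 1.
have m0 : 0 < m by rewrite subr_gt0 ltr1n.
have m1 : 1 <= m by rewrite /m lerBrDr -[1 + 1]/(2%:R) ler_nat.
(* A row of [S] sums to 0, so its [n - 1] equal off-diagonal entries share [- s]. *)
have offE k l : l != k -> S k l = - s / m.
  move=> lk; have := S_sum k; rewrite (bigD1 k)//= (S_diag k i0) -/s.
  rewrite (eq_bigr (fun=> S k l)) => [|l' l'k]; last exact: S_off.
  rewrite sumr_const cardC1 card_ord -mulr_natl => h.
  have nm : n.-1%:R = m by rewrite /m -[in RHS](prednK (ltnW n1)) -natr1 addrK.
  rewrite nm in h; have -> : S k l = (s + m * S k l - s) / m by field; rewrite gt_eqF.
  by rewrite h sub0r.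
have -> : \sum_k \sum_l dd k * dd l * S k l =
    s * (1 + m^-1) * (\sum_k dd k ^+ 2) - s / m * (\sum_k dd k) ^+ 2.
  transitivity (\sum_k (s * (1 + m^-1) * dd k ^+ 2 - s / m * (dd k * \sum_l dd l))); last first.
    by rewrite sumrB -!mulr_sumr -mulr_suml expr2.
  apply: eq_bigr => k _.
  rewrite (bigD1 k)//= [X in _ - _ * (_ * X)](bigD1 k)//= (S_diag k i0) -/s.
  rewrite (eq_bigr (fun l => (dd k * (- s / m)) * dd l)) => [|l lk]; last first.
    by rewrite offE//; ring.
  by rewrite -mulr_sumr; field; rewrite gt_eqF.
have /andP[s0 sC] := SC i0; rewrite -/s in s0 sC.
have D0 : 0 <= \sum_k dd k ^+ 2 by apply: sumr_ge0 => k _; exact: sqr_ge0.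
have E0 : 0 <= s / m * (\sum_k dd k) ^+ 2.
  by apply: mulr_ge0; [exact: divr_ge0 s0 (ltW m0)|exact: sqr_ge0].
have mi : m^-1 <= 1 by rewrite invf_le1.
(* The 2 of the statement bounds [1 + 1 / (n - 1)]. *)
have m2 : 1 + m^-1 <= 2 by lra.
have mi0 : 0 <= 1 + m^-1 by rewrite addr_ge0// invr_ge0 ltW.
apply: (@le_trans _ _ (s * (1 + m^-1) * \sum_k dd k ^+ 2)); first by rewrite lerBlDr lerDl.
rewrite ler_wpM2r// (le_trans (ler_pM s0 mi0 sC m2))//.
by rewrite le_eqVlt; apply/orP; left; apply/eqP; ring.
Qed.

End permutation_average.

(** * Independence of columns and permuted quadratic forms *)

Section column_independence.
Context d (T : measurableType d) (R : realType) (P : probability T R).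
Variables (I : finType) (F : I -> set (set T)) (n p : nat) (col : I -> 'I_p).
Hypothesis Fm : forall i, F i `<=` measurable.
Hypothesis FT : forall i, F i setT.
Hypothesis FI : forall i, setI_closed (F i).
Hypothesis Find : mutually_independent P F.
Variable Y : T -> 'M[R]_(n, p).
Hypothesis mY : forall i j A, measurable A ->
  <<s \bigcup_(a in [set a | col a = j]) F a >> ((fun t => Y t i j) @^-1` A).

(** The identity of [T] is read through two sigma-algebras, one generated by the sources of column
    [k] and one by all other sources; grouping makes them independent, and decoupling applies to
    this pair of maps. *)
Lemma independent_columns_grouping : independent_columns P Y.
Proof.
move=> k h mh h0.
pose J := [set a : I | col a == k]%SET; pose K := [set a : I | col a != k]%SET.
pose G (L : {set I}) := \bigcup_(i in [set` L]) F i.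
have GJ : \bigcup_(a in [set a | col a = k]) F a `<=` G J.
  by move=> A [a /= ak Fa]; exists a => //; rewrite /= finset.inE ak eqxx.
have GK j : j != k -> \bigcup_(a in [set a | col a = j]) F a `<=` G K.
  by move=> jk A [a /= aj Fa]; exists a => //; rewrite /= finset.inE aj.
pose TK := g_sigma_algebraType (G K); pose TJ := g_sigma_algebraType (G J).
have mid (L : {set I}) : @measurable_fun _ _ T (g_sigma_algebraType (G L)) setT (fun t => t).
  move=> _ A mA; rewrite setTI preimage_id.
  by apply: smallest_sub mA; [exact: sigma_algebra_measurable|move=> B [i _]; exact: Fm].
pose hh (u : TK * TJ) := (h (replace_col k (Y u.1) (Y u.2)))%:E.
have mhh : measurable_fun [set: TK * TJ] hh.
  apply/measurable_EFinP; apply: mh => i j.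
  under eq_fun do rewrite replace_colE.
  case: (eqVneq j k) => [->|jk].
    apply: (measurableT_comp (f := fun t : TJ => Y t i k) (g := snd)); last exact: measurable_snd.
    move=> _ A mA; rewrite setTI; move: (@mY i k _ mA); apply: sub_sigma_algebra2; exact: GJ.
  apply: (measurableT_comp (f := fun t : TK => Y t i j) (g := fst)); last exact: measurable_fst.
  move=> _ A mA; rewrite setTI; move: (@mY i j _ mA); apply: sub_sigma_algebra2; exact: GK.
have hE := @decoupling _ _ _ P _ _ TK TJ (fun t => t) (fun t => t) hh (mid K) (mid J).
rewrite -hE//.
- apply: eq_integral => t _; rewrite /hh /=; congr (h _)%:E.
  by apply/matrixP => i j; rewrite replace_colE if_same.
- move=> A B mA mB; rewrite !preimage_id.
  apply: (grouping_independent Fm FT FI Find (J := K) (K := J)) => //.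
  by apply/pred0P => a /=; rewrite !finset.inE; case: eqP.
- by move=> u; rewrite /hh lee_fin.
Qed.

End column_independence.

Lemma mutually_independent_inj d (T : measurableType d) (R : realType)
    (P : probability T R) (I J : finType) (f : J -> I) (F : I -> set (set T)) :
  injective f -> mutually_independent P F -> mutually_independent P (F \o f).
Proof.
move=> fI h L E FE.
pose E' i := if [pick j | f j == i] is Some j then E j else setT.
have E'E j : E' (f j) = E j.
  by rewrite /E'; case: pickP => [j' /eqP/fI ->//|/(_ j)]; rewrite eqxx.
have -> : \bigcap_(i in [set` L]) E i = \bigcap_(i in [set` f @: L]) E' i.
  apply/seteqP; split=> [t h1 i /= /imsetP[j jL ->]|t h1 j /= jL].
    by rewrite E'E; exact: h1.
  by rewrite -E'E; apply: h1; rewrite /= imset_f.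
rewrite h => [|i /imsetP[j jL ->]]; last by rewrite E'E; exact: FE.
rewrite big_imset/=; last by move=> ? ? _ _ /fI.
by apply: eq_bigr => j _; rewrite E'E.
Qed.

Section permuted_quadratic_form.
Context d (T : measurableType d) (R : realType) (P : probability T R).
Variables (n : nat) (X : 'I_n -> T -> R) (K : R) (s : T -> 'S_n).
Hypothesis mX : forall i, measurable_fun setT (X i).
Hypothesis Xind : mutually_independent P (fun i => sigma_RV (X i)).
Hypothesis X4 : forall i, P.-integrable setT (EFin \o (fun t => X i t ^+ 4)).
Hypothesis X4K : forall i, \int[P]_t (X i t ^+ 4) <= K.
Hypothesis X1 : forall i, \int[P]_t X i t = 0.
Hypothesis s_unif : uniform_perm P s.
Hypothesis sX : independent_families P (sigma_discrete s)
  <<s \bigcup_i sigma_RV (X i) >>.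

Let w i := \int[P]_t (X i t ^+ 2).
Let v := n%:R^-1 * \sum_i w i.

Let w_bounds i : 0 <= w i <= 1 + K.
Proof.
have [_ /andP[-> h]] := second_moment_bounds (mX i) (X4 i).
by rewrite (le_trans h)// lerD2l.
Qed.

Let D (M : 'M[R]_n) (sg : 'S_n) t := quad_dev M v (fun i => X (sg i) t).

(** For a fixed permutation, moving it onto the matrix turns the deviation into a centred quadratic
    form with reindexed matrix [M'] plus a deterministic bias, since the variances [w (sg k)] differ
    from their mean [v]. *)
Let D_second_moment (M : 'M[R]_n) (sg : 'S_n) :
  P.-integrable setT (EFin \o (fun t => D M sg t ^+ 2)) /\
  \int[P]_t (D M sg t ^+ 2) <= 4 * K * (\sum_k \sum_l M k l ^+ 2) +
    2 * (\sum_k M k k * (w (sg k) - v)) ^+ 2.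
Proof.
pose M' : 'M[R]_n := \matrix_(k, l) M (sg^-1%g k) (sg^-1%g l).
pose q t := \sum_k \sum_l M' k l * (X k t * X l t) - \sum_k M' k k * w k.
have [i1] : P.-integrable setT (EFin \o (fun t => q t ^+ 2)) /\
    \int[P]_t (q t ^+ 2) <= 2 * K * \sum_k \sum_l M' k l ^+ 2.
  exact: quad_dev_second_moment.
set c := \sum_k M k k * (w (sg k) - v).
have re2 (g : 'I_n -> 'I_n -> R) : \sum_k \sum_l g k l = \sum_k \sum_l g (sg k) (sg l).
  rewrite (reindex_inj (@perm_inj _ sg)); apply: eq_bigr => k _.
  by rewrite (reindex_inj (@perm_inj _ sg)).
have DE t : D M sg t = q t + c.
  rewrite /D /quad_dev /q [in RHS]re2 [X in _ = _ - X + _](reindex_inj (@perm_inj _ sg)) /=.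
  rewrite /c mulr_sumr -addrA; congr (_ + _).
    by apply: eq_bigr => k _; apply: eq_bigr => l _; rewrite mxE !permK.
  rewrite -sumrN -sumrN -big_split; apply: eq_bigr => k _.
  by rewrite mxE !permK /=; ring.
have -> : \sum_k \sum_l M' k l ^+ 2 = \sum_k \sum_l M k l ^+ 2.
  by rewrite [LHS]re2; apply: eq_bigr => k _; apply: eq_bigr => l _; rewrite mxE !permK.
move=> q2.
have mq : measurable_fun setT q.
  apply: measurable_funB; last exact: measurable_cst.
  apply: measurable_sum => k; apply: measurable_sum => l.
  by apply: measurable_funM => //; exact: measurable_funM.
have ib : P.-integrable setT (EFin \o (fun t => 2 * q t ^+ 2 + 2 * c ^+ 2)).
  by apply: integrable_EFinD; [exact: integrable_EFinZ|exact: integrable_EFin_cst].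
have bd t : D M sg t ^+ 2 <= 2 * q t ^+ 2 + 2 * c ^+ 2.
  by rewrite DE; move: (q t) (c) => a e; have := sqr_ge0 (a - e); nra.
have i2 : P.-integrable setT (EFin \o (fun t => D M sg t ^+ 2)).
  apply: integrable_dominated ib; last by move=> t; rewrite ger0_norm ?sqr_ge0.
  apply: measurable_funX; rewrite (_ : D M sg = fun t => q t + c); last exact/funext.
  by apply: measurable_funD => //; exact: measurable_cst.
split => //; apply: (@le_trans _ _ (\int[P]_t (2 * q t ^+ 2 + 2 * c ^+ 2))).
  exact: le_Rintegral.
rewrite RintegralD//; [|exact: integrable_EFinZ|exact: integrable_EFin_cst].
rewrite RintegralZl// Rintegral_prob_cst lerD2r.
by rewrite (_ : 4 = 2 * 2) -?mulrA ?ler_pM2l ?mulrA//; ring.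
Qed.

(** The integral is split over the values of [s], each of weight [1 / n!] and independent of the
    entries. The bias, which need not be small for one permutation, is bounded on average by the
    permutation estimate with [C = (1 + K)^2]; both constants 4 are [2 * 2]. *)
Lemma permuted_quad_dev_second_moment (M : 'M[R]_n) :
  (\int[P]_t (quad_dev M v (fun i => X (s t i) t) ^+ 2)%:E <=
   ((4 * K + 4 * (1 + K) ^+ 2) * \sum_k \sum_l M k l ^+ 2)%:E)%E.
Proof.
have mD sg : @measurable_fun _ _ (g_sigma_algebraType (\bigcup_i sigma_RV (X i))) _ setT (D M sg).
  have mXs i : @measurable_fun _ _ (g_sigma_algebraType (\bigcup_i sigma_RV (X i))) _ setT (X i).
    by move=> _ A mA; apply: sub_sigma_algebra; exists i => //; exists A.
  apply: measurable_funB; last exact: measurable_cst.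
  apply: measurable_sum => k; apply: measurable_sum => l.
  by apply: measurable_funM => //; exact: measurable_funM.
have mDT sg : measurable_fun setT (D M sg).
  apply: measurable_funB; last exact: measurable_cst.
  apply: measurable_sum => k; apply: measurable_sum => l.
  by apply: measurable_funM => //; exact: measurable_funM.
pose f (sg : 'S_n) t : R := (s t == sg)%:R.
have msU (U : set 'S_n) : measurable (s @^-1` U).
  have -> : s @^-1` U = \bigcup_(sg in U) s @^-1` [set sg].
    by apply/seteqP; split=> [t Ut|t [sg Us /= ->//]]; exists (s t).
  apply: fin_bigcup_measurable => [|sg _]; last by have [] := s_unif sg.
  exact: finite_finset.
have fE sg (A : set R) : f sg @^-1` A = s @^-1` [set x | A ((x == sg)%:R)] by [].
have mf sg : measurable_fun setT (f sg).
  by move=> _ A mA; rewrite setTI fE; exact: msU.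
have E sg : (\int[P]_t (f sg t * D M sg t ^+ 2)%:E =
    ((n`!%:R)^-1 * \int[P]_t (D M sg t ^+ 2))%:E)%E.
  (* The product formula asks for functions nonnegative on the whole line, so the 0-1 valued [f sg]
     enters through [Num.norm], which fixes its values. *)
  have h := @integral_independentM _ _ _ P (f sg) (D M sg) (mf sg) (mDT sg) _ Num.norm (fun x => x ^+ 2).
  rewrite EFinM EFin_Rintegral; last by case: (D_second_moment M sg).
  have <- : (\int[P]_t (`|f sg t|%:E) = (n`!%:R^-1 : R)%:E)%E.
    have mss : measurable (s @^-1` [set sg]) by exact: msU.
    have [_ <-] := s_unif sg; rewrite -[s @^-1` _ in RHS]setIT -integral_indic//.
    apply: eq_integral => t _; rewrite indicE /f ger0_norm ?ler0n//.
    congr ((nat_of_bool _)%:R)%:E; apply/eqP/idP => [<-|/set_mem //].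
    exact/mem_set.
  rewrite -h//.
  - by apply: eq_integral => t _; rewrite /f ger0_norm ?ler0n.
  - move=> A B mA mB; rewrite fE; apply: sX; first by exists [set x | A ((x == sg)%:R)]; rewrite ?setTI.
    by have := mD sg measurableT B mB; rewrite setTI.
  - by move=> x; exact: sqr_ge0.
have -> : (\int[P]_t (quad_dev M v (fun i => X (s t i) t) ^+ 2)%:E =
    \sum_(sg : 'S_n) \int[P]_t (f sg t * D M sg t ^+ 2)%:E)%E.
  rewrite -ge0_integral_sum//.
  - apply: eq_integral => t _; rewrite sumEFin (bigD1 (s t))//= big1 ?addr0 => [|sg].
      by rewrite /f eqxx mul1r.
    by rewrite /f eq_sym => /negbTE ->; rewrite mul0r.
  - by move=> sg; apply/measurable_EFinP; apply: measurable_funM => //; exact: measurable_funX.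
  - by move=> sg t _; rewrite lee_fin mulr_ge0 ?ler0n ?sqr_ge0.
under eq_bigr do rewrite E; rewrite sumEFin lee_fin -mulr_sumr.
have nf : 0 < n`!%:R :> R by rewrite ltr0n fact_gt0.
rewrite ler_pdivrMl//.
apply: (@le_trans _ _ (\sum_(sg : 'S_n) (4 * K * (\sum_k \sum_l M k l ^+ 2) +
    2 * (\sum_k M k k * (w (sg k) - v)) ^+ 2))).
  by apply: ler_sum => sg _; case: (D_second_moment M sg).
rewrite big_split/= sumr_const -mulr_sumr (_ : #|_| = n`!); last exact: card_Sn.
have [n0|n0] := posnP n.
  rewrite [X in _ + 2 * X <= _]big1 => [|sg _]; last first.
    rewrite big1 ?expr0n// => k; exfalso; case: k => k; by rewrite {1}n0.
  rewrite [X in 4 * K * X]big1 ?mulr0 ?mul0rn ?addr0 ?big1 ?mulr0//;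
    by move=> k; exfalso; case: k => k; rewrite {1}n0.
have n0R : 0 < n%:R :> R by rewrite ltr0n.
have vb : 0 <= v <= 1 + K.
  rewrite /v mulr_ge0 ?invr_ge0 ?sumr_ge0//=; last by move=> k _; have /andP[] := w_bounds k.
  rewrite ler_pdivrMl// mulr_natl -[n in leRHS]card_ord -sumr_const.
  by apply: ler_sum => k _; have /andP[] := w_bounds k.
have u0 : \sum_i (w i - v) = 0.
  by rewrite sumrB sumr_const card_ord -mulr_natl /v mulVKf ?gt_eqF// subrr.
have uC i : (w i - v) ^+ 2 <= (1 + K) ^+ 2.
  have /andP[h1 h2] := vb; have /andP[h3 h4] := w_bounds i.
  move: (w i) (v) h1 h2 h3 h4 => a b h1 h2 h3 h4.
  have h : 0 <= (1 + K - (a - b)) * (1 + K + (a - b)) by apply: mulr_ge0; lra.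
  by nra.
have := perm_average_sqr_le (fun k => M k k) u0 uC.
have MM : \sum_k M k k ^+ 2 <= \sum_k \sum_l M k l ^+ 2.
  by apply: ler_sum => k _; rewrite (bigD1 k)//= lerDl sumr_ge0// => l _; exact: sqr_ge0.
have M0 : 0 <= \sum_k M k k ^+ 2 by apply: sumr_ge0 => k _; exact: sqr_ge0.
move: (\sum_(sg : 'S_n) _) (\sum_k M k k ^+ 2) (\sum_k \sum_l _) MM M0 => a b c bc b0 ha.
rewrite -[_ *+ n`!]mulr_natl.
have h2 : 2 * (1 + K) ^+ 2 * n`!%:R * b <= 2 * (1 + K) ^+ 2 * n`!%:R * c.
  apply: ler_wpM2l => //; apply: mulr_ge0; last exact: ltW.
  by apply: mulr_ge0 => //; exact: sqr_ge0.
move: h2 ha; lra.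
Qed.

End permuted_quadratic_form.

Lemma uniform_perm_measurable d (T : measurableType d) (R : realType)
    (P : probability T R) n (s : T -> 'S_n) (U : set 'S_n) :
  uniform_perm P s -> measurable (s @^-1` U).
Proof.
move=> s_unif; have -> : s @^-1` U = \bigcup_(sg in U) s @^-1` [set sg].
  by apply/seteqP; split=> [t Ut|t [sg Us /= ->//]]; exists (s t).
apply: fin_bigcup_measurable => [|sg _]; first exact: finite_finset.
by have [] := s_unif sg.
Qed.

Section permuted_columns.
Context d (T : measurableType d) (R : realType) (P : probability T R).
Variables (n p : nat) (X : 'I_n -> 'I_p -> T -> R) (s : 'I_p -> T -> 'S_n).
Hypothesis mX : forall i j, measurable_fun setT (X i j).
Let FX (ij : 'I_n * 'I_p) := sigma_RV (X ij.1 ij.2).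

Let Fm ij : FX ij `<=` measurable. Proof. exact: sigma_RV_measurable. Qed.
Let FT ij : FX ij setT. Proof. exact: sigma_RV_setT. Qed.
Let FI ij : setI_closed (FX ij). Proof. exact: sigma_RV_setI. Qed.

Hypothesis Xind : mutually_independent P FX.

Lemma independent_columns_entries :
  independent_columns P (fun t => \matrix_(i, j) X i j t).
Proof.
apply: (@independent_columns_grouping _ _ _ P _ FX n p snd Fm FT FI Xind).
move=> i j A mA; apply: sub_sigma_algebra; exists (i, j) => //.
by exists A => //; rewrite setTI; apply/seteqP; split => t; rewrite /= mxE.
Qed.

Hypothesis s_unif : forall j, uniform_perm P (s j).
Hypothesis s_ind : mutually_independent P (fun j => sigma_discrete (s j)).
Hypothesis sX : independent_families P
  (sigma_joint (fun j => sigma_discrete (s j))) (sigma_joint FX).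

(** Permutations and entries form one independent family over a sum type, so that the sources of a
    permuted column are its permutation together with its entries. *)
Let F (a : 'I_p + 'I_n * 'I_p) : set (set T) :=
  match a with inl j => sigma_discrete (s j) | inr ij => FX ij end.

Let col (a : 'I_p + 'I_n * 'I_p) := match a with inl j => j | inr ij => ij.2 end.

Let F_ind : mutually_independent P F.
Proof.
move=> J E FE.
pose Js : {set 'I_p} := [set j | inl j \in J]%SET.
pose JX : {set 'I_n * 'I_p} := [set ij | inr ij \in J]%SET.
have JsE j : j \in Js = (inl j \in J) by rewrite finset.inE.
have JXE ij : ij \in JX = (inr ij \in J) by rewrite finset.inE.
have -> : \bigcap_(a in [set` J]) E a =
    (\bigcap_(j in [set` Js]) E (inl j)) `&` (\bigcap_(ij in [set` JX]) E (inr ij)).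
  apply/seteqP; split=> [t h|t [h1 h2] [j|ij] /= aJ].
  - by split=> a /= aJ; apply: h; rewrite /= -?JsE -?JXE.
  - by apply: h1; rewrite /= JsE.
  - by apply: h2; rewrite /= JXE.
have mem (I : finType) (L : {set I}) (G : I -> set (set T)) (E' : I -> set T) :
    (forall i, i \in L -> G i (E' i)) -> sigma_joint G (\bigcap_(i in [set` L]) E' i).
  move=> GE; pose S := g_sigma_algebraType (\bigcup_i G i).
  have : @measurable _ S (\bigcap_(i in [set` L]) E' i).
    apply: fin_bigcap_measurable => // i iL.
    by apply: sub_sigma_algebra; exists i => //; exact: GE.
  by [].
rewrite sX; [|by apply: mem => j; rewrite JsE => /FE|by apply: mem => ij; rewrite JXE => /FE].
rewrite s_ind; last by move=> j; rewrite JsE => /FE.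
rewrite Xind; last by move=> ij; rewrite JXE => /FE.
rewrite [RHS]big_mkcond/= big_sumType/= -!big_mkcond/=.
by congr (_ * _)%E; apply: eq_bigl => ?; rewrite ?JsE ?JXE.
Qed.

Lemma independent_permuted_columns :
  independent_columns P (fun t => \matrix_(i, j) X (s j t i) j t).
Proof.
apply: (@independent_columns_grouping _ _ _ P _ F n p col _ _ _ F_ind).
- move=> [j|ij] /=; last exact: Fm.
  by move=> _ [U _ <-]; rewrite setTI; exact: (uniform_perm_measurable _ (s_unif j)).
- by move=> [j|ij] /=; [exists setT; rewrite ?preimage_setT ?setTI|exact: FT].
- move=> [j|ij] /=; last exact: FI.
  move=> _ _ [U _ <-] [V _ <-]; exists (U `&` V) => //.
  by rewrite preimage_setI setIACA setIid.
move=> i j A mA; set G := \bigcup_(a in _) _.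
pose S := g_sigma_algebraType G.
(* An entry with a random row index is a sum over all rows weighted by indicators, which exhibits it
   as a function of [s j] and of the entries of column [j]. *)
have mf m : @measurable_fun _ _ S R setT (fun t => (s j t i == m)%:R * X m j t).
  apply: measurable_funM.
    move=> _ B mB; rewrite setTI; apply: sub_sigma_algebra; exists (inl j) => //=.
    by exists [set x | B ((x i == m)%:R)]; rewrite ?setTI.
  move=> _ B mB; rewrite setTI; apply: sub_sigma_algebra; exists (inr (m, j)) => //=.
  by exists B; rewrite ?setTI.
have mS : @measurable_fun _ _ S R setT (fun t => \sum_m (s j t i == m)%:R * X m j t).
  exact: measurable_sum.
rewrite (_ : (fun t => _) = (fun t => \sum_m (s j t i == m)%:R * X m j t)).
  by have := mS measurableT A mA; rewrite setTI.
apply/funext => t; rewrite mxE (bigD1 (s j t i))//= eqxx mul1r big1 ?addr0// => m.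
by rewrite eq_sym => /negbTE ->; rewrite mul0r.
Qed.

Lemma measurable_permuted_entry i j :
  measurable_fun setT (fun t => X (s j t i) j t).
Proof.
have -> : (fun t => X (s j t i) j t) = (fun t => \sum_m (s j t i == m)%:R * X m j t).
  apply/funext => t; rewrite (bigD1 (s j t i))//= eqxx mul1r big1 ?addr0// => m.
  by rewrite eq_sym => /negbTE ->; rewrite mul0r.
apply: measurable_sum => m; apply: measurable_funM => // _ B mB.
by rewrite setTI (_ : _ @^-1` _ = s j @^-1` [set x | B ((x i == m)%:R)])//; exact: (uniform_perm_measurable _ (s_unif j)).
Qed.

End permuted_columns.

(** * Gaussian moments *)

Section integral_density.
Context d (T : measurableType d) (R : realType).
Variables (mu nu : {measure set T -> \bar R}) (g : T -> R).
Hypothesis mg : measurable_fun setT g.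
Hypothesis g0 : forall x, 0 <= g x.
Hypothesis nuE : forall A, measurable A -> (nu A = \int[mu]_(x in A) (g x)%:E)%E.
Import HBNNSimple.

Let integral_density_nnsfun (f : {nnsfun T >-> R}) :
  (\int[nu]_x (f x)%:E = \int[mu]_x ((f x)%:E * (g x)%:E))%E.
Proof.
have mgE : measurable_fun setT (fun x => (g x)%:E) by exact/measurable_EFinP.
under [LHS]eq_integral do rewrite fimfunE -fsumEFin//.
rewrite [LHS]ge0_integral_fsum//; last 2 first.
- by move=> r; exact/measurable_EFinP/measurableT_comp.
- by move=> n x _; rewrite EFinM nnfun_muleindic_ge0.
under [RHS]eq_integral.
  move=> x xD; rewrite fimfunE -fsumEFin// ge0_mule_fsuml; last first.
    by move=> r; rewrite EFinM nnfun_muleindic_ge0.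
  over.
rewrite [RHS]ge0_integral_fsum//; last 2 first.
- move=> r; apply: emeasurable_funM => //.
  by apply/measurable_EFinP/measurableT_comp.
- move=> n x _; apply: mule_ge0; last by rewrite lee_fin.
  by rewrite EFinM nnfun_muleindic_ge0.
apply: eq_fsbigr => r _.
have [r0|r0] := leP 0 r; last first.
  rewrite (_ : f @^-1` [set r] = set0); last first.
    by apply/seteqP; split=> // x /= fx; move: r0; rewrite -fx ltNge fun_ge0.
  under eq_integral do rewrite indic0 mulr0.
  under [RHS]eq_integral do rewrite indic0 mulr0 mul0e.
  by rewrite !integral0.
under eq_integral do rewrite EFinM.
under [RHS]eq_integral do rewrite EFinM -muleA.
rewrite !ge0_integralZl//; last 3 first.
- apply: emeasurable_funM => //; exact/measurable_EFinP.
- by move=> x _; rewrite mule_ge0 ?lee_fin.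
- exact/measurable_EFinP.
congr (_ * _)%E; rewrite integral_indic// setIT nuE// [LHS]integral_mkcond.
apply: eq_integral => x _; rewrite patchE indicE.
by case: (x \in _); rewrite ?mul1e ?mul0e.
Qed.

Lemma integral_density (f : T -> \bar R) : measurable_fun setT f ->
  (forall x, 0 <= f x)%E -> (\int[nu]_x f x = \int[mu]_x (f x * (g x)%:E))%E.
Proof.
move=> mf f0; pose f_ := nnsfun_approx measurableT mf.
have mgE : measurable_fun setT (fun x => (g x)%:E) by exact/measurable_EFinP.
transitivity (lim (\int[nu]_x (f_ n x)%:E @[n --> \oo])%E).
  rewrite -monotone_convergence//=.
  - apply: eq_integral => ? /[!inE] xD; apply/esym/cvg_lim => //=.
    exact: cvg_nnsfun_approx.
  - by move=> n; exact/measurable_EFinP/measurable_funTS.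
  - by move=> n ? _; rewrite lee_fin.
  - by move=> ? _ ? ? mn; rewrite lee_fin; exact/lefP/nd_nnsfun_approx.
under eq_fun do rewrite integral_density_nnsfun.
rewrite -monotone_convergence//=.
- apply: eq_integral => x /[!inE] xD; apply/cvg_lim => //=.
  by apply: cvgeZr => //; exact: cvg_nnsfun_approx.
- by move=> n; apply: emeasurable_funM => //; exact/measurable_EFinP/measurable_funTS.
- by move=> n ? _; rewrite mule_ge0 ?lee_fin.
- move=> x _ ? ? mn; rewrite lee_wpmul2r ?lee_fin//; exact/lefP/nd_nnsfun_approx.
Qed.

End integral_density.

Section gaussian_moments.
Context d (T : measurableType d) (R : realType) (P : probability T R).
Variables (X : T -> R) (v : R).
Hypothesis mX : measurable_fun setT X.
Hypothesis v0 : 0 < v.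
Hypothesis X_law : forall B, measurable B ->
  P (X @^-1` B) = normal_prob 0 (Num.sqrt v) B.

(* The ratio of the densities of N(m, r^2 v) and N(0, v) integrates to 1. *)
Lemma gaussian_tilt (m r : R) : 0 < r ->
  (\int[P]_t (expR ((X t ^+ 2 - (X t - m) ^+ 2 / r ^+ 2) / (2 * v)))%:E = r%:E)%E.
Proof.
move=> r0; set s := Num.sqrt v; have s0 : 0 < s by rewrite sqrtr_gt0.
have s2 : s ^+ 2 = v by rewrite sqr_sqrtr// ltW.
pose X' : {mfun T >-> measurableTypeR R} :=
  HB.pack X (isMeasurableFun.Build _ _ _ (measurableTypeR R) X mX).
pose k (x : measurableTypeR R) : R := expR ((x ^+ 2 - (x - m) ^+ 2 / r ^+ 2) / (2 * v)).
have mk : measurable_fun [set: measurableTypeR R] k.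
  apply: (measurableT_comp (f := @expR R)); first exact: measurable_expR.
  apply: measurable_funM; last exact: measurable_cst.
  apply: measurable_funB; first exact: measurable_funX.
  apply: measurable_funM; last exact: measurable_cst.
  by apply: measurable_funX; exact: measurable_funB.
have mkE : measurable_fun [set: measurableTypeR R] (EFin \o k) by exact/measurable_EFinP.
have k0 x : (0 <= (EFin \o k) x)%E by rewrite lee_fin expR_ge0.
transitivity (\int[distribution P X']_y (EFin \o k) y)%E.
  by rewrite (ge0_integral_distribution X' mkE k0).
transitivity (\int[normal_prob 0 s]_y (EFin \o k) y)%E.
  by apply: eq_measure_integral => A mA _; exact: X_law.
rewrite (@integral_density _ _ _ lebesgue_measure _ (normal_pdf 0 s))//; last 2 first.
- exact: measurable_normal_pdf.
- by move=> x; exact: normal_pdf_ge0.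
transitivity (\int[lebesgue_measure]_x (r%:E * (normal_pdf m (r * s) x)%:E))%E; last first.
  rewrite ge0_integralZl//; last 3 first.
  - by apply/measurable_EFinP; exact: measurable_normal_pdf.
  - by move=> x _; rewrite lee_fin normal_pdf_ge0.
  - by rewrite lee_fin ltW.
  by rewrite integral_normal_pdf mule1.
apply: eq_integral => x _; rewrite -!EFinM !normal_pdfE ?gt_eqF ?mulr_gt0//.
congr EFin; rewrite /normal_peak /normal_fun /k.
rewrite mulrCA -expRD mulrA; congr (_ * expR _); last first.
  by rewrite subr0 exprMn s2 -[v *+ 2]mulr_natl -[(_ * v) *+ 2]mulr_natl; field; rewrite !gt_eqF.
have -> : (r * s) ^+ 2 * pi *+ 2 = r ^+ 2 * (s ^+ 2 * pi *+ 2).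
  by ring.
by rewrite sqrtrM ?sqr_ge0// sqrtr_sqr gtr0_norm// invfM mulrA divff ?gt_eqF// mul1r.
Qed.

Let le0_of_le_small (x c : R) : 0 <= c -> (forall h, 0 < h < 1 -> x <= c * h) -> x <= 0.
Proof.
move=> c0 h; rewrite leNgt; apply/negP => x0.
have c1 : 0 < c + x + 1 by rewrite ltr_wpDl// addr_ge0// ltW.
(* This [h] lies between 0 and 1, and [c * h < x] for it. *)
have := h (x / (c + x + 1)); rewrite divr_gt0//= ltr_pdivrMr// mul1r.
have -> : x < c + x + 1 by lra.
move=> /(_ isT); rewrite mulrA ler_pdivlMr// => h1.
have : 0 < x * (x + 1) by rewrite mulr_gt0// addr_gt0.
by move: h1; nra.
Qed.

(** A tilt by [m = v * a] at scale 1: the exponent is [a * X - v * a^2 / 2]. *)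
Let expR_mgf (a : R) : P.-integrable setT (EFin \o (fun t => expR (a * X t))) /\
  \int[P]_t expR (a * X t) = expR (v * a ^+ 2 / 2).
Proof.
have E t : expR (a * X t) = expR (v * a ^+ 2 / 2) *
    expR ((X t ^+ 2 - (X t - v * a) ^+ 2 / 1 ^+ 2) / (2 * v)).
  by rewrite -expRD; congr expR; field; rewrite gt_eqF.
have me : measurable_fun setT (fun t => expR ((X t ^+ 2 - (X t - v * a) ^+ 2 / 1 ^+ 2) / (2 * v))).
  apply: (measurableT_comp (f := @expR R)); first exact: measurable_expR.
  apply: measurable_funM; last exact: measurable_cst.
  apply: measurable_funB; first exact: measurable_funX.
  apply: measurable_funM; last exact: measurable_cst.
  by apply: measurable_funX; exact: measurable_funB.
have h := gaussian_tilt (v * a) ltr01.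
have i : P.-integrable setT
    (EFin \o (fun t => expR ((X t ^+ 2 - (X t - v * a) ^+ 2 / 1 ^+ 2) / (2 * v)))).
  apply/integrableP; split; first exact/measurable_EFinP.
  under eq_integral do rewrite gee0_abs ?lee_fin ?expR_ge0//.
  by rewrite h ltry.
under eq_Rintegral do rewrite E.
split; last by rewrite RintegralZl// /Rintegral h mulr1.
apply: eq_integrable (integrable_EFinZ (expR (v * a ^+ 2 / 2)) i) => // t _.
by rewrite /= -E.
Qed.

(** The exponential moments at 1 and [-1] dominate the fourth power. The bound is crude but
    increasing in [v], hence uniform over bounded variances. *)
Lemma gaussian_fourth_moment : P.-integrable setT (EFin \o (fun t => X t ^+ 4)) /\
  \int[P]_t (X t ^+ 4) <= 48 * expR (v / 2).
Proof.
have [i1 e1] := expR_mgf 1; have [i2 e2] := expR_mgf (-1).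
have i3 : P.-integrable setT (EFin \o (fun t => 24 * (expR (1 * X t) + expR (-1 * X t)))).
  by apply: integrable_EFinZ; exact: integrable_EFinD.
have b t : X t ^+ 4 <= 24 * (expR (1 * X t) + expR (-1 * X t)).
  by rewrite mul1r mulN1r; exact: pow4_le_expR.
have i4 : P.-integrable setT (EFin \o (fun t => X t ^+ 4)).
  apply: integrable_dominated i3; first exact: measurable_funX.
  by move=> t; rewrite ger0_norm// (exprM _ 2 2) sqr_ge0.
split => //; apply: (@le_trans _ _ (\int[P]_t (24 * (expR (1 * X t) + expR (-1 * X t))))).
  exact: le_Rintegral.
rewrite RintegralZl//; last exact: integrable_EFinD.
by rewrite RintegralD// e1 e2 sqrrN expr1n mulr1; lra.
Qed.

Let X2_integrable : P.-integrable setT (EFin \o (fun t => X t ^+ 2)).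
Proof. by have [] := second_moment_bounds mX gaussian_fourth_moment.1. Qed.

Let X_integrable : P.-integrable setT (EFin \o X).
Proof.
apply: (@integrable_dominated _ _ _ _ _ (fun t => 1 + X t ^+ 2)) => //.
  move=> t; rewrite ler_norml.
  have h1 := sqr_ge0 (X t - 2^-1); have h2 := sqr_ge0 (X t + 2^-1).
  by move: (X t) h1 h2 => a h1 h2; apply/andP; split; nra.
by apply: integrable_EFinD; first exact: integrable_EFin_cst.
Qed.

(** From [1 + a * m <= expR (v * a^2 / 2)], the quantity [a * m] is at most of order [a^2]; letting
    [a] tend to 0 through both signs gives [m = 0]. *)
Lemma gaussian_mean : \int[P]_t X t = 0.
Proof.
set m := \int[P]_t X t.
have bd a : a ^+ 2 <= 1 -> a * m <= v / 2 * expR (v / 2) * a ^+ 2.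
  move=> a1; have [ia ea] := expR_mgf a.
  have h1 : 1 + a * m <= expR (v * a ^+ 2 / 2).
    rewrite -ea -[X in X + _](Rintegral_prob_cst P) -RintegralZl// -RintegralD//; last 2 first.
    - exact: integrable_EFin_cst.
    - exact: integrable_EFinZ.
    apply: le_Rintegral => //.
      by apply: integrable_EFinD; [exact: integrable_EFin_cst|exact: integrable_EFinZ].
    by move=> t _; exact: expR_ge1Dx.
  set u := v * a ^+ 2 / 2 in h1.
  have a2 : 0 <= a ^+ 2 := sqr_ge0 a.
  have u0 : 0 <= u by rewrite /u divr_ge0// mulr_ge0// ltW.
  have uv : u <= v / 2 by rewrite /u ler_pM2r// ler_piMr// ltW.
  have h2 : expR u - 1 <= u * expR u.
    have := expR_ge1Dx (- u); rewrite -(ler_pM2r (expR_gt0 u)) -expRD addNr expR0.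
    by move: (expR u) => e; nra.
  have h3 : u * expR u <= u * expR (v / 2) by rewrite ler_wpM2l// ler_expR.
  have -> : v / 2 * expR (v / 2) * a ^+ 2 = u * expR (v / 2) by rewrite /u; ring.
  lra.
have c0 : 0 <= v / 2 * expR (v / 2) by rewrite mulr_ge0 ?expR_ge0// divr_ge0// ltW.
have sq (h : R) : 0 < h < 1 -> h ^+ 2 <= 1 by move=> /andP[h0 h1]; rewrite expr_le1// ltW.
apply/eqP; rewrite eq_le; apply/andP; split.
  apply: (le0_of_le_small c0) => h hh; have := bd h (sq h hh).
  by case/andP: hh => h0 _; rewrite expr2 mulrA mulrC ler_pM2r.
rewrite -oppr_le0; apply: (le0_of_le_small c0) => h hh.
have := bd (- h); rewrite sqrrN => /(_ (sq h hh)).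
by case/andP: hh => h0 _; rewrite expr2 mulrA mulNr -mulrN mulrC ler_pM2r.
Qed.

(** A change of scale gives [E expR (b * X^2) = r] with [b = (1 - r^-2) / (2 v)]. Hence
    [1 + b * S <= r], and [r] tending to 1 from above and from below bounds [S] on both sides. *)
Lemma gaussian_variance : \int[P]_t (X t ^+ 2) = v.
Proof.
set S := \int[P]_t (X t ^+ 2).
have bd r : 0 < r -> (r - 1) * ((r + 1) * S) <= (r - 1) * (2 * v * r ^+ 2).
  move=> r0; have h := gaussian_tilt 0 r0.
  pose b := (1 - r ^- 2) / (2 * v).
  have E t : expR ((X t ^+ 2 - (X t - 0) ^+ 2 / r ^+ 2) / (2 * v)) = expR (b * X t ^+ 2).
    by congr expR; rewrite subr0 /b; ring.
  have ib : P.-integrable setT (EFin \o (fun t => expR (b * X t ^+ 2))).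
    apply/integrableP; split.
      apply/measurable_EFinP/(measurableT_comp (f := @expR R)); first exact: measurable_expR.
      by apply: measurable_funM => //; exact: measurable_funX.
    under eq_integral do rewrite /= ger0_norm ?expR_ge0// -E.
    by rewrite h ltry.
  have h1 : 1 + b * S <= r.
    have -> : r = \int[P]_t expR (b * X t ^+ 2).
      by rewrite /Rintegral; under eq_integral do rewrite -E; rewrite h.
    rewrite -[X in X + _](Rintegral_prob_cst P) -RintegralZl// -RintegralD//; last 2 first.
    - exact: integrable_EFin_cst.
    - exact: integrable_EFinZ.
    apply: le_Rintegral => //.
      by apply: integrable_EFinD; [exact: integrable_EFin_cst|exact: integrable_EFinZ].
    by move=> t _; exact: expR_ge1Dx.
  have r2 : 0 < 2 * v * r ^+ 2 by rewrite !mulr_gt0// exprn_gt0.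
  have e : b * S * (2 * v * r ^+ 2) = (r - 1) * ((r + 1) * S).
    by rewrite /b; field; rewrite !gt_eqF.
  by rewrite -e ler_pM2r// lerBrDl.
have S0 : 0 <= S by apply: Rintegral_ge0 => t _; exact: sqr_ge0.
have v3 : 0 <= 3 * v by rewrite mulr_ge0// ltW.
apply/eqP; rewrite eq_le; apply/andP; split.
  rewrite -subr_le0; apply: (le0_of_le_small v3) => h /andP[h0 h1].
  have := bd (1 + h); rewrite addr_gt0// => /(_ isT).
  by rewrite addrAC subrr add0r ler_pM2l//; nra.
rewrite -subr_le0; apply: (le0_of_le_small v3) => h /andP[h0 h1].
have := bd (1 - h); rewrite subr_gt0 h1 => /(_ isT).
have -> : 1 - h - 1 = - h by ring.
by rewrite !mulNr lerN2 ler_pM2l//; nra.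
Qed.

End gaussian_moments.

(** * Empirical spectral measures *)

Section empirical_measures.
Variable R : realType.
Implicit Types (s : seq R) (f : R -> R).

Lemma ge0_integral_empirical s f : measurable_fun setT f -> (forall x, 0 <= f x) ->
  (\int[empirical_measure s]_x (f x)%:E = ((size s)%:R^-1 * \sum_(x <- s) f x)%:E)%E.
Proof.
move=> mf f0; have mfE : measurable_fun setT (EFin \o f) by exact/measurable_EFinP.
have f0E x : setT x -> (0 <= (EFin \o f) x)%E by rewrite /= lee_fin.
rewrite (ge0_integral_mscale _ _ _ mfE f0E)// ge0_integral_measure_sum//.
rewrite EFinM (big_nth 0) big_mkord -sumEFin; congr (_ * _)%E; apply: eq_bigr => k _.
by rewrite integral_dirac// diracT mul1e.
Qed.

Lemma Rintegral_empirical s f : measurable_fun setT f ->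
  \int[empirical_measure s]_x f x = (size s)%:R^-1 * \sum_(x <- s) f x.
Proof.
move=> mf; rewrite /Rintegral integralE.
have mp : measurable_fun setT (fun x => Num.max (f x) 0) by exact: measurable_maxr.
have mn : measurable_fun setT (fun x => Num.max (- f x) 0).
  by apply: measurable_maxr => //; exact: measurableT_comp.
have pE : ((fun x => (f x)%:E)^\+)%E = EFin \o (fun x => Num.max (f x) 0).
  by apply/funext => x; rewrite funeposE /= EFin_max.
have nE : ((fun x => (f x)%:E)^\-)%E = EFin \o (fun x => Num.max (- f x) 0).
  by apply/funext => x; rewrite funenegE /= EFin_max.
rewrite pE nE.
rewrite !ge0_integral_empirical//; last 2 first.
- by move=> x; rewrite le_max lexx orbT.
- by move=> x; rewrite le_max lexx orbT.
rewrite -EFinB /= -mulrBr -sumrB; congr (_ * _); apply: eq_bigr => x _.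
have [x0|x0] := leP (f x) 0; rewrite /Num.max.
  by rewrite oppr_lt0 ltNge x0 /= sub0r opprK.
by rewrite oppr_lt0 x0 subr0.
Qed.

Lemma empirical_measure_supp s (A : set R) : measurable A -> (0 < size s)%N ->
  (forall x, x \in s -> A x) -> empirical_measure s A = 1%E.
Proof.
move=> mA s0 sA; rewrite -[A in LHS]setIT -integral_indic//.
rewrite ge0_integral_empirical; [|exact: measurable_indic|by move=> x; rewrite indicE ler0n].
rewrite (eq_big_seq (fun=> 1)) => [|x xs]; last by rewrite indicE mem_set//; exact: sA.
rewrite big_const_seq count_predT iter_addr_0 mulVf//.
by rewrite pnatr_eq0 -lt0n.
Qed.

Lemma empirical_probability s : {Q : probability R R | (0 < size s)%N ->
  forall A, Q A = empirical_measure s A}.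
Proof.
have [s0|s0] := ltnP 0 (size s); last by exists (\d_(0 : R)).
have e1 : empirical_measure s setT = 1%E by exact: empirical_measure_supp.
pose Q : probability R R := HB.pack
  (mscale (((size s)%:R^-1)%:nng : {nonneg R}) (msum (fun k => \d_(nth 0 s k)) (size s)))
  (Measure_isProbability.Build _ _ _ (empirical_measure s) e1).
by exists Q.
Qed.

Lemma Rintegral_eq_measure (mu nu : {measure set R -> \bar R}) f :
  (forall A, measurable A -> mu A = nu A) -> \int[mu]_x f x = \int[nu]_x f x.
Proof. by move=> h; congr fine; apply: eq_measure_integral => A mA _; exact: h. Qed.

Lemma cintegral_empirical s (f : R -> R[i]) : ccontinuous f ->
  cintegral (empirical_measure s) f = (size s)%:R^-1 * \sum_(x <- s) f x.
Proof.
move=> /ccontinuous_cmeasurable[f1 f2].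
have -> : (size s)%:R^-1 = ((size s)%:R^-1)%:C :> R[i] by rewrite fmorphV /= rmorph_nat.
by apply: complex_eq; rewrite /= ?cReMr ?cImMr Rintegral_empirical// ?cRe_sum ?cIm_sum.
Qed.

End empirical_measures.

(** * Convergence of spectral distributions *)

Section gram_matrices.
Variables (R : realType) (gamma C : R) (H : probability R R).
Variables (p : nat -> nat) (A : forall n, 'M[R]_(n, p n)) (v : forall n, 'I_(p n) -> R).
Hypothesis gamma_gt0 : 0 < gamma.
Hypothesis C0 : 0 <= C.
Hypothesis p_oo : p n @[n --> \oo] --> \oo.
Hypothesis p_ratio : ((p n)%:R / n%:R : R) @[n --> \oo] --> gamma.
Hypothesis v_bounds : forall n j, 0 <= @v n j <= C.
Hypothesis v_cvg : weakly_converges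
  (fun n => empirical_measure [seq @v n j | j <- enum 'I_(p n)]) H.
Hypothesis defect_cvg : forall q r : rat, 0 < ratr r :> R ->
  normc (MP_defect (ratr q +i* ratr r) (@v n) (A n)) @[n --> \oo] --> (0 : R).

(** Deterministic: for one realization, [MP_defect] is rewritten as the defect of the equation for
    the spectral distribution, with [H_ n] the empirical distribution of the variances. *)
Lemma esd_gram_cvg : exists mu : probability R R, generalized_MP gamma H mu /\
  weakly_converges (fun n => esd (A n *m (A n)^T)) mu.
Proof.
pose ev n := eigenvalues (A n *m (A n)^T); pose vs n := [seq @v n j | j <- enum 'I_(p n)].
have evn n : size (ev n) = n.
  by apply: size_eigenvalues; rewrite trmx_mul trmxK.
have vsn n : size (vs n) = p n by rewrite size_map size_enum_ord.
(* An empty list has the zero measure as empirical measure; the Dirac mass at 0 takes its place,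
   which affects only finitely many sizes. *)
have ex s (B : set R) : measurable B -> B 0 -> (forall x, x \in s -> B x) ->
    exists Q : probability R R, Q B = 1%E /\
    ((0 < size s)%N -> forall A, Q A = empirical_measure s A).
  move=> mB B0 sB; have [s0|s0] := ltnP 0 (size s); last first.
    exists [the probability R R of \d_(0 : R)]; split => //.
    by rewrite /= diracE mem_set.
  have [Q hQ] := empirical_probability s; exists Q; split; last by move=> _; exact: hQ.
  by rewrite hQ// empirical_measure_supp.
have /choice[mu_ mu_P] n : exists Q : probability R R, Q `[0, +oo[%classic = 1%E /\
    ((0 < size (ev n))%N -> forall A, Q A = empirical_measure (ev n) A).
  apply: ex => //= [|x xe]; first by rewrite in_itv/= lexx.
  by rewrite in_itv/= andbT (eigenvalues_gram_ge0 xe).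
have /choice[H_ H_P] n : exists Q : probability R R, Q `[0, C]%classic = 1%E /\
    ((0 < size (vs n))%N -> forall A, Q A = empirical_measure (vs n) A).
  apply: ex => //= [|x /mapP[j _ ->]]; first by rewrite in_itv/= lexx.
  by rewrite in_itv/=; exact: v_bounds.
have n_gt0 : \forall n \near \oo, (0 < n)%N by exact: nbhs_infty_gt.
have p_gt0 : \forall n \near \oo, (0 < p n)%N by exact: (p_oo (nbhs_infty_gt 0)).
have H_cvg f : continuous f -> bounded_fun f ->
    \int[H_ n]_x f x @[n --> \oo] --> \int[H]_x f x.
  move=> cf bf; apply: cvg_trans (v_cvg cf bf); apply: near_eq_cvg.
  apply: filterS p_gt0 => n pn; apply: Rintegral_eq_measure => B _.
  by apply/esym; apply: (H_P n).2; rewrite vsn.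
have dc (q r : rat) : 0 < ratr r :> R -> let z : R[i] := ratr q +i* ratr r in
    normc (1 + z * stieltjes (mu_ n) z - ((p n)%:R / n%:R)%:C *
      (stieltjes (mu_ n) z * MP_integral (H_ n) (stieltjes (mu_ n) z)))
      @[n --> \oo] --> (0 : R).
  move=> r0 z; have z0 : 0 < Im z by [].
  apply: cvg_trans (defect_cvg q r0); apply: near_eq_cvg.
  apply: filterS2 n_gt0 p_gt0 => n n0 pn; congr normc.
  have mE : stieltjes (mu_ n) z = gram_stieltjes z (A n).
    rewrite /gram_stieltjes mxtrace_resolvent// mulrC -{2}(evn n).
    rewrite -cintegral_empirical; last exact: ccontinuous_stieltjes_kernel.
    by apply: complex_eq; apply: Rintegral_eq_measure => B _; apply: (mu_P n).2; rewrite evn.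
  have m0 : 0 < Im (gram_stieltjes z (A n)) by rewrite -mE; exact: Im_stieltjes_gt0.
  rewrite mE /MP_defect -/z; set m := gram_stieltjes z (A n).
  have -> : MP_integral (H_ n) m = (p n)%:R^-1 * \sum_j (@v n j)%:C / (1 + (@v n j)%:C * m).
    transitivity (cintegral (empirical_measure (vs n)) (fun t => t%:C / (1 + t%:C * m))).
      by apply: complex_eq; apply: Rintegral_eq_measure => B _; apply: (H_P n).2; rewrite vsn.
    rewrite cintegral_empirical; last exact: ccontinuous_MP_kernel.
    by rewrite vsn big_map big_enum.
  congr (_ - _); rewrite !mulr_sumr; apply: eq_bigr => j _.
  have pC : (p n)%:R != 0 :> R[i] by rewrite pnatr_eq0 -lt0n.
  have nC : n%:R != 0 :> R[i] by rewrite pnatr_eq0 -lt0n.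
  rewrite fmorph_div /= !rmorph_nat; field.
  by apply/and3P; split => //; exact: (neq0_1Dreal (@v n j) m0).
have [mu [MPmu mu_cvg]] := @MP_convergence R gamma C H mu_ H_ (fun n => (p n)%:R / n%:R)
  gamma_gt0 (fun n => (mu_P n).1) p_ratio H_cvg C0 (fun n => (H_P n).1) dc.
exists mu; split => // f cf bf; apply: cvg_trans (mu_cvg f cf bf).
apply: near_eq_cvg; apply: filterS n_gt0 => n n0.
by apply: Rintegral_eq_measure => B _; apply: (mu_P n).2; rewrite evn.
Qed.

End gram_matrices.

(** Rational points are countable, so a single null set is discarded and the deterministic statement
    applies to each remaining realization. The law may at this stage depend on the realization. *)
Lemma as_esd_gram_cvg d (T : measurableType d) (R : realType) (P : probability T R)
    (gamma C K : R) (H : probability R R) (p : nat -> nat)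
    (Y : forall n, T -> 'M[R]_(n, p n)) (v : forall n, 'I_(p n) -> R) :
  0 < gamma -> 0 <= C -> p n @[n --> \oo] --> \oo ->
  ((p n)%:R / n%:R : R) @[n --> \oo] --> gamma ->
  (forall n j, 0 <= @v n j <= C) ->
  weakly_converges (fun n => empirical_measure [seq @v n j | j <- enum 'I_(p n)]) H ->
  (forall n i j, measurable_fun setT (fun t => Y n t i j)) ->
  (forall n, independent_columns P (Y n)) ->
  (forall n (j : 'I_(p n)) (M : 'M[R]_n), (0 < n)%N ->
    (\int[P]_t (quad_dev M (@v n j) (fun i => Y n t i j) ^+ 2)%:E <=
     (K * \sum_k \sum_l M k l ^+ 2)%:E)%E) ->
  let B n t := (Num.sqrt n%:R)^-1 *: Y n t in
  {ae P, forall t, exists mu : probability R R, generalized_MP gamma H mu /\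
    weakly_converges (fun n => esd (B n t *m (B n t)^T)) mu}.
Proof.
move=> gamma0 C0 p_oo p_ratio vb v_cvg mY Yind Yquad B.
have [Kp pK] : exists Kp, forall n, (0 < n)%N -> (p n)%:R <= Kp * n%:R :> R.
  have /cvg_seq_bounded[M [_ hM]] : cvgn (fun n => (p n)%:R / n%:R : R) by apply/cvg_ex; exists gamma.
  exists (M + 1) => n n0; rewrite -ler_pdivrMr ?ltr0n//.
  by apply: le_trans (ler_norm _) _; apply: (hM (M + 1)) => //; rewrite ltrDl.
have v0 n (j : 'I_(p n)) : 0 <= @v n j by have /andP[] := vb n j.
have vC n (j : 'I_(p n)) : @v n j <= C by have /andP[] := vb n j.
pose Q (k : nat) t := if (unpickle k : option (rat * rat)) is Some (q, r) then
  0 < ratr r :> R -> normc (MP_defect (ratr q +i* ratr r) (@v n) (B n t)) @[n --> \oo] --> (0 : R)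
  else True.
have : {ae P, forall t, forall k, Q k t}.
  apply: ae_foralln => k; rewrite /Q; case: (unpickle k) => [[q r]|]; last exact: aeW.
  have [r0|r0] := boolP (0 < ratr r :> R); last first.
    by apply: aeW => t r1; exfalso; exact: (negP r0).
  have := @MP_defect_ae_cvg0 _ _ _ P p Y v C K Kp mY Yind v0 vC pK Yquad (ratr q +i* ratr r) r0.
  by apply: filterS => t h _.
apply: filterS => t h; apply: (@esd_gram_cvg _ gamma C H p (fun n => B n t) v) => // q r r0.
by have := h (pickle (q, r)); rewrite /Q pickleK; apply.
Qed.

Lemma esvd_cvg (R : realType) (p : nat -> nat) (A : forall n, 'M[R]_(n, p n))
    (mu : probability R R) (sq : {mfun R >-> R}) : sq =1 Num.sqrt ->
  weakly_converges (fun n => esd (A n *m (A n)^T)) mu ->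
  weakly_converges (fun n => esvd (A n)) (distribution mu sq).
Proof.
move=> sqE h f cf [b [_ fb]]; have {fb} fb x : `|f x| <= `|b| + 1.
  by apply: (fb (`|b| + 1)) => //; rewrite (le_lt_trans (ler_norm b))// ltrDl.
have mf : measurable_fun setT f by exact: continuous_measurable_fun.
have csq : continuous (fun x => f (Num.sqrt x)).
  by move=> x; apply: continuous_comp; [exact: sqrt_continuous|exact: cf].
have msq := continuous_measurable_fun csq.
have -> : \int[distribution mu sq]_x f x = \int[mu]_x f (Num.sqrt x).
  rewrite /Rintegral integral_distribution//; last 2 first.
  - exact/measurable_EFinP.
  - apply: (@integrable_bounded _ _ _ _ _ (`|b| + 1)) => [|x]; last exact: fb.
    by rewrite (_ : (fun x => f (sq x)) = (fun x => f (Num.sqrt x)))//; apply/funext => x; rewrite sqE.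
  by congr fine; apply: eq_integral => x _ /=; rewrite sqE.
have -> : (fun n => \int[esvd (A n)]_x f x) =
    (fun n => \int[esd (A n *m (A n)^T)]_x f (Num.sqrt x)).
  apply/funext => n; rewrite /esvd /esd !Rintegral_empirical//.
  by rewrite /singular_values size_map big_map.
apply: h => //; exists (`|b| + 1); split; first exact: num_real.
by move=> x /ltW bx y _; exact: le_trans (fb _) bx.
Qed.

Lemma centered_normal_moments d (T : measurableType d) (R : realType)
    (P : probability T R) (X : {RV P >-> R}) (v : R) : 0 <= v ->
  has_law X (centered_normal v) ->
  [/\ P.-integrable setT (EFin \o (fun t => X t ^+ 4)),
      \int[P]_t (X t ^+ 4) <= 48 * expR (v / 2),
      \int[P]_t X t = 0 & \int[P]_t (X t ^+ 2) = v].
Proof.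
move=> v0 Xlaw; have mX : measurable_fun setT X by [].
move: v0; rewrite le_eqVlt => /predU1P[v0|v0]; last first.
  have hl B : measurable B -> P (X @^-1` B) = normal_prob 0 (Num.sqrt v) B.
    by move=> mB; have := Xlaw B mB; rewrite /centered_normal gt_eqF.
  have [i4 b4] := gaussian_fourth_moment mX v0 hl.
  by split => //; [exact: gaussian_mean hl|exact: gaussian_variance hl].
(* The tilting identity divides by [v]; at [v = 0] the Dirac law gives the moments directly. *)
have X0 : {ae P, forall t, X t = 0}.
  exists (X @^-1` (~` [set 0])); split => //.
  - by rewrite -[X in measurable X]setTI; apply: mX => //; exact: measurableC.
  - have mc : measurable (~` [set (0 : R)]) by exact: measurableC.
    have := Xlaw _ mc; rewrite /centered_normal -v0 eqxx => h.
    by rewrite [LHS]h diracE memNset//= => /(_ erefl).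
have E (k : nat) : (0 < k)%N -> P.-integrable setT (EFin \o (fun t => X t ^+ k)) /\
    \int[P]_t (X t ^+ k) = 0.
  move=> k0; have aeE : ae_eq P setT (EFin \o (fun t => X t ^+ k)) (cst 0%E).
    by apply: filterS X0 => t Xt _; rewrite /= Xt expr0n gtn_eqF.
  have mk : measurable_fun setT (EFin \o (fun t => X t ^+ k)).
    by apply/measurable_EFinP; exact: measurable_funX.
  split.
    by apply/integrableP; split => //; rewrite (ae_eq_integral_abs _ measurableT mk).2// ltry.
  by rewrite /Rintegral (ae_eq_integral (cst 0%E))// integral0.
have [i4 e4] := E 4%N isT; split => //.
- by rewrite e4 mulr_ge0// expR_ge0.
- by have [_ <-] := E 1%N isT.
by have [_ ->] := E 2%N isT.
Qed.

Lemma ae_probability_ex d (T : measurableType d) (R : realType)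
    (P : probability T R) (Q : T -> Prop) :
  {ae P, forall t, Q t} -> exists t, Q t.
Proof.
move=> aeQ; apply: contrapT => nQ.
have hN : P.-negligible setT by apply: negligibleS aeQ => t _ /= Qt; apply: nQ; exists t.
have h : P setT = 0%E by apply/negligibleP.
by have := probability_setT P; rewrite h => /eqP; rewrite eq_sym onee_eq0.
Qed.

Section moments.
Context d (T : measurableType d) (R : realType) (P : probability T R).

Lemma abs_moment2E (X : {RV P >-> R}) :
  fine (abs_moment X 2) = \int[P]_t (X t ^+ 2).
Proof.
rewrite /abs_moment unlock; congr fine; apply: eq_integral => t _.
by rewrite real_normK ?num_real.
Qed.

Lemma abs_moment4_le (X : {RV P >-> R}) (K : R) : (abs_moment X 4 <= K%:E)%E ->
  P.-integrable setT (EFin \o (fun t => X t ^+ 4)) /\ \int[P]_t (X t ^+ 4) <= K.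
Proof.
move=> XK; have XK' : (\int[P]_t (X t ^+ 4)%:E <= K%:E)%E.
  move: XK; rewrite /abs_moment unlock; congr (_ <= _)%E; apply: eq_integral => t _.
  by rewrite (exprM _ 2 2) real_normK ?num_real// -exprM.
have i4 : P.-integrable setT (EFin \o (fun t => X t ^+ 4)).
  apply/integrableP; split; first by apply/measurable_EFinP; exact: measurable_funX.
  under eq_integral do rewrite /= ger0_norm ?exprn_even_ge0//.
  exact: le_lt_trans XK' (ltry _).
by split => //; rewrite -lee_fin EFin_Rintegral.
Qed.

Lemma mean_zeroE (X : {RV P >-> R}) : ('E_P[X] = 0)%E -> \int[P]_t X t = 0.
Proof. by rewrite unlock /Rintegral => ->. Qed.

End moments.
Theorem theorem3p10 (R : realType) (d : measure_display)
    (T : measurableType d) (P : probability T R)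
    (p : nat -> nat) (gamma : R) (H : probability R R)
    (N Nbar : forall n : nat, 'I_n -> 'I_(p n) -> {RV P >-> R})
    (s : forall n : nat, 'I_(p n) -> T -> 'S_n)
    (p_oo : p n @[n --> \oo] --> \oo)
    (gamma_gt0 : 0 < gamma)
    (p_ratio : ((p n)%:R / n%:R : R) @[n --> \oo] --> gamma)
    (N_indep : forall n, mutually_independent P
       (fun ij : 'I_n * 'I_(p n) => sigma_RV (N n ij.1 ij.2)))
    (N_mean : forall n i j, ('E_P[N n i j] = 0)%E)
    (N_moment4 : (ereal_sup [set x | exists n (i : 'I_n) (j : 'I_(p n)),
                    x = abs_moment (N n i j) 4] < +oo)%E)
    (s_uniform : forall n j, uniform_perm P (s n j))
    (s_indep : forall n, mutually_independent P
       (fun j : 'I_(p n) => sigma_discrete (s n j)))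
    (s_N_indep : forall n, independent_families P
       (sigma_joint (fun j : 'I_(p n) => sigma_discrete (s n j)))
       (sigma_joint (fun ij : 'I_n * 'I_(p n) => sigma_RV (N n ij.1 ij.2))))
    (Nbar_indep : forall n, mutually_independent P
       (fun ij : 'I_n * 'I_(p n) => sigma_RV (Nbar n ij.1 ij.2)))
    (Nbar_law : forall n i j,
       has_law (Nbar n i j) (centered_normal (column_variance (N n) j)))
    (v_cvg : weakly_converges
       (fun n => empirical_measure
          [seq column_variance (N n) j | j <- enum 'I_(p n)])
       H) :
  let A := fun n t => (Num.sqrt n%:R)^-1 *:
             permute_columns (fun j => s n j t) (matrix_of (N n) t) in
  let Abar := fun n t => (Num.sqrt n%:R)^-1 *: matrix_of (Nbar n) t in
  (exists nu : probability R R,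
     as_weakly_converges P (fun n t => esvd (A n t)) nu /\
     as_weakly_converges P (fun n t => esvd (Abar n t)) nu) /\
  (exists mu : probability R R,
     [/\ generalized_MP gamma H mu,
         as_weakly_converges P (fun n t => esd (A n t *m (A n t)^T)) mu &
         as_weakly_converges P
           (fun n t => esd (Abar n t *m (Abar n t)^T)) mu]).
Proof.
have N4 : exists2 K : R, 0 <= K & forall n i j,
    P.-integrable setT (EFin \o (fun t => N n i j t ^+ 4)) /\
    \int[P]_t (N n i j t ^+ 4) <= K.
  set S := ereal_sup _ in N_moment4; exists (Num.max (fine S) 0); first by rewrite le_max lexx orbT.
  move=> n i j; apply: abs_moment4_le.
  have XS : (abs_moment (N n i j) 4 <= S)%E by apply: ereal_sup_ubound; exists n, i, j.
  apply: le_trans XS _; apply: (@le_trans _ _ (fine S)%:E); last first.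
    by rewrite lee_fin le_max lexx.
  by case: (S) N_moment4 => [r _|//|_]; rewrite ?leNye.
have [K K0 NK] := N4; pose v n j := column_variance (N n) j.
have mN n i j : measurable_fun setT (N n i j) by [].
have vE n j : v n j = n%:R^-1 * \sum_i \int[P]_t (N n i j t ^+ 2).
  by congr (_ * _); apply: eq_bigr => i _; exact: abs_moment2E.
have v_bounds n (j : 'I_(p n)) : 0 <= v n j <= 1 + K.
  have b i : 0 <= \int[P]_t (N n i j t ^+ 2) <= 1 + K.
    have [i4 b4] := NK n i j; have [_ /andP[-> h]] := second_moment_bounds (mN n i j) i4.
    by rewrite (le_trans h)// lerD2l.
  rewrite vE; apply/andP; split.
    by rewrite mulr_ge0 ?invr_ge0// sumr_ge0// => i _; have /andP[] := b i.
  have [n0|n0] := posnP n.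
    rewrite big1 ?mulr0 ?addr_ge0// => i _; exfalso; case: (i) => m; by rewrite {1}n0.
  rewrite ler_pdivrMl ?ltr0n// mulr_natl -[n in leRHS]card_ord -sumr_const.
  by apply: ler_sum => i _; have /andP[] := b i.
have C0 : 0 <= 1 + K by rewrite addr_ge0.
have col_inj n (j : 'I_(p n)) : injective (fun i : 'I_n => (i, j)) by move=> i i' [].
move=> A Abar.
pose Y n t : 'M[R]_(n, p n) := \matrix_(i, j) N n (s n j t i) j t.
have AE n t : A n t = (Num.sqrt n%:R)^-1 *: Y n t.
  congr (_ *: _); apply/matrixP => i j.
  (* Multiplication by a permutation matrix on the left reads entry [i] of a column at row
     [s n j t i]. *)
  by rewrite mxE [RHS]mxE -row_permE !mxE.
have mY n i j : measurable_fun setT (fun t => Y n t i j).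
  under eq_fun do rewrite mxE.
  exact: (@measurable_permuted_entry _ _ _ P n (p n) (fun i j => N n i j) (s n)).
have Yind n : independent_columns P (Y n).
  exact: (@independent_permuted_columns _ _ _ P n (p n) (fun i j => N n i j) (s n)).
have Yquad n (j : 'I_(p n)) (M : 'M[R]_n) : (0 < n)%N ->
    (\int[P]_t (quad_dev M (v n j) (fun i => Y n t i j) ^+ 2)%:E <=
     ((4 * K + 4 * (1 + K) ^+ 2) * \sum_k \sum_l M k l ^+ 2)%:E)%E.
  have YE t : (fun i => Y n t i j) = (fun i => N n (s n j t i) j t).
    by apply/funext => i; rewrite mxE.
  move=> _; under eq_integral do rewrite vE YE.
  apply: (@permuted_quad_dev_second_moment _ _ _ P n (fun i => N n i j) K (s n j)) => //.
  - exact: (mutually_independent_inj (@col_inj n j) (N_indep n)).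
  - by move=> i; case: (NK n i j).
  - by move=> i; case: (NK n i j).
  - by move=> i; apply: mean_zeroE; exact: N_mean.
  move=> B C BU CU; apply: (s_N_indep n).
    by apply: sub_sigma_algebra; exists j.
  move: CU; apply: sub_sigma_algebra2 => D [i _ iD]; by exists (i, j).
pose Z n t : 'M[R]_(n, p n) := matrix_of (Nbar n) t.
pose Kb : R := 48 * expR ((1 + K) / 2).
have bar n i j : [/\ P.-integrable setT (EFin \o (fun t => Nbar n i j t ^+ 4)),
    \int[P]_t (Nbar n i j t ^+ 4) <= Kb, \int[P]_t Nbar n i j t = 0 &
    \int[P]_t (Nbar n i j t ^+ 2) = v n j].
  have /andP[v0 vK] := v_bounds n j.
  have [h1 h2 h3 h4] := centered_normal_moments v0 (Nbar_law n i j).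
  split => //; apply: le_trans h2 _; rewrite /Kb ler_pM2l// ler_expR.
  by rewrite ler_pM2r.
have mNbar n i j : measurable_fun setT (Nbar n i j) by [].
have mZ n i j : measurable_fun setT (fun t => Z n t i j).
  rewrite (_ : (fun t => Z n t i j) = Nbar n i j)//.
  by apply/funext => t; rewrite mxE.
have Zind n : independent_columns P (Z n).
  exact: (@independent_columns_entries _ _ _ P n (p n) (fun i j => Nbar n i j)).
have Zquad n (j : 'I_(p n)) (M : 'M[R]_n) : (0 < n)%N ->
    (\int[P]_t (quad_dev M (v n j) (fun i => Z n t i j) ^+ 2)%:E <=
     (2 * Kb * \sum_k \sum_l M k l ^+ 2)%:E)%E.
  move=> _.
  have Z4 i := let: And4 h _ _ _ := bar n i j in h.
  have Z4K i := let: And4 _ h _ _ := bar n i j in h.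
  have Z1 i := let: And4 _ _ h _ := bar n i j in h.
  have [i2 h2] := quad_dev_second_moment (fun i => mNbar n i j)
    (mutually_independent_inj (@col_inj n j) (Nbar_indep n)) Z4 Z4K Z1 M.
  rewrite -lee_fin EFin_Rintegral// in h2; apply: le_trans h2.
  rewrite le_eqVlt; apply/orP; left; apply/eqP; apply: eq_integral => t _.
  congr (_ ^+ 2)%:E; rewrite /quad_dev mulr_sumr; congr (_ - _).
    by apply: eq_bigr => k _; apply: eq_bigr => l _; rewrite !mxE.
  by apply: eq_bigr => k _; case: (bar n k j) => _ _ _ ->; rewrite mulrC.
have aeY := as_esd_gram_cvg gamma_gt0 C0 p_oo p_ratio v_bounds v_cvg mY Yind Yquad.
have aeZ := as_esd_gram_cvg gamma_gt0 C0 p_oo p_ratio v_bounds v_cvg mZ Zind Zquad.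
(* The law is taken from one realization of the permuted matrix. The uniqueness clause of
   [generalized_MP] identifies it with the limit in all others, and for the Gaussian matrix too, as
   the equation only involves [gamma] and [H]. *)
have [t0 [mu [MPmu _]]] := ae_probability_ex aeY.
have to_mu (mu_ : nat -> T -> {measure set R -> \bar R}) :
    {ae P, forall t, exists mu' : probability R R, generalized_MP gamma H mu' /\
      weakly_converges (fun n => mu_ n t) mu'} -> as_weakly_converges P mu_ mu.
  apply: filterS => t [mu' [MPmu' h]] f cf bf.
  rewrite (@Rintegral_eq_measure _ mu mu')//; first exact: h.
  by move=> B mB; exact: (MPmu'.2 mu MPmu.1 B mB).
have cA : as_weakly_converges P (fun n t => esd (A n t *m (A n t)^T)) mu.
  apply: (to_mu (fun n t => esd (A n t *m (A n t)^T))).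
  move: aeY; apply: filterS => t [mu' [MPmu' h]].
  exists mu'; split; first exact: MPmu'.
  have -> : (fun n => esd (A n t *m (A n t)^T)) = (fun n => esd
      (((Num.sqrt n%:R)^-1 *: Y n t) *m ((Num.sqrt n%:R)^-1 *: Y n t)^T)).
    by apply/funext => n; rewrite AE.
  exact: h.
have cAbar : as_weakly_converges P (fun n t => esd (Abar n t *m (Abar n t)^T)) mu.
  exact: (to_mu (fun n t => esd (Abar n t *m (Abar n t)^T)) aeZ).
have msq : measurable_fun setT (@Num.sqrt R).
  by apply: continuous_measurable_fun; exact: sqrt_continuous.
pose sq : {mfun R >-> R} := HB.pack (@Num.sqrt R) (isMeasurableFun.Build _ _ _ _ _ msq).
split; last by exists mu.
exists (distribution mu sq); split.
  by move: cA; apply: filterS => t; exact: esvd_cvg.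
by move: cAbar; apply: filterS => t; exact: esvd_cvg.
Qed.
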